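(* Let $L\cong\mathbb{Z}^n$ be a lattice with $\mathbb{Z}$-basis $v_1,\dots,v_n$, let $\Lambda$ be a lattice of rank $k$, let $\psi:L\to\Lambda$ be a homomorphism with finite cokernel, and let $\Sigma$ be a subfan of the first orthant fan in $L_{\mathbb{R}}$ (the fan of all faces of $\sum_{i=1}^n\mathbb{R}_{\ge0}v_i$). Let $U_\Sigma\subseteq\mathbb{C}^n$ be the corresponding open toric subvariety. Then the corresponding HHL complex $$0\rightarrow\bigoplus_{\sigma\in S_{k}} \mathcal{O}_{U_{\Sigma}}\, e_{\sigma} \rightarrow \cdots \rightarrow \bigoplus_{\sigma\in S_{1}} \mathcal{O}_{U_{\Sigma}}\, e_{\sigma} \rightarrow \bigoplus_{\sigma\in S_{0}} \mathcal{O}_{U_{\Sigma}}\, e_{\sigma}\rightarrow0$$ is a resolution of the restriction of $i_*\mathcal{O}_Y$ to $U_\Sigma\subseteq\mathbb{C}^n$ (that is, its homology vanishes except in degree $0$, where it is isomorphic to $(i_*\mathcal{O}_Y)|_{U_\Sigma}$), where $Y=\operatorname{Spec}\mathbb{C}[C\cap M]$ and $i:Y\to\mathbb{C}^n$ is the natural morphism.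
   Context: Stratifications. Let $\Lambda^*=\operatorname{Hom}(\Lambda,\mathbb{Z})$, $\Lambda^*_{\mathbb{R}}=\operatorname{Hom}(\Lambda,\mathbb{R})\cong\mathbb{R}^k$, and $T=\Lambda^*_{\mathbb{R}}/\Lambda^*$. For $i=1,\dots,n$ let $H_i:\Lambda^*_{\mathbb{R}}\to\mathbb{R}$, $H_i(f)=f(\psi(v_i))$. The hyperplanes $\{H_i=a\}$, $a\in\mathbb{Z}$, $1\le i\le n$, form a $\Lambda^*$-periodic hyperplane arrangement and induce a stratification $\widetilde S$ of $\Lambda^*_{\mathbb{R}}$: two points $x,y$ are in the (relative interior of the) same stratum iff for every $i$ either $H_i(x)=H_i(y)\in\mathbb{Z}$ or $H_i(x),H_i(y)$ lie in the same open interval $(a,a+1)$ with $a\in\mathbb{Z}$. It descends to a stratification $S$ of $T$ (the Bondal stratification), whose strata are the images of the strata of $\widetilde S$. Let $S_m$, $\widetilde S_m$ be the sets of $m$-dimensional strata. Since $\operatorname{coker}\psi$ is finite, the strata of $\widetilde S$ are bounded convex polytopes. For $\widetilde\sigma\in\widetilde S$, $H_i(\widetilde\sigma)$ denotes the value of $H_i$ at an arbitrary point of the relative interior of $\widetilde\sigma$; the integer $\lceil H_i(\widetilde\sigma)\rceil$ does not depend on the point. Open set. A subfan $\Sigma$ of the first orthant fan defines the toric variety $U_\Sigma\subseteq\mathbb{C}^n$, the open subset of points $x=(x_1,\dots,x_n)$ whose set of zero coordinates lies in a cone of $\Sigma$, i.e. such that $\operatorname{Cone}(v_i: x_i=0)\in\Sigma$.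 HHL complex. Fix orientations of all strata of $S$; these induce orientations of all their lifts in $\widetilde S$. For $\sigma\in S_m$ choose any lift $\widetilde\sigma\in\widetilde S_m$. The differential is the $\mathcal{O}_{U_\Sigma}$-linear map $$d(e_\sigma)=\sum_{\widetilde\tau}\operatorname{sgn}(\widetilde\sigma,\widetilde\tau)\prod_{i=1}^n x_i^{\lceil H_i(\widetilde\sigma)\rceil-\lceil H_i(\widetilde\tau)\rceil}\,e_\tau,$$ where $\widetilde\tau$ runs over all facets ($(m-1)$-dimensional faces) of $\widetilde\sigma$, $\tau\in S_{m-1}$ is the image of $\widetilde\tau$ in $T$, and $\operatorname{sgn}(\widetilde\sigma,\widetilde\tau)=1$ if the orientations of $\widetilde\sigma$ and $\widetilde\tau$ are compatible (as in the cellular boundary map) and $-1$ otherwise. The exponents are $0$ or $1$. The complex does not depend on the choice of lifts, and different orientations give isomorphic complexes. The term indexed by $S_m$ is in homological degree $m$. The scheme $Y$. Let $L^*=\operatorname{Hom}(L,\mathbb{Z})$ with dual basis $v_1^*,\dots,v_n^*$, and regard $\Lambda^*$ as a subgroup of $L^*$ via the (injective) dual map $\psi^*$. Set $M=L^*/\Lambda^*$, a finitely generated abelian group, possibly with torsion. Let $M_{\mathbb{R}}=M\otimes\mathbb{R}=L^*_{\mathbb{R}}/\Lambda^*_{\mathbb{R}}$. $C\cap M$ denotes the subsemigroup of those $m\in M$ whose image in $M_{\mathbb{R}}$ lies in the image of the orthant $\sum_{i=1}^n\mathbb{R}_{\ge0}v_i^*\subseteq L^*_{\mathbb{R}}$ under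 $L^*_{\mathbb{R}}\to M_{\mathbb{R}}$. $Y=\operatorname{Spec}\mathbb{C}[C\cap M]$ is called a generalized affine toric variety. The natural morphism $i:Y\to\mathbb{C}^n=\operatorname{Spec}\mathbb{C}[x_1,\dots,x_n]$ corresponds to the ring homomorphism sending $x_i$ to the basis element of the class of $v_i^*$ in $M$. *)

(* Defs.v *)
From HB Require Import structures.
From mathcomp Require Import all_boot all_order all_algebra.
From mathcomp Require Import generic_quotient ring_quotient.
From mathcomp Require Import finmap ring zify complex mpoly.
From mathcomp Require monalg.
From mathcomp Require Import boolp classical_sets cardinality fsbigop.
From mathcomp Require Import reals topology normedtype.

Set Implicit Arguments.
Unset Strict Implicit.
Unset Printing Implicit Defensive.

Import Order.TTheory GRing.Theory Num.Theory.
Import numFieldNormedType.Exports.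

Local Open Scope classical_set_scope.
Local Open Scope ring_scope.
Local Open Scope quotient_scope.

(** ** Affine schemes: prime spectra, localizations, structure sheaves *)

Record Spec (A : comNzRingType) := PrimeIdeal {
  pideal : A -> bool;
  prime_idealP : idealr_closed pideal;
  prime_primeP : prime_idealr_closed pideal }.

HB.instance Definition _ (A : comNzRingType) (p : Spec A) :=
  isIdealr.Build A (pideal p) (prime_idealP p).
HB.instance Definition _ (A : comNzRingType) (p : Spec A) :=
  isPrimeIdealrClosed.Build A (pideal p) (@prime_primeP A p).

Section Localization.
Variables (A : comNzRingType) (p : Spec A).

Definition denom := {s : A | s \notin pideal p}.
Definition dval (s : denom) : A := val s.
Definition fraction := (A * denom)%type.

Definition eqfrac (x y : fraction) : bool :=
  `[< exists2 u, u \notin pideal p & u * (x.1 * dval y.2 - y.1 * dval x.2) = 0 >].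

Lemma denomM (s t : denom) : dval s * dval t \notin pideal p.
Proof. by rewrite prime_idealrM negb_or (valP s) (valP t). Qed.

Lemma denom1 : 1 \notin pideal p.
Proof. by rewrite idealr1. Qed.

Lemma eqfrac_is_equiv : equiv_class_of eqfrac.
Proof.
split=> [x|x y|y x z].
- by apply/asboolP; exists 1; rewrite ?denom1// subrr mulr0.
- apply/asboolP/asboolP => -[u pu h]; exists u => //;
    by rewrite -opprB mulrN h oppr0.
- move=> /asboolP[u pu hu] /asboolP[v pv hv]; apply/asboolP.
  exists (dval y.2 * (u * v)).
    by rewrite !prime_idealrM !negb_or pu pv (valP y.2).
  move: hu hv; case: x y z => [a [s ps]] [b [t pt]] [c [r pr]] /=.
  move=> hu hv.
  have -> : t * (u * v) * (a * r - c * s) =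
      v * r * (u * (a * t - b * s)) + u * s * (v * (b * r - c * t)).
    by rewrite !mulrBr; ring.
  by rewrite hu hv !mulr0 addr0.
Qed.

Canonical eqfrac_equiv := EquivRelPack eqfrac_is_equiv.
Canonical eqfrac_encModRel := defaultEncModRel eqfrac.

Definition local_ring := {eq_quot eqfrac}.
HB.instance Definition _ := EqQuotient.on local_ring.
HB.instance Definition _ := Choice.on local_ring.

Definition dmul (s t : denom) : denom := Sub (dval s * dval t) (denomM s t).
Definition dunit : denom := Sub 1 denom1.

Lemma dval_dmul s t : dval (dmul s t) = dval s * dval t. Proof. by []. Qed.
Lemma dval_dunit : dval dunit = 1. Proof. by []. Qed.
Let valE := (dval_dmul, dval_dunit).

Definition frac (a : A) (s : denom) : local_ring := \pi_local_ring (a, s).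

Lemma frac_eqP a s b t : reflect
  (exists2 u, u \notin pideal p & u * (a * dval t - b * dval s) = 0)
  (frac a s == frac b t).
Proof. by rewrite /frac piE; apply: asboolP. Qed.

Lemma frac_eq a s b t : a * dval t = b * dval s -> frac a s = frac b t.
Proof.
by move=> h; apply/eqP/frac_eqP; exists 1; rewrite ?denom1// h subrr mulr0.
Qed.

Lemma fracP (x : local_ring) : {a & {s | x = frac a s}}.
Proof.
by exists (repr x).1, (repr x).2; rewrite /frac -surjective_pairing reprK.
Qed.

Definition loc_add (x y : local_ring) :=
  let: ((a, s), (b, t)) := (repr x, repr y) in
  frac (a * dval t + b * dval s) (dmul s t).
Definition loc_opp (x : local_ring) := frac (- (repr x).1) (repr x).2.
Definition loc_mul (x y : local_ring) :=
  let: ((a, s), (b, t)) := (repr x, repr y) in frac (a * b) (dmul s t).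

Lemma repr_frac a s :
  exists2 u, u \notin pideal p &
    u * ((repr (frac a s)).1 * dval s - a * dval (repr (frac a s)).2) = 0.
Proof. by apply/frac_eqP; rewrite /frac -surjective_pairing reprK. Qed.

Lemma loc_addE a s b t :
  loc_add (frac a s) (frac b t) = frac (a * dval t + b * dval s) (dmul s t).
Proof.
rewrite /loc_add; case: (repr_frac a s) (repr_frac b t) => u pu hu [v pv hv].
case: (repr _) hu => a' s' /= hu; case: (repr _) hv => b' t' /= hv.
apply/eqP/frac_eqP; exists (u * v); first by rewrite prime_idealrM negb_or pu.
rewrite [LHS](_ : _ = v * dval t * dval t' * (u * (a' * dval s - a * dval s')) +
  u * dval s * dval s' * (v * (b' * dval t - b * dval t'))); last first.
  by rewrite !valE; ring.
by rewrite hu hv !mulr0 addr0.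
Qed.

Lemma loc_oppE a s : loc_opp (frac a s) = frac (- a) s.
Proof.
rewrite /loc_opp; case: (repr_frac a s) => u pu.
case: (repr _) => a' s' /= hu; apply/eqP/frac_eqP; exists u => //.
by rewrite !mulNr -opprD mulrN hu oppr0.
Qed.

Lemma loc_mulE a s b t :
  loc_mul (frac a s) (frac b t) = frac (a * b) (dmul s t).
Proof.
rewrite /loc_mul; case: (repr_frac a s) (repr_frac b t) => u pu hu [v pv hv].
case: (repr _) hu => a' s' /= hu; case: (repr _) hv => b' t' /= hv.
apply/eqP/frac_eqP; exists (u * v); first by rewrite prime_idealrM negb_or pu.
rewrite [LHS](_ : _ = v * b' * dval t * (u * (a' * dval s - a * dval s')) +
  u * a * dval s' * (v * (b' * dval t - b * dval t'))); last first.
  by rewrite !valE; ring.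
by rewrite hu hv !mulr0 addr0.
Qed.

Let loc0 := frac 0 dunit.
Let loc1 := frac 1 dunit.

Fact loc_addA : associative loc_add.
Proof.
move=> x y z; case: (fracP x) (fracP y) (fracP z) => [a [s ->]] [b [t ->]] [c [r ->]].
by rewrite !loc_addE; apply: frac_eq; rewrite !valE; ring.
Qed.
Fact loc_addC : commutative loc_add.
Proof.
move=> x y; case: (fracP x) (fracP y) => [a [s ->]] [b [t ->]].
by rewrite !loc_addE; apply: frac_eq; rewrite !valE; ring.
Qed.
Fact loc_add0 : left_id loc0 loc_add.
Proof.
move=> x; case: (fracP x) => [a [s ->]].
by rewrite !loc_addE; apply: frac_eq; rewrite !valE; ring.
Qed.
Fact loc_addN : left_inverse loc0 loc_opp loc_add.
Proof.
move=> x; case: (fracP x) => [a [s ->]].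
by rewrite loc_oppE !loc_addE; apply: frac_eq; rewrite !valE; ring.
Qed.
HB.instance Definition _ :=
  GRing.isZmodule.Build local_ring loc_addA loc_addC loc_add0 loc_addN.

Fact loc_mulA : associative loc_mul.
Proof.
move=> x y z; case: (fracP x) (fracP y) (fracP z) => [a [s ->]] [b [t ->]] [c [r ->]].
by rewrite !loc_mulE; apply: frac_eq; rewrite !valE; ring.
Qed.
Fact loc_mulC : commutative loc_mul.
Proof.
move=> x y; case: (fracP x) (fracP y) => [a [s ->]] [b [t ->]].
by rewrite !loc_mulE; apply: frac_eq; rewrite !valE; ring.
Qed.
Fact loc_mul1 : left_id loc1 loc_mul.
Proof.
move=> x; case: (fracP x) => [a [s ->]].
by rewrite !loc_mulE; apply: frac_eq; rewrite !valE; ring.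
Qed.
Fact loc_mulD : left_distributive loc_mul +%R.
Proof.
move=> x y z; case: (fracP x) (fracP y) (fracP z) => [a [s ->]] [b [t ->]] [c [r ->]].
have addE (u v : local_ring) : u + v = loc_add u v by [].
by rewrite !addE !(loc_mulE, loc_addE); apply: frac_eq; rewrite !valE; ring.
Qed.
Fact loc_1neq0 : loc1 != 0.
Proof.
apply/negP => /frac_eqP[u pu]; rewrite mul0r subr0 dval_dunit !mulr1 => u0.
by rewrite u0 rpred0 in pu.
Qed.
HB.instance Definition _ := GRing.Zmodule_isComNzRing.Build local_ring
  loc_mulA loc_mulC loc_mul1 loc_mulD loc_1neq0.
End Localization.

Arguments frac {A p} a s.

Section StructureSheaf.
Variable A : comNzRingType.

Definition zariski_open (V : set (Spec A)) :=
  exists E : set A, V = [set p : Spec A | exists2 a, E a & a \notin pideal p].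

(** A section over [V] is represented by a family indexed by the whole of
    [Spec A]; only its restriction to [V] is meaningful, so that restriction to a
    smaller open set is the identity on representatives. *)
Definition germs := forall p : Spec A, local_ring p.

Definition const_germ (a : A) : germs := fun p => frac a (dunit p).

Definition regular (V : set (Spec A)) (s : germs) :=
  forall p, V p -> exists W, [/\ zariski_open W, W p, W `<=` V &
    exists a b : A, forall q, W q ->
      exists bq : b \notin pideal q, s q = frac a (Sub b bq)].

End StructureSheaf.

Section SpecMap.
Variables (A B : comNzRingType) (f : {rmorphism A -> B}).

Section Point.
Variable q : Spec B.

Definition preim_ideal : {pred A} := fun a => f a \in pideal q.

Fact preim_ideal_closed : idealr_closed preim_ideal.
Proof.
have [q0 q1 qD] := prime_idealP q; split; rewrite ?unfold_in ?rmorph0 ?rmorph1//.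
by move=> a u v qu qv; rewrite unfold_in rmorphD rmorphM; apply: qD.
Qed.

Fact preim_ideal_prime : prime_idealr_closed preim_ideal.
Proof. by move=> u v; rewrite !unfold_in rmorphM; apply: prime_primeP. Qed.

Definition spec_map : Spec A := PrimeIdeal preim_ideal_closed preim_ideal_prime.

Definition denom_map (s : denom spec_map) : denom q := Sub (f (val s)) (valP s).

Definition local_map (x : local_ring spec_map) : local_ring q :=
  frac (f (repr x).1) (denom_map (repr x).2).

Lemma local_mapE a s : local_map (frac a s) = frac (f a) (denom_map s).
Proof.
have [u pu hu] := repr_frac a s; apply/eqP/frac_eqP; exists (f u) => //.
by rewrite -!rmorphM -rmorphB -rmorphM hu rmorph0.
Qed.
End Point.

Definition pullback (s : germs A) : germs B :=
  fun q => local_map (s (spec_map q)).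

End SpecMap.

(** ** Complexes of free sheaves on an open subset of a spectrum *)

Section Resolution.
Variables (A B : comNzRingType) (f : {rmorphism A -> B}) (U : set (Spec A)).

(** The [I m] are meant to be finite: [I m -> germs A] then represents sections
    of the direct sum of copies of the structure sheaf indexed by [I m]. Below they
    are the sets of strata, whose finiteness is [finite_strata]. *)
Variables (I : nat -> choiceType) (D : forall m, I m.+1 -> I m -> A).

Definition free_section (J : Type) (V : set (Spec A)) (s : J -> germs A) :=
  forall j, regular V (s j).

Definition pushforward_section (V : set (Spec A)) (t : germs B) :=
  regular (@spec_map A B f @^-1` V) t.

(** [d (e_i) = \sum_j D i j e_j] *)
Definition free_diff m (s : I m.+1 -> germs A) : I m -> germs A := fun j p =>
  \sum_(i \in [set: I m.+1]) const_germ (D i j) p * s i p.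

Definition is_cycle m (V : set (Spec A)) (s : I m.+1 -> germs A) :=
  forall j p, V p -> free_diff s j p = 0.

(** Membership in the image sheaf, which is a local condition. *)
Definition is_boundary m (V : set (Spec A)) (s : I m -> germs A) :=
  forall p, V p -> exists W (t : I m.+1 -> germs A),
    [/\ zariski_open W, W p, W `<=` V, free_section W t &
      forall j q, W q -> free_diff t j q = s j q].

Definition exact_at_succ m := forall V (s : I m.+1 -> germs A),
  zariski_open V -> V `<=` U -> free_section V s ->
  is_cycle V s <-> is_boundary V s.

Definition sheaf_morphism
    (eps : set (Spec A) -> (I 0 -> germs A) -> germs B) :=
  [/\ forall V s, zariski_open V -> V `<=` U -> free_section V s ->
        pushforward_section V (eps V s),
      forall V W s t, zariski_open V -> V `<=` U -> free_section V s ->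
        zariski_open W -> W `<=` V -> free_section W t ->
        (forall j p, W p -> s j p = t j p) ->
        forall q, W (spec_map f q) -> eps V s q = eps W t q &
      forall V (a : germs A) s t, zariski_open V -> V `<=` U -> regular V a ->
        free_section V s -> free_section V t ->
        forall q, V (spec_map f q) ->
        eps V (fun j p => a p * s j p + t j p) q =
          pullback f a q * eps V s q + eps V t q].

Definition sheaf_surjective
    (eps : set (Spec A) -> (I 0 -> germs A) -> germs B) :=
  forall V t, zariski_open V -> V `<=` U -> pushforward_section V t ->
  forall p, V p -> exists W s, [/\ zariski_open W, W p, W `<=` V,
    free_section W s & forall q, W (spec_map f q) -> eps W s q = t q].

(** The cokernel of [d_1] is isomorphic to [f_* O] over [U]: there is an epimorphism
    of sheaves of modules [F_0 -> f_* O] whose kernel is the image of [d_1]. *)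
Definition is_resolution_of_pushforward :=
  (forall m, exact_at_succ m) /\
  exists eps, [/\ sheaf_morphism eps, sheaf_surjective eps &
    forall V (s : I 0 -> germs A),
      zariski_open V -> V `<=` U -> free_section V s ->
      (forall q, V (spec_map f q) -> eps V s q = 0) <-> is_boundary V s].

End Resolution.

(** ** Monoid algebras
    The product of [{malg F[K]}] in the library requires [K] to have no nontrivial
    units, which fails for the monoids considered here. *)

Section MonoidAlgebra.
Import monalg.
Variables (K : nmodType) (F : comNzRingType).

Definition monoid_algebra := {malg F[K]}.
HB.instance Definition _ := GRing.Zmodule.on monoid_algebra.

Implicit Types (g : monoid_algebra) (k : K).

Local Notation msupp := (@monalg.msupp K F).
Local Notation msuppU_le := monalg.msuppU_le.
Local Notation "<< c *g k >>" := (@monalg.mkmalgU K F k c) : ring_scope.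
Local Notation "g @_ k" := (@monalg.mcoeff K F k g) : ring_scope.

Definition ma_monomial (c : F) k : monoid_algebra := << c *g k >>.

Definition ma_mul g1 g2 : monoid_algebra :=
  \sum_(k1 <- msupp g1) \sum_(k2 <- msupp g2) << g1@_k1 * g2@_k2 *g (k1 + k2)%R >>.

Lemma ma_mulw (d1 d2 : {fset K}) g1 g2 :
  (msupp g1 `<=` d1)%fset -> (msupp g2 `<=` d2)%fset ->
  ma_mul g1 g2 =
    \sum_(k1 <- d1) \sum_(k2 <- d2) << g1@_k1 * g2@_k2 *g (k1 + k2)%R >>.
Proof.
move=> le_d1 le_d2; rewrite /ma_mul (big_fset_incl _ le_d1) /=.
  apply/eq_bigr=> k1 _; apply/big_fset_incl => // k _ /monalg.mcoeff_outdom ->.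
  by rewrite mulr0 monalg.monalgU0.
move=> k _ /monalg.mcoeff_outdom g1k.
by rewrite big1 => // k' _; rewrite g1k mul0r monalg.monalgU0.
Qed.

Lemma ma_mulC : commutative ma_mul.
Proof.
move=> g1 g2; rewrite /ma_mul exchange_big; apply: eq_bigr => k2 _.
by apply: eq_bigr => k1 _; rewrite mulrC addrC.
Qed.

Lemma ma_mulUU c1 c2 k1 k2 :
  ma_mul << c1 *g k1 >> << c2 *g k2 >> = << c1 * c2 *g (k1 + k2)%R >>.
Proof.
by rewrite (ma_mulw msuppU_le msuppU_le) !big_seq_fset1 !monalg.mcoeffUU.
Qed.

Lemma ma_mul1 : left_id (ma_monomial 1 0) ma_mul.
Proof.
move=> g; rewrite (ma_mulw msuppU_le (fsubset_refl _)) big_seq_fset1.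
rewrite [RHS]monalg.monalgE; apply: eq_bigr => k _.
by rewrite monalg.mcoeffUU mul1r add0r.
Qed.

Lemma ma_mulDl : left_distributive ma_mul +%R.
Proof.
move=> g1 g2 g; rewrite (ma_mulw (monalg.msuppD_le _ _) (fsubset_refl _)).
rewrite (ma_mulw (fsubsetUl (msupp g1) (msupp g2)) (fsubset_refl _)).
rewrite (ma_mulw (fsubsetUr (msupp g1) (msupp g2)) (fsubset_refl _)).
rewrite -big_split /=; apply/eq_bigr=> k1 _.
rewrite -big_split /=; apply/eq_bigr=> k2 _.
by rewrite monalg.mcoeffD mulrDl monalg.monalgUD.
Qed.

Lemma ma_mulDr : right_distributive ma_mul +%R.
Proof. by move=> g g1 g2; rewrite ![ma_mul g _]ma_mulC ma_mulDl. Qed.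

Lemma ma_mul0 : left_zero 0 ma_mul.
Proof. by move=> g; rewrite /ma_mul monalg.msupp0 big_seq_fset0. Qed.

Lemma ma_mulA : associative ma_mul.
Proof.
have m0r g : ma_mul g 0 = 0 by rewrite ma_mulC ma_mul0.
have mEl g1 g2 : ma_mul g1 g2 = \sum_(k <- msupp g1) ma_mul << g1@_k *g k >> g2.
  rewrite {1}[g1]monalg.monalgE.
  by rewrite (big_morph (ma_mul^~ g2) (fun x y => ma_mulDl x y g2) (ma_mul0 g2)).
have mEr g1 g2 : ma_mul g1 g2 = \sum_(k <- msupp g2) ma_mul g1 << g2@_k *g k >>.
  by rewrite ma_mulC mEl; apply: eq_bigr => k _; rewrite ma_mulC.
move=> g1 g2 g3.
rewrite (mEl g1) [in RHS](mEl g1).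
rewrite (big_morph (ma_mul^~ _) (fun x y => ma_mulDl x y _) (ma_mul0 _)).
apply: eq_bigr => k1 _; rewrite (mEl g2) (mEr _ g2).
rewrite (big_morph (ma_mul _) (fun x y => ma_mulDr _ x y) (m0r _)).
rewrite (big_morph (ma_mul^~ _) (fun x y => ma_mulDl x y _) (ma_mul0 _)).
apply: eq_bigr => k2 _; rewrite (mEr _ g3) [RHS]mEr.
rewrite (big_morph (ma_mul _) (fun x y => ma_mulDr _ x y) (m0r _)).
by apply: eq_bigr => k3 _; rewrite !ma_mulUU mulrA addrA.
Qed.

Lemma ma_1neq0 : ma_monomial 1 0 != 0.
Proof. by rewrite monalg.monalgU_eq0 oner_eq0. Qed.

HB.instance Definition _ := GRing.Zmodule_isComNzRing.Build monoid_algebra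
  ma_mulA ma_mulC ma_mul1 ma_mulDl ma_1neq0.

Definition ma_const (c : F) : monoid_algebra := ma_monomial c 0.

Fact ma_const_is_zmod_morphism : zmod_morphism ma_const.
Proof. by move=> c d; rewrite /ma_const /ma_monomial monalg.monalgUB. Qed.
Fact ma_const_is_monoid_morphism : monoid_morphism ma_const.
Proof.
by split=> // c d; rewrite [RHS]ma_mulUU addr0.
Qed.
HB.instance Definition _ :=
  GRing.isZmodMorphism.Build F monoid_algebra ma_const ma_const_is_zmod_morphism.
HB.instance Definition _ :=
  GRing.isMonoidMorphism.Build F monoid_algebra ma_const
    ma_const_is_monoid_morphism.

Definition ma_char k : monoid_algebra := ma_monomial 1 k.
End MonoidAlgebra.

(** ** The lattice data
    [L = Z^n] and [Lambda = Z^k] are spaces of row vectors, and [psi] is the matrix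
    whose [i]-th row is the image of the basis vector [v_i], so that [psi] acts by
    [u |-> u *m psi]. In the dual bases, [Lambda^* = Z^k], [L^* = Z^n] and the
    dual map is [f |-> f *m psi^T]. *)

Section Cokernel.
Variables (m n : nat) (A : 'M[int]_(m, n)).

Definition row_lattice : {pred 'rV[int]_n} :=
  fun u => `[< exists w : 'rV[int]_m, u = w *m A >].

Fact row_lattice_closed : zmod_closed row_lattice.
Proof.
split=> [|u v /asboolP[w ->] /asboolP[w' ->]]; apply/asboolP.
  by exists 0; rewrite mul0mx.
by exists (w - w'); rewrite mulmxBl.
Qed.
HB.instance Definition _ :=
  GRing.isZmodClosed.Build 'rV[int]_n row_lattice row_lattice_closed.

Definition coker := Quotient.quot row_lattice.
HB.instance Definition _ := GRing.Zmodule.on coker.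
HB.instance Definition _ := EqQuotient.on coker.
End Cokernel.

Section Stratification.
Variables (R : realType) (n k : nat) (psi : 'M[int]_(n, k)).

Local Notation V := 'rV[R]_k.

Definition int_vector : {pred V} :=
  fun x => `[< exists w : 'rV[int]_k, x = map_mx intr w >].

Fact int_vector_closed : zmod_closed int_vector.
Proof.
split=> [|u v /asboolP[w ->] /asboolP[w' ->]]; apply/asboolP.
  by exists 0; rewrite map_mx0.
by exists (w - w'); rewrite map_mxB.
Qed.
HB.instance Definition _ :=
  GRing.isZmodClosed.Build V int_vector int_vector_closed.

Definition torus := Quotient.quot int_vector.
HB.instance Definition _ := GRing.Zmodule.on torus.
HB.instance Definition _ := EqQuotient.on torus.

Definition eval_psi (i : 'I_n) (x : V) : R := (x *m (map_mx intr psi)^T) 0 i.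

Definition same_stratum (x y : V) := forall i,
  (eval_psi i x = eval_psi i y /\ eval_psi i x \is a Num.int) \/
  exists a : int, a%:~R < eval_psi i x < (a + 1)%:~R /\
    a%:~R < eval_psi i y < (a + 1)%:~R.

(** Strata are identified with their relative interiors. *)
Definition stratum (s : set V) := exists x, s = [set y | same_stratum x y].

(** The rows of [b] form an ordered basis of the direction of the affine hull of
    [s], i.e. of the smallest linear subspace containing all differences of points
    of [s]. *)
Definition direction_basis m (b : 'M[R]_(m, k)) (s : set V) :=
  row_free b /\ forall W : 'M[R]_k,
    (b <= W)%MS <-> (forall x y, s x -> s y -> (y - x <= W)%MS).

Definition strata_up m : set (set V) :=
  [set s | stratum s /\ exists b : 'M[R]_(m, k), direction_basis b s].

Definition strata m : set (set torus) :=
  [set \pi_torus @` s | s in strata_up m].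

Definition facet m (s t : set V) := strata_up m t /\ t `<=` closure s.

Lemma same_stratumE x y : same_stratum x y <-> forall i,
  Num.floor (eval_psi i x) = Num.floor (eval_psi i y) /\
  (eval_psi i x \is a Num.int) = (eval_psi i y \is a Num.int).
Proof.
split=> h i; case: (h i).
- by case=> ->.
- case=> a [/andP[ax xa] /andP[ay ya]].
  have fx : Num.floor (eval_psi i x) = a by apply: floor_def; rewrite ltW.
  have fy : Num.floor (eval_psi i y) = a by apply: floor_def; rewrite ltW.
  by rewrite !intrEfloor fx fy lt_eqF// lt_eqF.
- rewrite !intrEfloor => fE iE.
  have [xi|xi] := boolP ((Num.floor (eval_psi i x))%:~R == eval_psi i x).
    left; split=> //.
    by move: (xi); rewrite iE => /eqP <-; rewrite -fE (eqP xi).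
  right; exists (Num.floor (eval_psi i x)); move: (xi); rewrite iE => yi.
  split; rewrite lt_neqAle ?xi ?floor_itv//.
  by rewrite fE yi floor_itv.
Qed.

Lemma finite_bounded_strata (N : nat) : finite_set [set s : set V |
  exists2 x, s = [set y | same_stratum x y] &
    forall i, `|Num.floor (eval_psi i x)| <= N%:Z].
Proof.
pose g (e : {ffun 'I_n -> 'I_(N + N).+1 * bool}) : set V := [set y | forall i,
  Num.floor (eval_psi i y) = (e i).1%:Z - N%:Z /\
  (eval_psi i y \is a Num.int) = (e i).2].
apply: (@sub_finite_set _ _ (range g)); last exact/finite_image/finite_finset.
move=> s [x -> xN].
exists [ffun i => (inord (absz (Num.floor (eval_psi i x) + N%:Z)),
                   eval_psi i x \is a Num.int)] => //.
apply/seteqP; split=> y; rewrite /g /=.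
  move=> h; apply/same_stratumE => i; have := h i; rewrite ffunE /=.
  by have := xN i; rewrite ler_norml => /andP[? ?] [-> ->]; rewrite inordK; lia.
move=> /same_stratumE h i; have [<- <-] := h i; rewrite ffunE /=.
by have := xN i; rewrite ler_norml => /andP[? ?]; rewrite inordK; lia.
Qed.

Lemma eval_psiD i x y : eval_psi i (x + y) = eval_psi i x + eval_psi i y.
Proof. by rewrite /eval_psi mulmxDl mxE. Qed.

Lemma eval_psi_int i (w : 'rV[int]_k) : eval_psi i (map_mx intr w) \is a Num.int.
Proof.
rewrite /eval_psi mxE; apply: rpred_sum => j _.
by rewrite !mxE rpredM// intr_int.
Qed.

Lemma continuous_eval_psi i : continuous (eval_psi i).
Proof.
have -> : eval_psi i = fun x : V => \sum_j x 0 j * (psi i j)%:~R.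
  by apply/funext => x; rewrite /eval_psi mxE; apply: eq_bigr => j _; rewrite !mxE.
apply: continuous_big => [|j _ x]; first exact: add_continuous.
have := @coord_continuous R 1 k 0 j x.
by move/cvgM; apply; exact: cvg_cst.
Qed.

Lemma same_stratumDint x y (w : 'rV[int]_k) : same_stratum x y ->
  same_stratum (x + map_mx intr w) (y + map_mx intr w).
Proof.
move=> /same_stratumE h; apply/same_stratumE => i; have [hf hi] := h i.
have wi := eval_psi_int i w; rewrite !eval_psiD !floorDrz// hf; split=> //.
by rewrite !rpredDr.
Qed.

(** The two finiteness lemmas below ensure that the [fsbigop] sums over strata and
    over facets are genuine sums. *)
Lemma finite_strata m : finite_set (strata m).
Proof.
pose N := (\max_i \sum_j `|psi i j|)%N.
have := finite_image (fun s => \pi_torus @` s) (finite_bounded_strata N.+1).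
apply: sub_finite_set => _ [s [[x ->] _] <-].
pose w : 'rV[int]_k := \row_j Num.floor (x 0 j).
have piw (z : V) (v : 'rV[int]_k) : \pi_torus (z + map_mx intr v) = \pi_torus z.
  apply/eqP; rewrite -Quotient.idealrBE addrAC subrr add0r.
  by apply/asboolP; exists v.
have mapN (v : 'rV[int]_k) : map_mx intr (- v) = - map_mx intr v :> V.
  by rewrite map_mxN.
exists [set y | same_stratum (x - map_mx intr w) y].
  exists (x - map_mx intr w) => // i.
  have : `|eval_psi i (x - map_mx intr w)| <= N%:R.
    rewrite /eval_psi mxE; apply: (le_trans (ler_norm_sum _ _ _)).
    apply: (@le_trans _ _ (\sum_j (absz (psi i j))%:R)); last first.
      by rewrite -natr_sum ler_nat; exact: (leq_bigmax i).
    apply: ler_sum => j _; rewrite !mxE normrM natr_absz intr_norm.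
    rewrite ler_piMl// ger0_norm ?subr_ge0 ?floor_le//.
    by have /andP[_ /ltW] := floor_itv (x 0 j); rewrite intrD -lerBlDl.
  rewrite ler_norml => /andP[lo hi].
  have : - N%:Z <= Num.floor (eval_psi i (x - map_mx intr w)).
    by rewrite floor_ge_int rmorphN.
  have : Num.floor (eval_psi i (x - map_mx intr w)) < N%:Z + 1.
    by rewrite floor_lt_int (le_lt_trans hi)// intrD ltrDl.
  by lia.
apply/seteqP; split=> _ [y /= xy <-].
  exists (y + map_mx intr w); last exact: piw.
  by rewrite -(subrK (map_mx intr w) x); apply: same_stratumDint.
exists (y - map_mx intr w); last by rewrite -mapN piw.
by rewrite -mapN; apply: same_stratumDint.
Qed.


Lemma finite_facets m (s : set V) : stratum s ->
  finite_set [set t | facet m s t].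
Proof.
move=> [x0 ->].
pose N := (\max_i `|Num.floor (eval_psi i x0)|)%N.
apply: sub_finite_set (finite_bounded_strata N.+1).
move=> t [[[x ->] _] tcl]; exists x => // i.
have /tcl xcl : same_stratum x x by apply/same_stratumE.
set a := Num.floor (eval_psi i x0).
have : closure [set y : V | a%:~R <= eval_psi i y /\ eval_psi i y <= (a + 1)%:~R] x.
  apply: closure_subset xcl => y /= /same_stratumE /(_ i) [h _].
  by have := floor_itv (eval_psi i y); rewrite -h => /andP[-> /ltW].
have -> : [set y : V | a%:~R <= eval_psi i y /\ eval_psi i y <= (a + 1)%:~R] =
   eval_psi i @^-1` ([set z | a%:~R <= z] `&` [set z | z <= (a + 1)%:~R]) by [].
rewrite -(closure_id _).1; last first.
  apply: closed_comp; last by apply: closedI; [exact: closed_ge|exact: closed_le].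
  by move=> y _; exact: continuous_eval_psi.
move=> [/= ax xa].
have aN : (`|a| <= N)%N by exact: leq_bigmax.
have ax' : a <= Num.floor (eval_psi i x) by rewrite floor_ge_int.
have : Num.floor (eval_psi i x) < a + 2.
  by rewrite floor_lt_int (le_lt_trans xa)// ltr_int; lia.
lia.
Qed.

Definition ceilH (s : set V) (i : 'I_n) : int := Num.ceil (eval_psi i (xget 0 s)).

(** An orientation of an [m]-dimensional stratum: a sign attached to each ordered
    basis of its direction, changing as the sign of the determinant of the change
    of basis. It only depends on the direction, hence is the same for all lifts. For
    [m = 0], it is a sign. *)
Definition orientation_of m (o : 'M[R]_(m, k) -> int) (s : set V) :=
  forall b, direction_basis b s ->
    (o b = 1 \/ o b = -1) /\
    forall P : 'M[R]_m, P \in unitmx -> o (P *m b) = sgz (\det P) * o b.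

Definition is_orientation
    (o : forall m, strata m -> 'M[R]_(m, k) -> int) :=
  forall m (s : strata m) (s' : set V), strata_up m s' ->
    \pi_torus @` s' = val s -> orientation_of (o m s) s'.

Definition is_lift (lift : forall m, strata m -> set V) :=
  forall m (s : strata m),
    strata_up m (lift m s) /\ \pi_torus @` lift m s = val s.

(** Cellular boundary sign with the convention "outward vector first": for
    [x] in [s], [y] in a facet [t] of [s] and an ordered basis [b] of the direction
    of [t], the vector [y - x] followed by [b] is an ordered basis of the direction
    of [s]; the orientations are compatible iff it has the same sign as [b]. *)
Definition boundary_sgn m
    (os : 'M[R]_(1 + m, k) -> int) (ot : 'M[R]_(m, k) -> int)
    (s t : set V) : int :=
  let b := xget 0 [set b : 'M[R]_(m, k) | direction_basis b t] in
  os (col_mx (xget 0 t - xget 0 s) b) * ot b.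

(** The coefficient of [e_t] in [d e_s], the lift [s'] of [s] being chosen: several
    facets of [s'] may have the same image [t]. The exponents are 0 or 1. *)
Definition hhl_coeff (F : comNzRingType)
    (o : forall m, strata m -> 'M[R]_(m, k) -> int)
    (lift : forall m, strata m -> set V)
    m (s : strata m.+1) (t : strata m) : {mpoly F[n]} :=
  let s' := lift m.+1 s in
  \sum_(t' \in [set t' | facet m s' t' /\ \pi_torus @` t' = val t])
    'X_[F, [multinom absz (ceilH s' i - ceilH t' i) | i < n] ]
      *~ boundary_sgn (o m.+1 s) (o m t) s' t'.

(** ** The generalized affine toric variety *)

Definition dual_coker := coker psi^T.
HB.instance Definition _ := GRing.Zmodule.on dual_coker.
HB.instance Definition _ := EqQuotient.on dual_coker.

(** The image of [L^*] in [M_R = L^*_R / Lambda^*_R] is induced by [map_mx intr]; the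
    class of [u] lies in the image of the orthant iff [u] is the sum of a vector
    [w] of the orthant and an element of [Lambda^*_R]. *)
Definition in_cone : {pred dual_coker} := fun c => `[< exists u : 'rV[int]_n,
  c = \pi_dual_coker u /\ exists (w : 'rV[R]_n) (x : V),
    (forall i, 0 <= w 0 i) /\ map_mx intr u = w + x *m (map_mx intr psi)^T >].

Fact in_cone_closed : Algebra.nmod_closed in_cone.
Proof.
split=> [|c c' /asboolP[u [-> [w [x [w0 e]]]]] /asboolP[u' [-> [w' [x' [w0' e']]]]]].
  apply/asboolP; exists 0; split; first by rewrite raddf0.
  by exists 0, 0; split=> [i|]; rewrite ?mxE// map_mx0 mul0mx addr0.
apply/asboolP; exists (u + u'); split; first by rewrite raddfD.
exists (w + w'), (x + x'); split=> [i|]; first by rewrite mxE addr_ge0.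
by rewrite map_mxD e e' mulmxDl addrACA.
Qed.
HB.instance Definition _ :=
  GRing.isAddClosed.Build dual_coker in_cone in_cone_closed.

Definition CM := {c : dual_coker | in_cone c}.
HB.instance Definition _ := SubChoice.on CM.
HB.instance Definition _ :=
  GRing.SubChoice_isSubNmodule.Build dual_coker in_cone CM in_cone_closed.

Lemma dual_basis_in_cone (i : 'I_n) : in_cone (\pi_dual_coker (delta_mx 0 i)).
Proof.
apply/asboolP; exists (delta_mx 0 i); split=> //; exists (delta_mx 0 i), 0.
split=> [j|]; first by rewrite mxE ler0n.
by rewrite mul0mx addr0; apply/matrixP => a b; rewrite !mxE; case: (_ && _).
Qed.

Definition dual_basis_class (i : 'I_n) : CM :=
  Sub (\pi_dual_coker (delta_mx 0 i)) (dual_basis_in_cone i).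

(** The ring morphism defining [i : Y -> C^n], where [C = R[i]]. *)
Definition Yring := monoid_algebra CM (complex R).

Definition Ymap : {rmorphism {mpoly (complex R)[n]} -> Yring} :=
  mpoly.mmap (@ma_const CM (complex R))
    (fun i => ma_char (complex R) (dual_basis_class i)).

End Stratification.

Arguments coker {m n} A.
Arguments strata R {n k} psi m.
Arguments hhl_coeff {R n k psi} F o lift m s t.
Arguments Ymap R {n k} psi.

(** ** The open set [U_Sigma]
    A face [Cone(v_i : i in J)] of the orthant is represented by [J]. *)

Definition is_subfan (n : nat) (Sigma : {set {set 'I_n}}) :=
  forall J J' : {set 'I_n}, J \in Sigma -> J' \subset J -> J' \in Sigma.

(** On closed points, [x_i \in p] means that the [i]-th coordinate vanishes. *)
Definition U_fan (F : comNzRingType) (n : nat) (Sigma : {set {set 'I_n}}) :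
    set (Spec {mpoly F[n]}) :=
  [set p : Spec {mpoly F[n]} | [set i | 'X_i \in pideal p]%SET \in Sigma].

Arguments U_fan F {n} Sigma.

(* Main.v *)
Require Import Defs.
From mathcomp Require Import all_boot all_order all_algebra.
From mathcomp Require Import ring lra zify.
From mathcomp Require Import finmap complex mpoly.
From mathcomp Require monalg.
From mathcomp Require Import boolp classical_sets cardinality fsbigop.
From mathcomp Require Import reals topology normedtype.

(** The differential and the map to the ring of [Y] are homogeneous for the grading by
    [M = Z^n / Lambda^*]: since [e_sigma] and the exponents involve the integers
    [ceil (H_i)], the monomial [x^(u - ceil (H x))] times [e_sigma] corresponds to the
    stratum of a lift [x] with [H_i x <= u_i] for all [i]; changing the lift changes [u]
    by an element of [Lambda^*]. Hence the part of degree [[u]] of the complex is the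
    cellular chain complex of the polyhedron [P_u = {x | H x <= u}], subdivided by the
    periodic arrangement. This polyhedron is convex, and it is nonempty exactly when
    [[u]] lies in the cone [C], that is when the algebra of [Y] has a one-dimensional
    part of degree [[u]]. So the complex augmented to the algebra of [Y] is exact as
    soon as the augmented cellular chain complexes of the [P_u] are.

    A chain is finite, thus lives in a polytope [-N <= H <= u]. Homogenization,
    [x |-> (1, x)], makes the levels [H_i = a] with [-N <= a <= N] linear hyperplanes,
    the strata cells of a central arrangement, and the polytope a closed cone. The new
    cell [{0}] is a face of all the others, and its coefficient in a boundary is the
    augmentation. It remains to see that the chain complex of a closed cone which is not
    a linear subspace is acyclic, in all degrees ([acyclic_cone]). For a half-space cut
    by its boundary only, there are two cells. Acyclicity survives the addition of a
    hyperplane to the arrangement ([acyclic_refine]), whence the case of all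
    half-spaces. Other cones are intersections of half-spaces, handled by induction on
    their number with a Mayer-Vietoris argument ([mayer_vietoris]). That the boundary
    squares to zero is the usual diamond property: between two cells whose dimensions
    differ by two there are exactly two cells, with opposite signs ([diamond]).

    The comparison of the geometric signs with those of the arrangement is
    [boundary_sgn_inc]; the multigraded pieces are realized by the chain map [push]
    ([push_diff], [push_coef], [push_decomp], [aug_push]), which gives exactness over
    the polynomial ring. The passage to sheaves ([resolution_of_module]) is the usual
    localization argument, with a partition of unity to describe sections over a basic
    open set. It holds over every set of points, in particular over [U_Sigma]. *)

Set Implicit Arguments.
Unset Strict Implicit.
Unset Printing Implicit Defensive.

Import Order.TTheory GRing.Theory Num.Theory.
Import numFieldNormedType.Exports.

Local Open Scope ring_scope.

(** * Orientations and signs *)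

Module Arrangement.
Import mathcomp.boot.fintype mathcomp.boot.finset.

Section Orientation.
Variables (R : realFieldType) (d : nat).

(** A canonical orientation of all subspaces at once. The minor selected by [pick] only
    depends on which maximal minors vanish, so that two bases of the same subspace are
    compared through the same minor. *)
Definition ori m (b : 'M[R]_(m, d)) : int :=
  if [pick f : {ffun 'I_m -> 'I_d} | \det (colsub f b) != 0] is Some f
  then sgz (\det (colsub f b)) else 0.

Lemma oriM m (P : 'M[R]_m) (b : 'M[R]_(m, d)) :
  ori (P *m b) = sgz (\det P) * ori b.
Proof.
have E (f : {ffun 'I_m -> 'I_d}) :
    \det (colsub f (P *m b)) = \det P * \det (colsub f b).
  by rewrite -det_mulmx; congr (\det _); apply/matrixP => i j; rewrite !mxE;
    apply: eq_bigr => l _; rewrite !mxE.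
rewrite /ori; have [P0|P0] := eqVneq (\det P) 0.
  case: pickP => [f|_]; first by rewrite E P0 mul0r eqxx.
  by rewrite P0 sgz0 mul0r.
rewrite (@eq_pick _ _ (fun f : {ffun _} => \det (colsub f b) != 0)); last first.
  by move=> f /=; rewrite E mulf_eq0 (negbTE P0).
by case: pickP => [f _|_]; rewrite ?mulr0// E sgzM.
Qed.

Lemma ori_sqr m (b : 'M[R]_(m, d)) : row_free b -> ori b * ori b = 1.
Proof.
move=> bf; rewrite /ori; case: pickP => [f|nof].
  by rewrite -expr2; case: sgzP; rewrite ?eqxx.
have bT : row_full b^T by rewrite -[row_full _]/(\rank b^T == m) mxrank_tr.
have := nof [ffun i => fullrankfun bT i]; rewrite -det_tr.
have -> : (colsub [ffun i => fullrankfun bT i] b)^T = rowsub (fullrankfun bT) b^T.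
  by apply/matrixP => i j; rewrite !mxE ffunE.
have := fullrowsub_unit bT; rewrite unitmxE unitfE => ->.
by [].
Qed.

Lemma ori_frame m (x : 'rV[R]_d) (b : 'M[R]_(m, d)) a (c : 'rV_m) (P : 'M_m) :
  ori (col_mx (a *: x + c *m b) (P *m b)) = sgz (a * \det P) * ori (col_mx x b).
Proof.
have -> : col_mx (a *: x + c *m b) (P *m b) = block_mx a%:M c 0 P *m col_mx x b.
  by rewrite mul_block_col mul_scalar_mx mul0mx add0r.
by rewrite oriM det_ublock det_scalar1.
Qed.

Lemma ori_frame2 m (x : 'rV[R]_d) (b : 'M[R]_(m, d)) (e : 'cV_m) (P : 'M_m) :
  ori (col_mx x (e *m x + P *m b)) = sgz (\det P) * ori (col_mx x b).
Proof.
have -> : col_mx x (e *m x + P *m b) = block_mx 1%:M 0 e P *m col_mx x b.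
  by rewrite mul_block_col mul1mx mul0mx addr0.
by rewrite oriM det_lblock det1 mul1r.
Qed.

Lemma row_free_col m (x : 'rV[R]_d) (b : 'M[R]_(m, d)) :
  row_free b -> ~~ (x <= b)%MS -> row_free (col_mx x b).
Proof.
move=> /eqP bf xb; rewrite /row_free -addsmxE eqn_leq.
rewrite (leq_trans (mxrank_adds_leqif _ _))/= ?bf ?leq_add2r ?rank_leq_row//.
rewrite add1n -{1}bf ltn_neqAle mxrankS ?addsmxSr ?andbT//.
have [_ ->] := mxrank_leqif_eq (addsmxSr x b).
by apply/negP => /andP[_]; rewrite addsmx_sub (negbTE xb).
Qed.

Lemma basis_change m (b b' : 'M[R]_(m, d)) :
  row_free b' -> (b' <= b)%MS -> exists2 P, P \in unitmx & b' = P *m b.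
Proof.
move=> /eqP b'f /submxP[P eP]; exists P => //.
rewrite -row_free_unit /row_free eqn_leq rank_leq_row/=.
by rewrite -{1}b'f eP mxrankM_maxl.
Qed.

End Orientation.

Section Sign.
Variable R : realFieldType.
Implicit Types r : R.

Definition sg3 r : option bool := if r == 0 then None else Some (0 < r).

Lemma sg3_None r : sg3 r = None <-> r = 0.
Proof. by rewrite /sg3; case: eqP. Qed.

Lemma sg3_pos r : sg3 r = Some true <-> 0 < r.
Proof. by rewrite /sg3; case: ltgtP. Qed.

Lemma sg3_neg r : sg3 r = Some false <-> r < 0.
Proof. by rewrite /sg3; case: ltgtP. Qed.

Lemma sg3Z a r : 0 < a -> sg3 (a * r) = sg3 r.
Proof. by move=> a0; rewrite /sg3 mulf_eq0 gt_eqF// pmulr_rgt0. Qed.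

Lemma sg3D r r' : sg3 r = sg3 r' -> sg3 (r + r') = sg3 r.
Proof.
case E: (sg3 r) => [[]|] /esym E'.
- by apply/sg3_pos/addr_gt0; apply/sg3_pos.
- by apply/sg3_neg; move/sg3_neg: E => E; move/sg3_neg: E' => E'; lra.
- by move/sg3_None: E => ->; move/sg3_None: E' => ->; rewrite addr0; apply/sg3_None.
Qed.

Lemma sg3_small r r' : `|r'| < `|r| -> sg3 (r + r') = sg3 r.
Proof.
rewrite ltr_norml => h; case E: (sg3 r) => [[]|].
- by move/sg3_pos: E => E; apply/sg3_pos; move: h; rewrite gtr0_norm//; lra.
- by move/sg3_neg: E => E; apply/sg3_neg; move: h; rewrite ltr0_norm//; lra.
- by move: h; move/sg3_None: E => ->; rewrite normr0 => /andP[? ?]; exfalso; lra.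
Qed.

End Sign.

(** * Cells of a central hyperplane arrangement *)

Section Cells.
Variables (R : realFieldType) (d : nat) (I : finType) (h : I -> 'cV[R]_d).
Implicit Types (x y z v w : 'rV[R]_d) (B : {set I}).

Definition ev i x : R := (x *m h i) 0 0.

Lemma evD i x y : ev i (x + y) = ev i x + ev i y.
Proof. by rewrite /ev mulmxDl mxE. Qed.
Lemma evZ i a x : ev i (a *: x) = a * ev i x.
Proof. by rewrite /ev -scalemxAl mxE. Qed.
Lemma evN i x : ev i (- x) = - ev i x.
Proof. by rewrite /ev mulNmx mxE. Qed.
Lemma evB i x y : ev i (x - y) = ev i x - ev i y.
Proof. by rewrite evD evN. Qed.
Lemma ev0 i : ev i 0 = 0.
Proof. by rewrite /ev mul0mx mxE. Qed.
Definition evE := (evD, evZ, evN, ev0).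

(** Cells are represented by their sign vectors. The value [None] outside the set [B] of
    hyperplanes in use makes the cells of all subarrangements elements of the same
    finite type. *)
Definition sgnv := {ffun I -> option bool}.
Implicit Types s t : sgnv.

Definition cell B x : sgnv := [ffun i => if i \in B then sg3 (ev i x) else None].

Definition real B s : bool := `[< exists x, s = cell B x >].

Lemma realP B s : reflect (exists x, s = cell B x) (real B s).
Proof. exact: asboolP. Qed.

Lemma real_cell B x : real B (cell B x).
Proof. by apply/realP; exists x. Qed.
Hint Resolve real_cell : core.

Definition pt B s : 'rV[R]_d :=
  if pselect (exists x, s = cell B x) is left ex then sval (cid ex) else 0.

Lemma ptK B s : real B s -> cell B (pt B s) = s.
Proof. by move/realP => ex; rewrite /pt; case: pselect => // ?; case: cid. Qed.

Lemma cell_in B x i : i \in B -> cell B x i = sg3 (ev i x).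
Proof. by rewrite ffunE => ->. Qed.

Lemma cell_notin B x i : i \notin B -> cell B x i = None.
Proof. by rewrite ffunE => /negbTE ->. Qed.

Lemma eq_cellP B x y :
  cell B x = cell B y <-> forall i, i \in B -> sg3 (ev i x) = sg3 (ev i y).
Proof.
split=> [/ffunP e i iB|e]; first by have := e i; rewrite !cell_in.
by apply/ffunP => i; rewrite !ffunE; case: ifP => // /e.
Qed.

Definition dir B s : 'M[R]_d := (\bigcap_(i in B | s i == None) kermx (h i))%MS.

Lemma dirP B s v :
  reflect (forall i, i \in B -> s i = None -> ev i v = 0) (v <= dir B s)%MS.
Proof.
apply: (iffP sub_bigcapmxP) => [H i iB si|H i /andP[iB /eqP si]].
  by have := H i; rewrite iB si eqxx => /(_ isT) /sub_kermxP; rewrite /ev => ->; rewrite mxE.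
apply/sub_kermxP/matrixP => a b; rewrite !ord1 [RHS]mxE; exact: H.
Qed.

Definition dim B s := \rank (dir B s).

Lemma cell_dir B x : (x <= dir B (cell B x))%MS.
Proof. by apply/dirP => i iB; rewrite cell_in// => /sg3_None. Qed.

Definition face t s := [forall i, (t i == None) || (t i == s i)].

Lemma faceP t s : reflect (forall i, t i = None \/ t i = s i) (face t s).
Proof.
apply: (iffP forallP) => H i; have := H i.
  by case/orP => /eqP; [left|right].
by case=> ->; rewrite eqxx ?orbT.
Qed.

Lemma face_trans t s r : face r t -> face t s -> face r s.
Proof.
move=> /faceP a /faceP b; apply/faceP => i.
by case: (a i) => ->; [left|exact: b].
Qed.

Lemma face_dir B t s : face t s -> (dir B t <= dir B s)%MS.
Proof.
move=> /faceP f; apply/row_subP => j; apply/dirP => i iB si.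
have := row_sub j (dir B t) => /dirP; apply=> //.
by case: (f i) => // ->.
Qed.

(** The functionals that vanish at [y] have at [y + e *: x] the sign which they have at
    [x]; the others have the same sign at [x] and at [y]. *)
Lemma face_move B x y e : face (cell B y) (cell B x) -> 0 < e ->
  cell B (y + e *: x) = cell B x.
Proof.
move=> /faceP f e0; apply/eq_cellP => i iB; have := f i; rewrite !cell_in//.
rewrite evD evZ; case=> [/sg3_None ->|E]; first by rewrite add0r sg3Z.
by rewrite sg3D ?sg3Z.
Qed.

Lemma face_dim_eq B s t : real B s -> face t s -> dim B s = dim B t -> s = t.
Proof.
move=> /realP[x ->] f e.
have xt : (x <= dir B t)%MS.
  have [_ E] := mxrank_leqif_eq (face_dir B f).
  move: E; rewrite -/(dim B t) -/(dim B (cell B x)) e eqxx => /esym/andP[_ H].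
  exact: submx_trans (cell_dir B x) H.
apply/ffunP => i; have [//|<-//] := faceP _ _ f i => ti.
rewrite ti; have [iB|iB] := boolP (i \in B); last by rewrite cell_notin.
by rewrite cell_in//; apply/sg3_None; move/dirP: xt; apply.
Qed.

Lemma small_move y v : exists2 e : R, 0 < e &
  forall i, ev i y != 0 -> sg3 (ev i (y + e *: v)) = sg3 (ev i y).
Proof.
(* [S] exceeds all the ratios between the variation along [v] and the value at [y]. *)
pose S := 1 + \sum_i `|ev i v| / `|ev i y|.
have S0 : 0 < S by rewrite ltr_pwDl// sumr_ge0// => i _; rewrite divr_ge0.
exists S^-1; first by rewrite invr_gt0.
move=> i yi; rewrite evD evZ; apply: sg3_small.
rewrite normrM gtr0_norm ?invr_gt0// mulrC ltr_pdivrMr//.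
rewrite mulrC -ltr_pdivrMr ?normr_gt0//.
rewrite /S (bigD1 i)//= addrCA ltrDl ltr_pwDl// sumr_ge0// => j _.
by rewrite divr_ge0.
Qed.

Section Facet.
Variables (B : {set I}) (x : 'rV[R]_d) (t : sgnv).
Let s := cell B x.
Hypotheses (ts : face t s) (dts : dim B s = (dim B t).+1).

Lemma facet_sep : exists i, [/\ i \in B, t i = None & s i <> None].
Proof.
apply: contrapT => H.
have : (dir B s <= dir B t)%MS.
  apply/row_subP => j; apply/dirP => i iB ti.
  have /dirP := row_sub j (dir B s); apply=> //.
  by apply: contrapT => si; apply: H; exists i.
by move/mxrankS; rewrite -/(dim B s) dts ltnn.
Qed.

Lemma facet_notin : ~~ (x <= dir B t)%MS.
Proof.
have [i [iB ti si]] := facet_sep.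
by apply/negP => /dirP/(_ i iB ti) /sg3_None E; apply: si; rewrite /s cell_in.
Qed.

Lemma facet_dir : (dir B s :=: x + dir B t)%MS.
Proof.
apply/eqmxP; rewrite andbC.
have H : (x + dir B t <= dir B s)%MS by rewrite addsmx_sub cell_dir face_dir.
have [_ <-] := mxrank_leqif_eq H.
have L : (dir B t <= x + dir B t)%MS by rewrite addsmxSr.
rewrite eqn_leq mxrankS//= -/(dim B s) dts ltn_neqAle mxrankS ?andbT//.
have [_ ->] := mxrank_leqif_eq L.
by apply/negP => /andP[_]; rewrite addsmx_sub (negbTE facet_notin).
Qed.

(** As the hyperplanes pass through the origin, a point [x] of [s] is also a vector
    transverse to the facet [t]. It serves as a coordinate on the direction of [s],
    positive on [s] by [facet_pos]. *)
Lemma facet_coord v : (v <= dir B s)%MS ->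
  exists a, exists2 u, (u <= dir B t)%MS & v = a *: x + u.
Proof.
rewrite facet_dir => /sub_addsmxP[[a b] /= ->].
exists (a 0 0); exists (b *m dir B t); first exact: submxMl.
by rewrite {1}[a]mx11_scalar mul_scalar_mx.
Qed.

Lemma facet_pos x' a u : cell B x' = s -> (u <= dir B t)%MS -> x' = a *: x + u -> 0 < a.
Proof.
move=> x's /dirP ut e; have [i [iB ti si]] := facet_sep.
have : sg3 (ev i x') = sg3 (ev i x) by move/eq_cellP: x's; apply.
move: si; rewrite /s cell_in// e evD evZ (ut i)// addr0.
case E: (sg3 _) => [[]|] // _.
  by move/sg3_pos: E => xi /sg3_pos; rewrite pmulr_lgt0.
by move/sg3_neg: E => xi /sg3_neg; rewrite nmulr_llt0.
Qed.

End Facet.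

(** A point of [s] points from the facet [t] to the interior of [s]. Followed by a basis
    of the direction of [t], it is a basis of the direction of [s], whose canonical
    orientation is compared with that of [t]. *)
Definition inc B s t : int :=
  if [&& real B s, real B t, face t s & dim B s == (dim B t).+1]
  then ori (col_mx (pt B s) (row_base (dir B t))) * ori (row_base (dir B t))
  else 0.

Lemma inc_neq0 B s t : inc B s t != 0 ->
  [/\ real B s, real B t, face t s & dim B s = (dim B t).+1].
Proof. by rewrite /inc; case: ifP => [/and4P[? ? ? /eqP]|_]; rewrite ?eqxx. Qed.

(** Two points of a cell agree up to a positive factor modulo the direction of the
    facet, and a change of basis of this direction contributes its sign twice. *)
Lemma incE B x t m (b : 'M[R]_(m, d)) :
  real B t -> face t (cell B x) -> dim B (cell B x) = (dim B t).+1 ->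
  row_free b -> (b :=: dir B t)%MS ->
  inc B (cell B x) t = ori (col_mx x b) * ori b.
Proof.
move=> rt f e bf bt; rewrite /inc real_cell rt f e eqxx /=.
have em : m = \rank (dir B t) by rewrite -bt; apply/esym/eqP.
move: (row_base_free (dir B t)) (eq_row_base (dir B t)).
move: (row_base _); rewrite -em => b' b'f b't.
have [||P Pu ->] := @basis_change _ _ _ b b'; rewrite ?b't ?bt//.
set p := pt _ _; have pK : cell B p = cell B x by rewrite /p ptK.
have [|a [u ut pe]] := facet_coord f e (v := p); first by rewrite -pK cell_dir.
have a0 := facet_pos e pK ut pe.
have /submxP[c uc] : (u <= b)%MS by rewrite bt.
rewrite pe uc ori_frame oriM mulrACA sgzM gtr0_sgz// mul1r.
have : sgz (\det P) * sgz (\det P) = 1.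
  by rewrite -expr2; case: sgzP; rewrite // => d0; rewrite unitmxE d0 unitr0 in Pu.
by move=> ->; rewrite mul1r.
Qed.

Lemma facet_frame B z r m (b : 'M[R]_(m, d)) :
  face r (cell B z) -> dim B (cell B z) = (dim B r).+1 ->
  row_free b -> (b :=: dir B r)%MS ->
  row_free (col_mx z b) /\ (col_mx z b :=: dir B (cell B z))%MS.
Proof.
move=> f e bf br; split.
  by apply: row_free_col; rewrite // br (facet_notin e).
apply: eqmx_trans (eqmx_sym (facet_dir f e)).
by apply: eqmx_trans (eqmx_sym (addsmxE _ _)) _; apply: adds_eqmx.
Qed.

(** Modulo the direction of [r], the direction of [s] is a plane with coordinates
    [(a, b)] in the basis [x], [z0]. The functional [i] of [K] (vanishing on [r] but not
    on [s]) has there the value [(a + b * rho i) * ev i x]. So [s] is the sector where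
    all [a + b * rho i] are positive. One of its sides is spanned by [z0], that is by
    [(0, 1)], the other one by [(M, -1)] where [M] is the greatest of the [rho i]. *)
Section Diamond.
Variables (B : {set I}) (x y z0 : 'rV[R]_d).
Let s := cell B x.
Let t0 := cell B z0.
Let r := cell B y.
Hypotheses (ts : face t0 s) (rt : face r t0).
Hypotheses (ds : dim B s = (dim B t0).+1) (dt : dim B t0 = (dim B r).+1).

Let K := [pred i | (i \in B) && (r i == None) && (s i != None)].
Let rho i := ev i z0 / ev i x.

Let xK i : K i -> ev i x != 0.
Proof.
move=> /andP[/andP[iB _]]; apply: contra_neq; rewrite cell_in//.
by move=> ?; apply/sg3_None.
Qed.

Let evK i a b u : K i -> (u <= dir B r)%MS ->
  ev i (a *: x + (b *: z0 + u)) = (a + b * rho i) * ev i x.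
Proof.
move=> Ki /dirP ur; have /andP[/andP[iB /eqP ri] _] := Ki.
rewrite !evE (ur i)// addr0 /rho mulrDl -mulrA divfK//; exact: xK.
Qed.

Let between_coord v : (v <= dir B s)%MS ->
  exists a b, exists2 u, (u <= dir B r)%MS & v = a *: x + (b *: z0 + u).
Proof.
move=> /(facet_coord ts ds)[a [v' /(facet_coord rt dt)[b [u ur ->]] ->]].
by exists a, b, u.
Qed.

Let between_same t t' z z' g u : face r t -> face r t' -> face t s -> face t' s ->
  t = cell B z -> t' = cell B z' -> 0 < g -> (u <= dir B r)%MS ->
  z' = g *: z + u -> t' = t.
Proof.
move=> /faceP rt1 /faceP rt2 _ _ et et' g0 /dirP ur ez.
apply/ffunP => i; have [iB|iB] := boolP (i \in B); last first.
  by rewrite et et' !cell_notin.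
have [ri|ri] := eqVneq (r i) None; last first.
  case: (rt1 i) => [e|<-]; first by rewrite e in ri.
  by case: (rt2 i) => [e|<-//]; rewrite e in ri.
by rewrite et et' !cell_in// ez evD evZ (ur i)// addr0 sg3Z.
Qed.

Let between_ratio t z a b u : face r t -> face t s -> dim B s = (dim B t).+1 ->
  t = cell B z -> (u <= dir B r)%MS -> z = a *: x + (b *: z0 + u) ->
  (forall i, K i -> 0 <= a + b * rho i) /\ (exists2 i, K i & a + b * rho i = 0).
Proof.
move=> rt1 ts1 ds1 et ur ez; split=> [i Ki|].
  have /andP[/andP[iB ri] si] := Ki.
  have : t i = None \/ t i = s i by apply/faceP.
  rewrite et cell_in// ez evK// => -[/sg3_None/eqP|].
    by rewrite mulf_eq0 (negbTE (xK Ki)) orbF => /eqP->.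
  move: si; rewrite /s cell_in//; case E: (sg3 (ev i x)) => [[]|//] _.
    by move/sg3_pos: E => E /sg3_pos; rewrite pmulr_lgt0// => /ltW.
  by move/sg3_neg: E => E /sg3_neg; rewrite nmulr_llt0// => /ltW.
have [i [iB ti si]] := facet_sep ds1.
have Ki : K i.
  rewrite /K /= iB (introN eqP si) andbT /=.
  by case: (faceP _ _ rt1 i) => ->//; rewrite ti.
exists i => //; move: ti; rewrite et cell_in// ez evK// => /sg3_None/eqP.
by rewrite mulf_eq0 (negbTE (xK Ki)) orbF => /eqP.
Qed.

Lemma diamond_point : \sum_t inc B s t * inc B t r = 0.
Proof.
have [i0 [i0B r0 t00]] := facet_sep dt.
have Ki0 : K i0.
  rewrite /K /= i0B r0 eqxx /=; apply/eqP => s0; apply: t00.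
  by case: (faceP _ _ ts i0) => ->.
(* The second side [t2] is reached from the point [y] of [r] in the direction [v2]. *)
have [i2 Ki2 max2] := arg_maxP rho Ki0.
set M := rho i2 in max2.
have z0r : ~~ (z0 <= dir B r)%MS by exact: facet_notin dt.
have xt0 : ~~ (x <= dir B t0)%MS by exact: facet_notin ds.
have z0t0 : (z0 <= dir B t0)%MS by exact: cell_dir.
have rt0 : (dir B r <= dir B t0)%MS by exact: face_dir.
pose v2 := M *: x - z0.
have [e e0 he] := small_move y v2.
pose z2 := y + e *: v2.
pose t2 := cell B z2.
have yr : (y <= dir B r)%MS by exact: cell_dir.
have z2E : z2 = (e * M) *: x + ((- e) *: z0 + y).
  by rewrite /z2 /v2 scalerBr scalerA scaleNr [RHS]addrA [RHS]addrC.
have rt2 : face r t2.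
  apply/faceP => i; have [iB|iB] := boolP (i \in B); last first.
    by left; rewrite /r cell_notin.
  rewrite /r /t2 !cell_in//; have [y0|y0] := eqVneq (ev i y) 0.
    by left; apply/sg3_None.
  by right; rewrite he.
have ts2 : face t2 s.
  apply/faceP => i; have [iB|iB] := boolP (i \in B); last first.
    by left; rewrite /t2 cell_notin.
  have [ri|ri] := eqVneq (r i) None; last first.
    right; have [rN|<-] := faceP _ _ rt2 i; first by rewrite rN in ri.
    by have [rN|->] := faceP _ _ (face_trans rt ts) i; first rewrite rN in ri.
  have [si|si] := eqVneq (s i) None.
    have xi : ev i x = 0 by apply/sg3_None; move: si; rewrite /s cell_in.
    have zi : ev i z0 = 0.
      by case: (faceP _ _ ts i); rewrite ?si /t0 cell_in// => /sg3_None.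
    have yi : ev i y = 0 by apply/sg3_None; move: ri; rewrite /r cell_in.
    by left; rewrite /t2 cell_in// z2E !evE xi zi yi !mulr0 !addr0; apply/sg3_None.
  have Ki : K i by rewrite /K /= iB ri si.
  rewrite /t2 /s !cell_in// z2E evK// mulNr -mulrBr.
  have : 0 <= M - rho i by rewrite subr_ge0; apply: max2.
  rewrite le_eqVlt => /predU1P[<-|rM].
    by left; rewrite mulr0 mul0r; apply/sg3_None.
  by right; rewrite sg3Z// mulr_gt0.
have z2r : ~~ (z2 <= dir B r)%MS.
  apply/negP => z2r.
  have H : (M *: x - z0 <= dir B r)%MS.
    have -> : M *: x - z0 = e^-1 *: (z2 - y).
      by rewrite /z2 addrAC subrr add0r scalerA mulVf ?scale1r// gt_eqF.
    by rewrite scalemx_sub// addmx_sub// eqmx_opp.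
  have Mx : (M *: x <= dir B t0)%MS.
    by rewrite -(subrK z0 (M *: x)) addmx_sub// (submx_trans H).
  have [M0|M0] := eqVneq M 0.
    by move: H; rewrite M0 scale0r sub0r eqmx_opp (negbTE z0r).
  by move: Mx; rewrite eqmx_scale// (negbTE xt0).
have dt2E : (dir B t2 :=: z2 + dir B r)%MS.
  apply/eqmxP/andP; split; last by rewrite addsmx_sub cell_dir face_dir.
  apply/row_subP => j; set v := row j _.
  have vt2 : (v <= dir B t2)%MS by exact: row_sub.
  have [a [b [u ur ve]]] := between_coord (submx_trans vt2 (face_dir B ts2)).
  have : ev i2 v = 0.
    move/dirP: vt2; apply; first by case/andP: Ki2 => /andP[].
    rewrite /t2 cell_in; last by case/andP: Ki2 => /andP[].
    by apply/sg3_None; rewrite z2E evK// -/M mulNr addrC addNr mul0r.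
  rewrite ve evK// => /eqP; rewrite mulf_eq0 (negbTE (xK Ki2)) orbF addr_eq0.
  move=> /eqP ->; apply/sub_addsmxP; have /submxP[c uc] := ur.
  have /submxP[cy yc] := yr.
  exists ((- b / e)%:M, (b / e) *: cy + c) => /=.
  rewrite mul_scalar_mx z2E mulmxDl -scalemxAl -yc -uc -/M.
  by apply/rowP => l; rewrite !mxE; field; rewrite gt_eqF.
have dt2 : dim B t2 = (dim B r).+1.
  have bf := row_base_free (dir B r).
  have := row_free_col bf; move=> /(_ z2); rewrite eq_row_base => /(_ z2r)/eqP.
  by rewrite -addsmxE (adds_eqmx (eqmx_refl z2) (eq_row_base _)) -dt2E.
have ds2 : dim B s = (dim B t2).+1 by rewrite dt2 -dt.
have t20 : t2 != t0.
  apply/negP => /eqP E.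
  have [|a [u ur z2e]] := facet_coord rt dt (v := z2); first by rewrite -/t0 -E cell_dir.
  have a0 := facet_pos dt E ur z2e.
  have xE : (e * M) *: x = (a + e) *: z0 + (u - y).
    have : z2 - y + e *: z0 = a *: z0 + u - y + e *: z0 by rewrite z2e.
    rewrite {1}z2E => /rowP ez; apply/rowP => l; have := ez l; rewrite !mxE; lra.
  have [M0|M0] := eqVneq M 0.
    have : ((a + e) *: z0 <= dir B r)%MS.
      have -> : (a + e) *: z0 = y - u.
        by apply/eqP; rewrite -subr_eq0 opprB -xE M0 mulr0 scale0r.
      by rewrite addmx_sub// eqmx_opp.
    by rewrite eqmx_scale ?(negbTE z0r)// gt_eqF// addr_gt0.
  have : ((e * M) *: x <= dir B t0)%MS.
    by rewrite xE addmx_sub ?scalemx_sub// (submx_trans _ rt0)// addmx_sub// eqmx_opp.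
  by rewrite eqmx_scale ?(negbTE xt0)// mulf_neq0// gt_eqF.
(* No other cell contributes: a cell between [r] and [s] is a ray of the sector on which
   some [a + b * rho i] vanishes, and the sign of [b] tells which side it is. *)
rewrite (bigD1 t0 isT) (bigD1 t2 t20) big1 /= ?addr0; last first.
  move=> t /andP[tt0 tt2]; apply/eqP; apply: contraT.
  rewrite mulf_eq0 negb_or => /andP[/inc_neq0[_ rlt ts' dst] /inc_neq0[_ _ rt' _]].
  pose z := pt B t; have zK : t = cell B z by rewrite ptK.
  have zs : (z <= dir B s)%MS.
    by apply: submx_trans (cell_dir B z) _; rewrite -zK; apply: face_dir.
  have [a [b [u ur ze]]] := between_coord zs.
  have [pos [i Ki ai]] := between_ratio rt' ts' dst zK ur ze.
  have z0e : z0 = 0 *: x + (1 *: z0 + 0) by rewrite scale0r add0r scale1r addr0.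
  have [pos0 [i' Ki' ai']] := between_ratio rt ts ds erefl (sub0mx _ _) z0e.
  have [b0|b0|b0] := ltgtP b 0.
  - have aE : a = - b * M.
      apply/eqP; rewrite eq_le; apply/andP; split.
        have -> : a = - b * rho i by lra.
        by rewrite ler_pM2l ?oppr_gt0//; apply: max2.
      by have := pos i2 Ki2; rewrite -/M; lra.
    have : t = t2.
      apply: (@between_same _ _ z2 z (- b / e) (u + (b / e) *: y)) => //.
      - by rewrite divr_gt0// oppr_gt0.
      - by rewrite addmx_sub// scalemx_sub.
      by rewrite z2E ze aE; apply/rowP => l; rewrite !mxE; field; rewrite gt_eqF.
    by move=> e2; rewrite e2 eqxx in tt2.
  - have a0 : a = 0.
      have h1 := pos i' Ki'; have h2 := pos0 i Ki.
      have h3 : rho i' = 0 by lra.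
      rewrite h3 mulr0 addr0 in h1.
      apply/eqP; rewrite eq_le h1 andbT.
      have -> : a = - (b * rho i) by lra.
      by rewrite oppr_le0 mulr_ge0 ?(ltW b0)//; lra.
    have : t = t0.
      apply: (@between_same _ _ z0 z b u) => //.
      by rewrite ze a0 scale0r add0r.
    by move=> e2; rewrite e2 eqxx in tt0.
  - move: ze; rewrite b0 scale0r add0r => ze.
    have zr : ~~ (z <= dir B r)%MS.
      rewrite zK in rt' dst *; apply: (@facet_notin _ _ _).
      by apply/eqP; rewrite -eqSS -dst ds dt.
    have : (z <= dir B t)%MS by rewrite zK; exact: cell_dir.
    rewrite ze => h1; have [a0|a0] := eqVneq a 0.
      by move: zr; rewrite ze a0 scale0r add0r ur.
    have : (a *: x <= dir B t)%MS.
      rewrite -(addrK u (a *: x)) addmx_sub// eqmx_opp.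
      by apply: submx_trans ur _; apply: face_dir.
    rewrite eqmx_scale// => xt.
    by have := facet_notin dst; rewrite xt.
(* The two products of signs are compared through the bases [(x, z0, b)] and
   [(x, z2, b)], whose change of basis has determinant [- e]. *)
pose b := row_base (dir B r).
have bf : row_free b by exact: row_base_free.
have br : (b :=: dir B r)%MS by exact: eq_row_base.
have [b0f b0r] := facet_frame rt dt bf br.
have [b2f b2r] := facet_frame rt2 dt2 bf br.
have := (incE (real_cell B z0) ts ds b0f b0r); rewrite -/s -/t0 => ->.
have := (incE (real_cell B y) rt dt bf br); rewrite -/t0 -/r => ->.
have := (incE (real_cell B z2) ts2 ds2 b2f b2r); rewrite -/s -/t2 => ->.
have := (incE (real_cell B y) rt2 dt2 bf br); rewrite -/t2 -/r => ->.
rewrite mulrACA -[X in _ + X]mulrACA.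
rewrite -[X in X + _]mulrA [ori (col_mx z0 b) * _]mulrA (ori_sqr b0f) mul1r.
rewrite -[X in _ + X]mulrA [ori (col_mx z2 b) * _]mulrA (ori_sqr b2f) mul1r.
have /submxP[c yc] : (y <= b)%MS by rewrite br.
have -> : col_mx z2 b = col_mx (e * M)%:M 0 *m x + block_mx (- e)%:M c 0 1%:M *m col_mx z0 b.
  rewrite mul_col_mx mul_block_col !mul_scalar_mx !mul0mx scale1r add0r.
  by rewrite add_col_mx add0r -yc z2E.
rewrite ori_frame2 det_ublock det_scalar1 det1 mulr1 sgzN gtr0_sgz//.
by rewrite mulN1r mulNr addrN.
Qed.

End Diamond.

Lemma diamond B s r : \sum_t inc B s t * inc B t r = 0.
Proof.
case: (pselect (exists t, inc B s t * inc B t r != 0)) => [[t]|H]; last first.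
  by rewrite big1// => t _; apply/eqP; apply: contraT => h0; case: H; exists t.
rewrite mulf_eq0 negb_or => /andP[/inc_neq0[rs rt fts ds] /inc_neq0[_ rr frt dr]].
by rewrite -(ptK rs) -(ptK rr); apply: (@diamond_point B _ _ (pt B t)); rewrite !ptK.
Qed.

Section Chains.
Variable F : pzRingType.
Implicit Types c b : sgnv -> F.

(** Chains of all dimensions are treated together: [inc] vanishes unless the dimension
    drops by one. *)
Definition bd B c : sgnv -> F := fun t => \sum_s c s * (inc B s t)%:~R.

Lemma bd_bd B c r : bd B (bd B c) r = 0.
Proof.
rewrite /bd; under eq_bigr do rewrite mulr_suml.
rewrite exchange_big big1//= => s _.
under eq_bigr do rewrite -mulrA -intrM.
by rewrite -mulr_sumr -rmorph_sum diamond mulr0.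
Qed.

Lemma bdD B c c' t : bd B (fun s => c s + c' s) t = bd B c t + bd B c' t.
Proof. by rewrite -big_split; apply: eq_bigr => s _; rewrite mulrDl. Qed.

Lemma bdN B c t : bd B (fun s => - c s) t = - bd B c t.
Proof. by rewrite -sumrN; apply: eq_bigr => s _; rewrite mulNr. Qed.

Lemma eq_bd B c c' t : c =1 c' -> bd B c t = bd B c' t.
Proof. by move=> e; apply: eq_bigr => s _; rewrite e. Qed.

Definition supp_in B (Q : pred sgnv) c := forall s, c s != 0 -> real B s && Q s.

(** The cell of the origin is not excluded. When it is a point, the complex is the
    augmented chain complex of an affine section of the cone. *)
Definition acyclic B Q := forall c, supp_in B Q c -> (forall t, bd B c t = 0) ->
  exists2 b, supp_in B Q b & forall t, bd B b t = c t.

End Chains.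

End Cells.

(** * Adding a hyperplane to an arrangement *)

Section Refine.
Variables (R : realFieldType) (d : nat) (I : finType) (h : I -> 'cV[R]_d).
Variables (B : {set I}) (g : I).
Hypothesis gB : g \notin B.
Implicit Types (x y z v w : 'rV[R]_d) (s t : sgnv I).
Local Notation B' := (g |: B)%SET.
Local Notation ev := (ev h).
Local Notation cell := (cell h).
Local Notation real := (real h).
Local Notation dir := (dir h).
Local Notation dim := (dim h).
Local Notation inc := (inc h).
Local Notation pt := (pt h).

Definition put e s : sgnv I := [ffun i => if i == g then e else s i].
Definition mask s := put None s.

Lemma putE e s i : i \in B -> put e s i = s i.
Proof. by move=> iB; rewrite ffunE ifN//; apply: contraNneq gB => <-. Qed.
Lemma put_g e s : put e s g = e.
Proof. by rewrite ffunE eqxx. Qed.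
Lemma put_put e e' s : put e (put e' s) = put e s.
Proof. by apply/ffunP => i; rewrite !ffunE; case: eqP. Qed.
Lemma put_mask s : put (s g) (mask s) = s.
Proof. by apply/ffunP => i; rewrite !ffunE; case: eqP => [->|]. Qed.

Lemma cell_put x : cell B' x = put (sg3 (ev g x)) (cell B x).
Proof.
apply/ffunP => i; rewrite !ffunE !inE; by case: eqP => [->|].
Qed.

Lemma mask_cell x : mask (cell B' x) = cell B x.
Proof.
rewrite cell_put /mask put_put; apply/ffunP => i; rewrite ffunE.
by case: eqP => // ->; rewrite cell_notin.
Qed.

Lemma real_mask s : real B' s -> real B (mask s).
Proof. by move/realP => [x ->]; rewrite mask_cell real_cell. Qed.

Lemma mask_face t s : face t s -> face (mask t) (mask s).
Proof.
move/faceP => f; apply/faceP => i; rewrite !ffunE.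
by case: eqP => _; [left|exact: f].
Qed.

Lemma dirS s : (dir B' s <= dir B (mask s))%MS.
Proof.
apply/row_subP => j; apply/dirP => i iB; rewrite putE// => si.
by have /dirP := row_sub j (dir B' s); apply; rewrite ?inE ?iB ?orbT.
Qed.

(** A cell of the refined arrangement is either open in the coarse cell [mask s] that
    contains it, and then called full, or a wall that cuts [mask s] into two halves, and
    then called thin. *)
Definition full s := dim B' s == dim B (mask s).

Lemma fullP s : reflect (dir B' s :=: dir B (mask s))%MS (full s).
Proof.
rewrite /full /dim; apply: (iffP eqP) => [e|e]; last by rewrite e.
apply/eqmxP; have [_ <-] := mxrank_leqif_eq (dirS s); exact/eqP.
Qed.

Lemma full_some s : s g != None -> full s.
Proof.
move=> sg; apply/fullP/eqmxP; rewrite dirS /=.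
apply/row_subP => j; apply/dirP => i; rewrite !inE => /orP[/eqP->|iB] si.
  by rewrite si in sg.
by have /dirP := row_sub j (dir B (mask s)); apply; rewrite ?putE.
Qed.

Lemma full_noneP s : s g = None ->
  reflect (forall v, (v <= dir B (mask s))%MS -> ev g v = 0) (full s).
Proof.
move=> sg; apply: (iffP (fullP s)) => [e v|H].
  by rewrite -e => /dirP; apply; rewrite ?setU11.
apply/eqmxP; rewrite dirS /=; apply/row_subP => j; have vj := row_sub j (dir B (mask s)).
apply/dirP => i; rewrite !inE => /orP[/eqP-> _|iB si]; first exact: H.
by move/dirP: vj; apply; rewrite ?putE.
Qed.

Lemma thinP s : ~~ full s ->
  s g = None /\ exists2 v, (v <= dir B (mask s))%MS & ev g v != 0.
Proof.
move=> sf; have sg : s g = None by apply/eqP; apply: contraNT sf; exact: full_some.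
split=> //; apply: contrapT => H; move/negP: sf; apply.
apply/(full_noneP sg) => v vs; apply/eqP; apply: contraT => v0.
by case: H; exists v.
Qed.

(** The direction of the coarse cell is spanned by that of the wall and one vector
    transverse to it. *)
Lemma thin_dim s : ~~ full s -> dim B (mask s) = (dim B' s).+1.
Proof.
move=> sf; have [sg [v vs v0]] := thinP sf.
have lt : (dim B' s < dim B (mask s))%N by rewrite ltn_neqAle sf mxrankS// dirS.
apply/eqP; rewrite eqn_leq lt andbT.
have H : (dir B (mask s) <= v + dir B' s)%MS.
  apply/row_subP => j; set w := row j _.
  have ws : (w <= dir B (mask s))%MS by exact: row_sub.
  rewrite -(subrK ((ev g w / ev g v) *: v) w) addrC addmx_sub_adds ?scalemx_sub//.
  apply/dirP => i; rewrite !inE => /orP[/eqP-> _|iB si].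
    by rewrite evB evZ divfK// subrr.
  have [ms m2] : mask s i = None /\ i \in B by rewrite putE.
  by move/dirP: vs => /(_ i iB ms) vi; move/dirP: ws => /(_ i iB ms) wi;
    rewrite evB evZ vi wi mulr0 subr0.
apply: leq_trans (mxrankS H) _.
apply: leq_trans (mxrank_adds_leqif _ _) _.
by rewrite -[X in (_ <= X)%N]add1n leq_add2r rank_leq_row.
Qed.

Lemma cell_sub_dir x x' : cell B x = cell B x' -> (x' - x <= dir B (cell B x))%MS.
Proof.
move=> e; rewrite addmx_sub ?eqmx_opp ?cell_dir//.
by rewrite e cell_dir.
Qed.

Lemma inc_full s t : real B' t -> full s -> full t -> face t s ->
  real B' s -> inc B' s t = inc B (mask s) (mask t).
Proof.
move=> rt fs ft f rs.
have [/eqP e|ne] := boolP (dim B (mask s) == (dim B (mask t)).+1); last first.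
  have [d1 d2] : dim B' s = dim B (mask s) /\ dim B' t = dim B (mask t).
    by split; apply/eqP.
  by rewrite /Arrangement.inc !real_mask// rs rt f mask_face//= -d1 -d2 in ne *;
    rewrite (negbTE ne).
have d' : dim B' s = (dim B' t).+1 by rewrite (eqP fs) (eqP ft).
have x's := ptK rs; set x := pt B' s in x's.
have xs : cell B x = mask s by rewrite -mask_cell x's.
pose b := row_base (dir B (mask t)).
have bf : row_free b by exact: row_base_free.
have bt : (b :=: dir B (mask t))%MS by exact: eq_row_base.
have bt' : (b :=: dir B' t)%MS.
  by apply: eqmx_trans bt (eqmx_sym _); apply/fullP.
have := incE rt (x := x) (b := b); rewrite x's => ->//.
by have := incE (real_mask rt) (x := x) (b := b); rewrite xs => ->//; exact: mask_face.
Qed.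

(** If [t] lies on the hyperplane [g], then so does its coarse cell, and the sign of [g]
    on [sig] is constant; otherwise the full cell over [sig] must lie on the same side
    as [t]. So the coarse cofaces correspond to the full ones. *)
Lemma full_coface t sig : real B' t -> full t -> real B sig ->
  face (mask t) sig -> dim B sig = (dim B (mask t)).+1 ->
  exists s, [/\ real B' s, full s, mask s = sig, face t s &
    forall s', real B' s' -> mask s' = sig -> face t s' -> s' = s].
Proof.
move=> /realP[y ty] ft /realP[x ->] f e.
have mt : mask t = cell B y by rewrite ty mask_cell.
have fy : face (cell B y) (cell B x) by rewrite -mt.
have [tg|tg] := eqVneq (t g) None.
  have y0 : ev g y = 0 by apply/sg3_None; move: tg; rewrite ty cell_put put_g.
  have H := full_noneP tg ft.
  exists (cell B' x); split; rewrite ?real_cell ?mask_cell//.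
  - have [xg|xg] := eqVneq (ev g x) 0; last first.
      by apply: full_some; rewrite cell_put put_g; apply/eqP => /sg3_None/eqP; apply/negP.
    have cg : cell B' x g = None by rewrite cell_put put_g; apply/sg3_None.
    apply/(full_noneP cg) => v; rewrite mask_cell.
    move=> /(facet_coord f e)[a [u ut ->]].
    by rewrite evD evZ xg mulr0 add0r H.
  - apply/faceP => i; have [->|ig] := eqVneq i g; first by left.
    by have := faceP _ _ f i; rewrite cell_put !ffunE (negbTE ig).
  move=> s' /realP[x' ->]; rewrite mask_cell => xx' _.
  rewrite !cell_put xx'; congr put.
  have [|a [u ut xe]] := facet_coord f e (v := x'); first by rewrite -xx' cell_dir.
  have a0 := facet_pos e xx' ut xe.
  by rewrite xe evD evZ (H _ ut) addr0 sg3Z.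
have y0 : ev g y != 0.
  by apply: contra_neq tg => y0; rewrite ty cell_put put_g; apply/sg3_None.
have [eps eps0 He] := small_move h y x.
have cy : cell B (y + eps *: x) = cell B x by exact: face_move.
have zE : cell B' (y + eps *: x) = put (t g) (cell B x).
  by rewrite cell_put cy He// ty cell_put put_g.
exists (cell B' (y + eps *: x)); split; rewrite ?real_cell ?mask_cell//.
- by apply: full_some; rewrite zE put_g.
- rewrite zE; apply/faceP => i; have [->|ig] := eqVneq i g.
    by right; rewrite put_g.
  by have := faceP _ _ f i; rewrite !ffunE (negbTE ig).
move=> s' /realP[x' ->]; rewrite mask_cell => xx' /faceP/(_ g)[tN|tE].
  by rewrite tN in tg.
by rewrite zE tE !cell_put put_g xx'.
Qed.

(** The functional [g] takes opposite signs on the two cells, or is zero on one of them.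
    It vanishes at a positive combination of two points, which belongs to the same
    coarse cell. *)
Lemma full_thin s s' : real B' s -> real B' s' -> full s -> mask s = mask s' ->
  s != s' -> exists t, [/\ real B' t, ~~ full t & mask t = mask s].
Proof.
move=> /realP[x sx] /realP[x' sx'] fs mm ss'.
have xx' : cell B x = cell B x' by rewrite -!mask_cell -sx -sx'.
have sg : s g != s' g.
  by apply: contra_neq ss' => sg; rewrite -(put_mask s) sg mm put_mask.
have xN : ev g x <> 0.
  move=> x0; have cg : s g = None by rewrite sx cell_put put_g; apply/sg3_None.
  move/eqP: sg; apply; rewrite cg sx' cell_put put_g; apply/esym/sg3_None.
  have := full_noneP cg fs (x' - x); rewrite evB x0 subr0; apply.
  by rewrite sx mask_cell cell_sub_dir.
have [x'0|x'0] := eqVneq (ev g x') 0.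
  exists s'; split; rewrite ?mm//; first by apply/realP; exists x'.
  have cg : s' g = None by rewrite sx' cell_put put_g; apply/sg3_None.
  apply/negP => /(full_noneP cg) H; apply: xN.
  have := H (x - x'); rewrite evB x'0 subr0; apply.
  by rewrite sx' mask_cell cell_sub_dir.
have opp : ev g x * ev g x' < 0.
  move: sg; rewrite sx sx' !cell_put !put_g => sg.
  rewrite lt_neqAle mulf_neq0 ?andbT//; last exact/eqP.
  rewrite leNgt; apply: contra_neqN sg.
  case: (ltgtP (ev g x) 0) xN => // x0 _.
    rewrite nmulr_rgt0// => x'0'; apply: etrans (_ : Some false = _); last apply/esym;
    exact/sg3_neg.
  rewrite pmulr_rgt0// => x'0'; apply: etrans (_ : Some true = _); last apply/esym;
    exact/sg3_pos.
pose z := `|ev g x'| *: x + `|ev g x| *: x'.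
have z0 : ev g z = 0.
  rewrite /z !evD !evZ; case: (ltgtP (ev g x) 0) xN opp => // x0 _.
    by rewrite nmulr_rlt0// => x'p; rewrite gtr0_norm// ltr0_norm//; ring.
  by rewrite pmulr_rlt0// => x'n; rewrite ltr0_norm// gtr0_norm//; ring.
have zs : cell B z = cell B x.
  apply/eq_cellP => i iB; move/eq_cellP: xx' => /(_ i iB) E.
  by rewrite evD !evZ sg3D !sg3Z ?normr_gt0//; apply/eqP.
have tg : cell B' z g = None by rewrite cell_put put_g; apply/sg3_None.
exists (cell B' z); rewrite real_cell mask_cell zs sx mask_cell; split=> //.
apply/negP => /(full_noneP tg)/(_ (x - z)); rewrite evB z0 subr0 mask_cell => H.
by apply: xN; apply: H; rewrite cell_sub_dir// zs.
Qed.

Section Thin.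
Variable t : sgnv I.
Hypotheses (rt : real B' t) (tt : ~~ full t).

Lemma real_put e : real B' (put e t).
Proof.
have [tg [v vt v0]] := thinP tt; have [z tz] := realP _ _ _ rt.
have z0 : ev g z = 0 by apply/sg3_None; move: tg; rewrite tz cell_put put_g.
case: e => [e|]; last by rewrite -tg -{2}(put_mask t) put_put put_mask.
wlog vE : v vt v0 / sg3 (ev g v) = Some e.
  move=> H; have [E|E] := eqVneq (sg3 (ev g v)) (Some e); first exact: (H v).
  apply: (H (- v)); rewrite ?eqmx_opp// evN ?oppr_eq0//.
  move: E; rewrite /sg3 oppr_eq0 (negbTE v0) oppr_gt0.
  by case: e {H} v0; case: ltgtP.
have [eps eps0 He] := small_move h z v.
apply/realP; exists (z + eps *: v).
rewrite cell_put evD evZ z0 add0r sg3Z// vE.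
apply/ffunP => i; rewrite !ffunE; case: eqP => // /eqP ig.
rewrite tz !ffunE !inE (negbTE ig) /=; case: ifP => // iB.
have [zi|zi] := eqVneq (ev i z) 0; last by rewrite He.
rewrite evD evZ zi (dirP _ _ _ _ vt i iB) ?mulr0 ?addr0//.
by rewrite putE// tz cell_in ?inE ?iB ?orbT//; apply/sg3_None.
Qed.

Lemma mask_put e : mask (put e t) = mask t.
Proof. exact: put_put. Qed.

Lemma full_put e : full (put (Some e) t).
Proof. by apply: full_some; rewrite put_g. Qed.

Lemma face_put e : face t (put e t).
Proof.
have [tg _] := thinP tt; apply/faceP => i; rewrite ffunE.
by case: eqP => [->|_]; [left|right].
Qed.

Lemma thin_coface s : full s -> inc B' s t != 0 ->
  exists e, s = put (Some e) t.
Proof.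
move=> fs /inc_neq0[rs _ f e].
have ms : mask s = mask t.
  apply: (@face_dim_eq _ _ _ h B); rewrite ?real_mask// ?mask_face//.
  by rewrite (thin_dim tt) -e; apply/esym/eqP.
case E : (s g) => [e'|]; first by exists e'; rewrite -(put_mask s) E ms put_put.
have : s = t by rewrite -(put_mask s) ms E; have [<- _] := thinP tt; rewrite put_mask.
by move=> st; move: tt; rewrite -st fs.
Qed.

(** The two halves are on opposite sides of the wall: a point of one is a negative
    multiple of a point of the other, modulo the direction of the wall. *)
Lemma inc_put : inc B' (put (Some true) t) t ^+ 2 = 1 /\
  inc B' (put (Some false) t) t = - inc B' (put (Some true) t) t.
Proof.
have e b : dim B' (put (Some b) t) = (dim B' t).+1.
  by rewrite -(thin_dim tt) (eqP (full_put b)) mask_put.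
have xt b := ptK (real_put (Some b)); move: xt.
set x := fun b => pt B' (put (Some b) t) => xt.
pose b := row_base (dir B' t).
have bf : row_free b by exact: row_base_free.
have bt : (b :=: dir B' t)%MS by exact: eq_row_base.
have iE e' : inc B' (put (Some e') t) t = ori (col_mx (x e') b) * ori b.
  rewrite -{1}(xt e') (incE rt (b := b))// /x xt ?face_put//; exact: e.
rewrite !iE; have fx e' : face t (cell B' (x e')) by rewrite /x xt face_put.
have ex e' : dim B' (cell B' (x e')) = (dim B' t).+1 by rewrite /x xt.
have [x1f _] : row_free (col_mx (x true) b) /\ True.
  by split=> //; apply: row_free_col; rewrite // bt (facet_notin (ex true)).
split; first by rewrite expr2 mulrACA !ori_sqr.
have xd e' : (x e' <= dir B (mask t))%MS.
  by rewrite -(mask_put (Some e')) -(xt e') mask_cell cell_dir.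
have [|a [u ut xe]] := facet_coord (fx true) (ex true) (v := x false).
  by rewrite xt (fullP _ (full_put true)) mask_put.
have a0 : a < 0.
  have [tg _] := thinP tt.
  have gx e' : sg3 (ev g (x e')) = Some e'.
    by have := congr1 (fun s : sgnv I => s g) (xt e'); rewrite cell_put !put_g.
  have /sg3_neg := gx false; have /sg3_pos x1 := gx true.
  rewrite xe evD evZ (dirP _ _ _ _ ut g) ?setU11// addr0.
  by rewrite pmulr_llt0.
have /submxP[c uc] : (u <= b)%MS by rewrite bt.
have := ori_frame (x true) b a c 1%:M; rewrite mul1mx -uc -xe => ->.
by rewrite det1 mulr1 ltr0_sgz// mulN1r mulNr.
Qed.

End Thin.

Section RefineChains.
Variables (F : pzRingType) (Q : pred (sgnv I)).
Hypothesis Qmask : forall s, Q s = Q (mask s).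
Hypothesis Qface : forall t s, face t s -> Q s -> Q t.
Implicit Types b c : sgnv I -> F.
Local Notation bd := (bd h).

(** The subdivision chain map: a coarse cell is the sum of the full cells that it
    contains. *)
Definition subdivide b : sgnv I -> F :=
  fun s => if real B' s && full s then b (mask s) else 0.

Lemma bd_subdivide_full b t : real B' t -> full t ->
  bd B' (subdivide b) t = bd B b (mask t).
Proof.
move=> rt ft; rewrite /Arrangement.bd (partition_big mask predT)//=.
apply: eq_bigr => sig _.
have [i0|i0] := eqVneq (inc B sig (mask t)) 0.
  rewrite i0 mulr0 big1// => s /eqP ms; rewrite /subdivide.
  case: ifP => [/andP[rs fs]|_]; last by rewrite mul0r.
  have [f|f] := boolP (face t s).
    by rewrite inc_full// ms i0 mulr0.
  by rewrite /Arrangement.inc (negbTE f) !andbF mulr0.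
have [rsig _ f e] := inc_neq0 i0.
have [s [rs fs ms fts us]] := full_coface rt ft rsig f e.
rewrite (bigD1 s) ?ms//= big1 ?addr0 => [|s' /andP[/eqP ms' ss']].
  by rewrite /subdivide rs fs ms /= inc_full// ms.
rewrite /subdivide; case: ifP => [/andP[rs' fs']|_]; last by rewrite mul0r.
suff -> : inc B' s' t = 0 by rewrite mulr0.
apply: contra_neq_eq ss' => /inc_neq0[_ _ f' _]; exact: us.
Qed.

Lemma bd_thin c t : (forall s, c s != 0 -> full s) -> real B' t -> ~~ full t ->
  bd B' c t = (c (put (Some true) t) - c (put (Some false) t)) *
              (inc B' (put (Some true) t) t)%:~R.
Proof.
move=> cf rt tt; rewrite /Arrangement.bd (bigD1 (put (Some true) t))//=.
rewrite (bigD1 (put (Some false) t))/=; last first.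
  by apply/eqP => /(congr1 (fun s : sgnv I => s g)); rewrite !put_g.
rewrite big1 ?addr0 => [|s /andP[s1 s2]].
  by have [_ ->] := inc_put rt tt; rewrite rmorphN mulrN -mulrBl.
have [->|c0] := eqVneq (c s) 0; first by rewrite mul0r.
suff -> : inc B' s t = 0 by rewrite mulr0.
apply/eqP; apply: contraT => i0.
by have [[] se] := thin_coface tt (cf s c0) i0; move: s1 s2; rewrite se eqxx.
Qed.

Lemma bd_subdivide_thin b t : real B' t -> ~~ full t -> bd B' (subdivide b) t = 0.
Proof.
move=> rt tt; rewrite bd_thin//; last first.
  by move=> s; rewrite /subdivide; case: ifP => [/andP[]|]; rewrite ?eqxx.
rewrite /subdivide !real_put// !full_put//= !mask_put; by rewrite subrr mul0r.
Qed.

(** The coefficients of a cycle on the walls are removed by subtracting the boundaries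
    of suitable multiples of the positive halves. As the boundary of the resulting cycle
    has no component on the walls, its coefficients on the two halves of a coarse cell
    are equal. The cycle is therefore a subdivided coarse cycle, which bounds by
    assumption. *)
Lemma acyclic_refine : acyclic h F B Q -> acyclic h F B' Q.
Proof.
move=> acB c cQ cyc.
(* The chain of positive halves whose boundary has the same coefficients as [c] on the
   walls. *)
pose w s := if real B' s && (s g == Some true) && ~~ full (mask s)
  then c (mask s) * (inc B' s (mask s))%:~R else 0.
have wf s : w s != 0 -> full s.
  rewrite /w; case: ifP => [/andP[/andP[_ /eqP sg] _] _|]; last by rewrite eqxx.
  by apply: full_some; rewrite sg.
have maskt t : ~~ full t -> mask t = t.
  by move=> tt; have [tg _] := thinP tt; rewrite -{2}(put_mask t) tg /mask put_put.
pose c1 s := c s + - bd B' w s.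
have c1_thin t : real B' t -> ~~ full t -> c1 t = 0.
  move=> rt tt; rewrite /c1 bd_thin// /w !real_put//= !put_g eqxx /=.
  rewrite mask_put maskt// tt /= subr0 -mulrA -intrM -expr2.
  by have [-> _] := inc_put rt tt; rewrite mulr1 subrr.
have c1_cyc t : bd B' c1 t = 0 by rewrite bdD bdN bd_bd cyc subr0.
have c1_real s : c1 s != 0 -> real B' s.
  apply: contraNT => rs; rewrite /c1; apply/eqP.
  have -> : c s = 0 by apply/eqP; apply: contraT => /cQ/andP[]; rewrite (negbTE rs).
  rewrite /Arrangement.bd big1 ?subr0// => s' _.
  by rewrite /Arrangement.inc (negbTE rs) andbF mulr0.
have c1_full s : c1 s != 0 -> full s.
  move=> s0; apply: contraT => sf; have := s0; by rewrite c1_thin ?eqxx ?c1_real.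
have wQ s : w s != 0 -> real B' s && Q s.
  rewrite /w; case: ifP => [/andP[/andP[rs _] _] ws|]; last by rewrite eqxx.
  rewrite rs Qmask; have : c (mask s) != 0 by apply: contra_neq ws => ->; rewrite mul0r.
  by move/cQ/andP => [].
have c1Q s : c1 s != 0 -> Q s.
  have [/eqP c0|/cQ/andP[_ Qs] //] := boolP (c s == 0).
  rewrite /c1 c0 add0r oppr_eq0 => b0.
  have [s' ws' i0] : exists2 s', w s' != 0 & inc B' s' s != 0.
    apply: contrapT => H; move/negP: b0; apply; rewrite /Arrangement.bd big1// => s' _.
    have [->|w0] := eqVneq (w s') 0; first by rewrite mul0r.
    have [->|i0] := eqVneq (inc B' s' s) 0; first by rewrite mulr0.
    by case: H; exists s'.
  by have [_ _ f _] := inc_neq0 i0; apply: Qface f _; case/andP: (wQ _ ws').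
have c1_side t : real B' t -> ~~ full t ->
    c1 (put (Some true) t) = c1 (put (Some false) t).
  move=> rt tt; have := c1_cyc t; rewrite bd_thin// => /(congr1 (fun r => r *
    (inc B' (put (Some true) t) t)%:~R)).
  rewrite mul0r -mulrA -intrM -expr2.
  by have [-> _] := inc_put rt tt; rewrite mulr1 => /eqP; rewrite subr_eq0 => /eqP.
have c1_mask s s' : real B' s -> real B' s' -> full s -> full s' ->
    mask s = mask s' -> c1 s = c1 s'.
  move=> rs rs' fs fs' mm; have [->//|ss'] := eqVneq s s'.
  have [t [rt tt mt]] := full_thin rs rs' fs mm ss'.
  have H r : full r -> mask r = mask t -> exists e, r = put (Some e) t.
    move=> fr mr; case E: (r g) => [e|].
      by exists e; rewrite -(put_mask r) E mr put_put.
    have : r = t by rewrite -(put_mask r) E mr (maskt t tt); exact: (maskt t tt).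
    by move=> rt'; rewrite -rt' fr in tt.
  have [e ->] := H s fs (esym mt); have [e' ->] := H s' fs' (etrans (esym mm) (esym mt)).
  by case: e e' => [] [] //; rewrite c1_side.
pose c2 sig := if [pick s | [&& real B' s, full s & mask s == sig]] is Some s then c1 s else 0.
have c1E s : c1 s = subdivide c2 s.
  rewrite /subdivide; case: ifP => [/andP[rs fs]|H].
    rewrite /c2; case: pickP => [s' /and3P[rs' fs' /eqP mm]|/(_ s)]; first exact: c1_mask.
    by rewrite rs fs eqxx.
  apply/eqP; apply: contraFT H => s0.
  by rewrite c1_real ?c1_full.
have c2Q : supp_in h B Q c2.
  move=> sig; rewrite /c2; case: pickP => [s /and3P[rs _ /eqP <-] s0|]; last by rewrite eqxx.
  by rewrite real_mask// -Qmask c1Q.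
have c2_cyc t : bd B c2 t = 0.
  have [/realP[x tx]|rt] := boolP (real B t); last first.
    by rewrite /Arrangement.bd big1// => s _; rewrite /Arrangement.inc (negbTE rt) andbF mulr0.
  have [t' [rt' ft' mt']] : exists t', [/\ real B' t', full t' & mask t' = t].
    have [fx|tx'] := boolP (full (cell B' x)).
      by exists (cell B' x); rewrite real_cell mask_cell.
    exists (put (Some true) (cell B' x)).
    by rewrite real_put ?real_cell// full_put mask_put mask_cell.
  rewrite -mt' -bd_subdivide_full// -(eq_bd _ _ _ c1E); exact: c1_cyc.
have [b bQ bE] := acB c2 c2Q c2_cyc.
exists (fun s => subdivide b s + w s) => [s|t].
  have [/eqP|ws _] := boolP (w s == 0); last exact: wQ.
  move=> ->; rewrite addr0 /subdivide; case: ifP; last by rewrite eqxx.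
  by move=> /andP[rs _] /bQ/andP[_]; rewrite -Qmask rs => ->.
rewrite bdD; suff -> : bd B' (subdivide b) t = c1 t by rewrite /c1 subrK.
have [rt|rt] := boolP (real B' t); last first.
  have -> : c1 t = 0 by apply/eqP; apply: contraNT rt; exact: c1_real.
  by rewrite /Arrangement.bd big1// => s _; rewrite /Arrangement.inc (negbTE rt) andbF mulr0.
have [ft|tt] := boolP (full t); last by rewrite bd_subdivide_thin// c1_thin.
by rewrite bd_subdivide_full// bE c1E /subdivide rt ft.
Qed.

End RefineChains.
End Refine.

(** * Acyclicity of closed cones *)

Section Cones.
Variables (R : realFieldType) (d : nat) (I : finType) (h : I -> 'cV[R]_d).
Variables (F : pzRingType).
Implicit Types (x y z v w p : 'rV[R]_d) (s t : sgnv I) (B J K : {set I}).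
Local Notation ev := (ev h).
Local Notation cell := (cell h).
Local Notation real := (real h).
Local Notation inc := (inc h).
Local Notation bd := (bd h).
Local Notation acyclic := (acyclic h F).

Definition in_closed_cone J K s :=
  [forall i in J, s i == None] && [forall i in K, s i != Some true].

Lemma in_closed_coneP J K s : reflect ((forall i, i \in J -> s i = None) /\
  (forall i, i \in K -> s i <> Some true)) (in_closed_cone J K s).
Proof.
apply: (iffP andP) => -[a b]; split.
- by move=> i iJ; apply/eqP; move/forall_inP: a; apply.
- by move=> i iJ; apply/eqP; move/forall_inP: b; apply.
- by apply/forall_inP => i iJ; rewrite a.
- by apply/forall_inP => i iJ; apply/eqP/b.
Qed.

Lemma in_closed_cone_face J K t s : face t s -> in_closed_cone J K s -> in_closed_cone J K t.
Proof.
move=> /faceP f /in_closed_coneP[a b]; apply/in_closed_coneP; split=> i ii; have [->|->] := f i => //.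
  exact: a.
exact: b.
Qed.

Lemma eq_acyclic B (Q Q' : pred (sgnv I)) :
  (forall x, Q (cell B x) = Q' (cell B x)) -> acyclic B Q -> acyclic B Q'.
Proof.
move=> e a c cQ cyc.
have E s : real B s -> Q s = Q' s by move=> /realP[x ->].
have [|//|b bQ be] := a c; first by move=> s /cQ/andP[rs]; rewrite rs E.
by exists b => // s /bQ/andP[rs]; rewrite rs -E.
Qed.

Lemma in_closed_cone_cell B J K x : J \subset B -> K \subset B ->
  reflect ((forall i, i \in J -> ev i x = 0) /\ (forall i, i \in K -> ev i x <= 0))
    (in_closed_cone J K (cell B x)).
Proof.
move=> /subsetP JB /subsetP KB; apply: (iffP (in_closed_coneP _ _ _)) => -[a b]; split=> i ii.
- by apply/sg3_None; rewrite -(a i ii) cell_in ?JB.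
- by have := b i ii; rewrite cell_in ?KB// leNgt => /sg3_pos/negP.
- by rewrite cell_in ?JB//; apply/sg3_None/a.
- by rewrite cell_in ?KB// => /sg3_pos; rewrite ltNge b.
Qed.

(** Only two cells are left, the open half-space and its boundary, with incidence a
    sign. *)
Lemma acyclic_halfspace_min J i p : i \notin J ->
  (forall j, j \in J -> ev j p = 0) -> ev i p < 0 ->
  acyclic (i |: J) (in_closed_cone J [set i]).
Proof.
move=> iJ pJ pi c cQ cyc.
pose t := cell (i |: J) 0.
have tN : t = [ffun=> None].
  apply/ffunP => j; rewrite !ffunE ev0; case: ifP => // _; exact/sg3_None.
have tt : ~~ full h J i t.
  have tg : t i = None by rewrite tN ffunE.
  apply/negP => /(full_noneP h iJ tg)/(_ p) H.
  suff /H p0 : (p <= dir h J (mask i t))%MS by rewrite p0 ltxx in pi.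
  by apply/dirP => j jJ _; exact: pJ.
have rt : real (i |: J) t by exact: real_cell.
pose s := put i (Some false) t.
have [i2 iN] := inc_put iJ rt tt; set it := inc _ _ _ in i2 iN.
have i2' : inc (i |: J) s t ^+ 2 = 1 by rewrite iN sqrrN.
have two r : real (i |: J) r -> in_closed_cone J [set i] r -> r = s \/ r = t.
  move=> /realP[x ->] /in_closed_coneP[a b].
  have e j : j != i -> cell (i |: J) x j = None.
    move=> ji; have [jJ|jJ] := boolP (j \in J); first exact: a.
    by rewrite cell_notin// !inE negb_or ji.
  have := b i; rewrite inE eqxx => /(_ isT).
  case E: (cell (i |: J) x i) => [[]|] // _; [left|right]; apply/ffunP => j.
    by rewrite /s tN [RHS]ffunE; case: eqVneq => [->//|ji]; rewrite ffunE; exact: e.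
  by rewrite tN [RHS]ffunE; have [->//|ji] := eqVneq j i; exact: e.
have st : s != t by apply/eqP => /(congr1 (fun s : sgnv I => s i)); rewrite put_g tN ffunE.
have cs : c s = 0.
  have := cyc t; rewrite /Arrangement.bd (bigD1 s)//= big1 ?addr0 => [|r rs].
    move=> /(congr1 (fun a => a * (inc (i |: J) s t)%:~R)).
    by rewrite mul0r -mulrA -intrM -expr2 i2' mulr1.
  have [->|r0] := eqVneq (c r) 0; first by rewrite mul0r.
  have /andP[rr rQ] := cQ r r0.
  have [E|->] := two r rr rQ; first by rewrite E eqxx in rs.
  suff -> : inc (i |: J) t t = 0 by rewrite mulr0.
  by apply/eqP; apply: contraT => /inc_neq0[_ _ _ /n_Sn].
have sQ : in_closed_cone J [set i] s.
  apply/in_closed_coneP; split=> j.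
    by move=> jJ; rewrite /s tN !ffunE ifN//; apply: contraNneq iJ => <-.
  by rewrite inE => /eqP ->; rewrite put_g.
exists (fun r => if r == s then c t * (inc (i |: J) s t)%:~R else 0).
  move=> r /=; case: (eqVneq r s) => [-> _|_]; last by rewrite eqxx.
  by rewrite real_put.
move=> r; rewrite /Arrangement.bd (bigD1 s)//= eqxx big1 ?addr0; last first.
  by move=> q /negbTE ->; rewrite mul0r.
have [->|rt'] := eqVneq r t; first by rewrite -mulrA -intrM -expr2 i2' mulr1.
have -> : c r = 0.
  apply/eqP; apply: contraT => r0; have /andP[rr rQ] := cQ r r0.
  have [E|E] := two r rr rQ; first by rewrite E cs eqxx in r0.
  by rewrite E eqxx in rt'.
suff -> : inc (i |: J) s r = 0 by rewrite mulr0.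
apply/eqP; apply: contraT => /inc_neq0[_ rr f e].
have [E|E] := two r rr (in_closed_cone_face f sQ).
- by move: e; rewrite E => /n_Sn.
- by rewrite E eqxx in rt'.
Qed.

Lemma acyclic_halfspace B J i p : J \subset B -> i \in B ->
  (forall j, j \in J -> ev j p = 0) -> ev i p < 0 ->
  acyclic B (in_closed_cone J [set i]).
Proof.
move=> JB iB pJ pi.
have iJ : i \notin J by apply: contraTN pi => /pJ->; rewrite ltxx.
have : i |: J \subset B by rewrite subUset sub1set iB.
elim: {B JB iB}_.+1 {-2}B (ltnSn #|B|) => // n IH B Bn sB.
have [BE|[g gB gN]] : B = i |: J \/ exists2 g, g \in B & g \notin i |: J.
  have [sB'|/subsetPn[g gB gN]] := boolP (B \subset i |: J); last by right; exists g.
  by left; apply/eqP; rewrite eqEsubset sB' sB.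
  by rewrite BE; apply: acyclic_halfspace_min pJ pi.
rewrite -(setD1K gB); apply: acyclic_refine.
- by rewrite !inE eqxx.
- move=> s; rewrite /in_closed_cone; congr (_ && _); apply: eq_forallb_in => j jJ; rewrite !ffunE;
    by case: (j =P g) => // jg; move: gN; rewrite -jg !inE ?jJ ?orbT//;
       move: jJ; rewrite inE => ->.
- by move=> t s; exact: in_closed_cone_face.
apply: IH; first by move: Bn; rewrite (cardsD1 g B) gB.
apply/subsetP => j jJ; rewrite !inE (subsetP sB)// andbT.
by apply: contraNneq gN => <-.
Qed.

(** A cycle [c] supported where [h_i <= 0] bounds a chain [b] of the whole cone. The
    part [b1] of [b] where [h_i > 0] has its boundary on the hyperplane [h_i = 0],
    because [c] has no component beyond it. Replacing [b1] by a chain of the hyperplane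
    section with the same boundary keeps the boundary [c]. *)
Lemma mayer_vietoris B J K i : i \in B ->
  acyclic B (in_closed_cone J K) -> acyclic B (in_closed_cone (i |: J) K) ->
  acyclic B (in_closed_cone J (i |: K)).
Proof.
move=> iB a a0 c cQ cyc.
have QE s : in_closed_cone J (i |: K) s = in_closed_cone J K s && (s i != Some true).
  apply/in_closed_coneP/andP => [[aJ aK]|[/in_closed_coneP[aJ aK] si]].
    split; last by apply/eqP; apply: aK; rewrite setU11.
    by apply/in_closed_coneP; split=> // j jK; apply: aK; rewrite inE jK orbT.
  by split=> // j; rewrite !inE => /orP[/eqP->|]; [exact/eqP|exact: aK].
have Q0E s : in_closed_cone (i |: J) K s = in_closed_cone J K s && (s i == None).
  apply/in_closed_coneP/andP => [[aJ aK]|[/in_closed_coneP[aJ aK] /eqP si]].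
    split; last by apply/eqP; apply: aJ; rewrite setU11.
    by apply/in_closed_coneP; split=> // j jK; apply: aJ; rewrite inE jK orbT.
  by split=> // j; rewrite !inE => /orP[/eqP->|]; [|exact: aJ].
have [|//|b bQ bE] := a c.
  by move=> s /cQ/andP[->]; rewrite QE => /andP[].
pose b1 s := if s i == Some true then b s else 0.
pose b2 s := if s i == Some true then 0 else b s.
have bb s : b s = b1 s + b2 s by rewrite /b1 /b2; case: ifP; rewrite ?addr0 ?add0r.
have b1Q s : bd B b1 s != 0 -> [/\ real B s, in_closed_cone J K s & s i != Some false].
  move=> s0; have [s' bs' i0] : exists2 s', b1 s' != 0 & inc B s' s != 0.
    apply: contrapT => H; move/negP: s0; apply; rewrite /Arrangement.bd big1// => s' _.
    have [->|w0] := eqVneq (b1 s') 0; first by rewrite mul0r.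
    have [->|i0] := eqVneq (inc B s' s) 0; first by rewrite mulr0.
    by case: H; exists s'.
  have [_ rs f _] := inc_neq0 i0.
  move: bs'; rewrite /b1; case: ifP => [/eqP s'i /bQ/andP[_ Qs']|]; last by rewrite eqxx.
  split=> //; first exact: in_closed_cone_face f Qs'.
  by have [->|->] := faceP _ _ f i; rewrite ?s'i.
have b2N s : s i = Some true -> bd B b2 s = 0.
  move=> si; rewrite /Arrangement.bd big1// => s' _; rewrite /b2.
  case: ifPn => [_|s'i]; first by rewrite mul0r.
  suff -> : inc B s' s = 0 by rewrite mulr0.
  apply/eqP; apply: contraT => /inc_neq0[_ _ f _].
  by have := faceP _ _ f i; rewrite si => -[//|E]; rewrite -E eqxx in s'i.
have b1E s : bd B b1 s = c s - bd B b2 s.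
  by rewrite -bE (eq_bd _ _ _ bb) bdD addrK.
have cN s : s i = Some true -> c s = 0.
  move=> si; apply/eqP; apply: contraT => /cQ/andP[_].
  by rewrite QE si eqxx andbF.
have [||e eQ eE] := a0 (bd B b1).
- move=> s s0; have [-> Qs si] := b1Q s s0; rewrite Q0E Qs /=.
  by move: s0 si; case E: (s i) => [[]|] //; rewrite b1E cN ?b2N// subr0 eqxx.
- by move=> t; exact: bd_bd.
exists (fun s => b2 s + e s) => [s|t]; last by rewrite bdD eE b1E addrC subrK.
have [/eqP->|es _] := boolP (e s == 0).
  rewrite addr0 /b2; case: ifPn => [_|si /bQ/andP[-> Qs]]; first by rewrite eqxx.
  by rewrite QE Qs.
by move/eQ/andP: es => [->]; rewrite Q0E QE => /andP[-> /eqP ->].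
Qed.

(** The point [p] ensures that the cone is not a linear subspace. The induction removes
    the inequality of index [i]. If the remaining inequalities define a linear subspace,
    the cone is a half-space of it. If not, the cone that they define is acyclic, and
    Mayer-Vietoris applies when its section by [h_i = 0] is not a linear subspace. When
    that section is a linear subspace, the inequality [h_i <= 0] was redundant. *)
Theorem acyclic_cone B J K p i : J \subset B -> K \subset B ->
  (forall j, j \in J -> ev j p = 0) -> (forall j, j \in K -> ev j p <= 0) ->
  i \in K -> ev i p < 0 -> acyclic B (in_closed_cone J K).
Proof.
move: p i; elim: {K}_.+1 {-2}K J (ltnSn #|K|) => // n IH K J Kn p i JB KB pJ pK iK pi.
pose K' := K :\ i; have KE : K = i |: K' by rewrite setD1K.
have K'n : (#|K'| < n)%N by move: Kn; rewrite (cardsD1 i K) iK.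
have iB : i \in B by exact: (subsetP KB).
have K'K j : j \in K' -> j \in K by rewrite inE => /andP[].
have K'B : K' \subset B by apply/subsetP => j /K'K; exact: (subsetP KB).
have KP x : (forall j, j \in K' -> ev j x <= 0) -> ev i x <= 0 ->
    forall j, j \in K -> ev j x <= 0.
  move=> xK' xi j; have [->//|ji jK] := eqVneq j i; apply: xK'; by rewrite in_setD1 ji.
pose P' q := (forall j, j \in J -> ev j q = 0) /\ (forall j, j \in K' -> ev j q <= 0).
have P'comb a b q r : P' q -> P' r -> 0 <= a -> 0 <= b -> P' (a *: q + b *: r).
  move=> [qJ qK] [rJ rK] a0 b0; split=> j jj.
    by rewrite evD !evZ qJ// rJ// !mulr0 addr0.
  have := qK j jj; have := rK j jj; rewrite evD !evZ; nra.
have pP' : P' p by split=> // j /K'K; exact: pK.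
(* The larger cone [P'] fails to be a linear subspace exactly when some [q] in it makes
   one of the inequalities strict. *)
case: (pselect (exists q, P' q /\ exists2 j, j \in K' & ev j q < 0)); last first.
  move=> H.
  have sub q : P' q -> forall j, j \in K' -> ev j q = 0.
    move=> qP j jK'; apply/eqP; rewrite eq_le (proj2 qP)//= leNgt.
    by apply/negP => jq; apply: H; exists q; split=> //; exists j.
  have JK'B : J :|: K' \subset B by rewrite subUset JB.
  apply: (@eq_acyclic _ (in_closed_cone (J :|: K') [set i])); last first.
    apply: (@acyclic_halfspace _ _ _ p) => //.
    by move=> j; rewrite inE => /orP[/pJ//|]; exact: sub.
  have iB1 : [set i] \subset B by rewrite sub1set.
  move=> x; apply/in_closed_cone_cell/in_closed_cone_cell => // -[a b]; split.
  - by move=> j jJ; apply: a; rewrite inE jJ.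
  - apply: KP; last by apply: b; rewrite inE.
    by move=> j jK'; rewrite a// inE jK' orbT.
  - have xP : P' x by split=> // j /K'K; exact: b.
    by move=> j; rewrite inE => /orP[/a//|]; exact: sub.
  - by move=> j; rewrite inE => /eqP->; exact: b.
move=> [q [qP [j jK' jq]]].
have acK' : acyclic B (in_closed_cone J K') by apply: (IH K' J K'n q j) => //; case: qP.
case: (pselect (exists r, [/\ P' r, ev i r = 0 & exists2 j, j \in K' & ev j r < 0])).
  move=> [r [rP ri [l lK' lr]]]; rewrite KE; apply: mayer_vietoris => //.
  apply: (IH K' (i |: J) K'n r l) => //; last by case: rP.
    by rewrite subUset sub1set iB.
  by move=> m; rewrite !inE => /orP[/eqP->//|]; case: rP => rJ _; exact: rJ.
move=> H.
have flat r : P' r -> ev i r = 0 -> forall l, l \in K' -> ev l r = 0.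
  move=> rP ri l lK'; apply/eqP; rewrite eq_le (proj2 rP)//= leNgt.
  by apply/negP => lr; apply: H; exists r; split=> //; exists l.
(* A point [x] of the larger cone with [ev i x > 0] would give, by positive combinations
   with [p] and [q], points of the section [h_i = 0], on which all the inequalities of
   [K'] are equalities; this contradicts [ev j q < 0]. *)
apply: (eq_acyclic _ acK') => x; apply/in_closed_cone_cell/in_closed_cone_cell => // -[a b]; split=> //; last first.
  by move=> l /K'K; exact: b.
apply: KP => //; rewrite leNgt; apply/negP => xi.
have xP : P' x by [].
have E m : m \in K' -> ev i x * ev m p + (- ev i p) * ev m x = 0.
  move=> mK'; have := @flat (ev i x *: p + (- ev i p) *: x).
  rewrite evD !evZ => /(_ _ _ m mK'); rewrite evD !evZ; apply.
    by apply: P'comb => //; rewrite ?oppr_ge0 ltW.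
  by ring.
have pj0 : ev j p = 0 /\ ev j x = 0.
  have e := E j jK'; have h1 := proj2 pP' j jK'; have h2 := proj2 xP j jK'.
  by split; nra.
have [qi|qi|qi] := ltgtP (ev i q) 0.
- have zP : P' (ev i x *: q + (- ev i q) *: x).
    by apply: P'comb => //; rewrite ?oppr_ge0 ltW.
  have z0 : ev i (ev i x *: q + (- ev i q) *: x) = 0 by rewrite evD !evZ; ring.
  have := flat _ zP z0 j jK'; rewrite evD !evZ (proj2 pj0) mulr0 addr0.
  by move/eqP; rewrite mulf_eq0 (gt_eqF xi) (lt_eqF jq).
- have zP : P' ((- ev i p) *: q + ev i q *: p).
    by apply: P'comb => //; rewrite ?oppr_ge0 ltW.
  have z0 : ev i ((- ev i p) *: q + ev i q *: p) = 0 by rewrite evD !evZ; ring.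
  have := flat _ zP z0 j jK'; rewrite evD !evZ (proj1 pj0) mulr0 addr0.
  by move/eqP; rewrite mulf_eq0 oppr_eq0 (lt_eqF pi) (lt_eqF jq).
- by have := flat q qP qi j jK'; move=> q0; rewrite q0 ltxx in jq.
Qed.

End Cones.

End Arrangement.
Import Arrangement.

(** * Germs and sections over basic open sets *)

Local Open Scope classical_set_scope.
Local Open Scope ring_scope.
Local Open Scope quotient_scope.

Local Notation frac := Defs.frac.

Section Primes.
Variable A : comNzRingType.
Implicit Types (a b u x y : A) (p q : Spec A).

Lemma pideal0 p : 0 \in pideal p. Proof. by have [] := prime_idealP p. Qed.
Lemma pideal1 p : 1 \notin pideal p. Proof. by have [] := prime_idealP p. Qed.
Lemma pidealM p x y : (x * y \notin pideal p) = (x \notin pideal p) && (y \notin pideal p).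
Proof. by rewrite prime_idealrM negb_or. Qed.
Lemma pidealX p x n : x \notin pideal p -> x ^+ n \notin pideal p.
Proof.
by move=> xp; elim: n => [|n IH]; rewrite ?expr0 ?pideal1// exprS pidealM xp.
Qed.
Lemma pideal_comb p a x y : x \in pideal p -> y \in pideal p -> a * x + y \in pideal p.
Proof. by have [_ _ H] := prime_idealP p; apply: H. Qed.

Definition is_ideal (J : set A) :=
  J 0 /\ forall a x y, J x -> J y -> J (a * x + y).

(** An ideal which is maximal among those that contain [J] and no power of [b] is
    prime. *)
Lemma prime_avoiding (J : set A) b : is_ideal J -> (forall n, ~ J (b ^+ n)) ->
  exists q : Spec A, (forall x, J x -> x \in pideal q) /\ b \notin pideal q.
Proof.
move=> [J0 JD] Jb.
pose good (X : set A) := [/\ J `<=` X, is_ideal X & forall n, ~ X (b ^+ n)].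
pose P (X : set A) := X = set0 \/ good X.
have [|X [PX maxX]] := @Zorn_bigcup A P.
  move=> C CP tot.
  case: (pselect (exists2 X, C X & good X)) => [[X CX gX]|nC]; last first.
    left; rewrite -subset0 => x [Y CY Yx].
    by have [Y0|gY] := CP Y CY; [rewrite -Y0|case: nC; exists Y].
  right; split=> [x Jx||n [Y CY Yb]].
  - by exists X => //; case: gX => JX _ _; exact: JX.
  - split; first by exists X => //; case: gX => _ [].
    move=> a x y [Y CY Yx] [Z CZ Zy].
    have [Y0|[_ [_ YD] _]] := CP Y CY; first by rewrite Y0 in Yx.
    have [Z0|[_ [_ ZD] _]] := CP Z CZ; first by rewrite Z0 in Zy.
    have [YZ|ZY] := tot Y Z CY CZ.
      by exists Z => //; apply: ZD => //; apply: YZ.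
    by exists Y => //; apply: YD => //; apply: ZY.
  - by have [Y0|[_ _ /(_ n)]] := CP Y CY; first by rewrite Y0 in Yb.
have gX : good X.
  case: PX => // X0; exfalso; apply: (maxX J); last by right; split.
  by rewrite X0; split=> // /(_ 0 J0).
have [JX [X0 XD] Xb] := gX.
have XM a x : X x -> X (a * x) by move=> Xx; rewrite -[a * x]addr0; apply: XD.
have XDD x y : X x -> X y -> X (x + y) by move=> Xx Xy; rewrite -[x]mul1r; apply: XD.
have ext x : ~ X x -> exists n a y, X y /\ b ^+ n = a * x + y.
  move=> nXx; pose Y := [set z | exists a y, X y /\ z = a * x + y].
  apply: contrapT => H; apply: (maxX Y); last first.
    right; split=> [z Jz||n [a [y [Xy e]]]].
    - by exists 0, z; split; [exact: JX|rewrite mul0r add0r].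
    - split; first by exists 0, 0; rewrite mul0r addr0.
      move=> c z z' [a [y [Xy ->]]] [a' [y' [Xy' ->]]].
      exists (c * a + a'), (c * y + y'); split; first exact: XD.
      by ring.
    - by apply: H; exists n, a, y.
  split=> [z Xz|YX]; first by exists 0, z; rewrite mul0r add0r.
  by apply: nXx; apply: YX; exists 1, 0; rewrite mul1r addr0.
have iX : idealr_closed (fun x => `[< X x >]).
  split; first exact/asboolP.
    by apply/negP => /asboolP; apply: (Xb 0).
  by move=> a u v /asboolP Xu /asboolP Xv; apply/asboolP; apply: XD.
have pX : prime_idealr_closed (fun x => `[< X x >]).
  move=> u v /asboolP Xuv; apply/orP.
  case: (pselect (X u)) => [Xu|nu]; first by left; apply/asboolP.
  case: (pselect (X v)) => [Xv|nv]; first by right; apply/asboolP.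
  have [n [a [y [Xy e]]]] := ext u nu; have [m [c [z [Xz e']]]] := ext v nv.
  exfalso; apply: (Xb (n + m)%N); rewrite exprD e e'.
  have -> : (a * u + y) * (c * v + z) = a * c * (u * v) + ((a * u) * z + (c * v + z) * y) by ring.
  by apply: (XD) => //; apply: (XD) => //; apply: XM.
exists (PrimeIdeal iX pX); split=> [x Jx|].
  by apply/asboolP; apply: JX.
by apply/negP => /asboolP; rewrite -[b]expr1; apply: Xb.
Qed.

Section Germ.
Variable p : Spec A.
Implicit Types z w : local_ring p.

Lemma const_germD a b : const_germ (a + b) p = const_germ a p + const_germ b p.
Proof.
rewrite /const_germ [RHS]loc_addE; apply: frac_eq.
by rewrite !dval_dmul !dval_dunit; ring.
Qed.
Lemma const_germM a b : const_germ (a * b) p = const_germ a p * const_germ b p.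
Proof.
by rewrite /const_germ [RHS]loc_mulE; apply: frac_eq; rewrite !dval_dmul !dval_dunit; ring.
Qed.
Lemma const_germ1 : const_germ 1 p = 1. Proof. by []. Qed.
Lemma const_germ0 : const_germ 0 p = 0. Proof. by []. Qed.
Lemma const_germ_sum (T : Type) (r : seq T) (E : T -> A) :
  const_germ (\sum_(i <- r) E i) p = \sum_(i <- r) const_germ (E i) p.
Proof. exact: (big_morph (fun a => const_germ a p) const_germD const_germ0). Qed.

Lemma const_germ_frac g a (s : denom p) : val s = g ->
  const_germ g p * frac a s = const_germ a p.
Proof.
move=> <-; rewrite /const_germ [LHS]loc_mulE; apply: frac_eq.
by rewrite dval_dmul !dval_dunit /dval; ring.
Qed.

Lemma const_germ_inj g z w : g \notin pideal p ->
  const_germ g p * z = const_germ g p * w -> z = w.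
Proof.
move=> gp e; pose i : local_ring p := frac 1 (Sub g gp).
have gi : i * const_germ g p = 1 by rewrite mulrC (@const_germ_frac g).
by rewrite -[z]mul1r -gi -mulrA e mulrA gi mul1r.
Qed.

Lemma const_germ_eqP a b : const_germ a p = const_germ b p <->
  exists2 u, u \notin pideal p & u * (a - b) = 0.
Proof.
split.
  move=> /eqP/frac_eqP[u up e]; exists u => //.
  by rewrite -e !dval_dunit !mulr1.
move=> [u up e]; apply/eqP/frac_eqP; exists u => //.
by rewrite !dval_dunit !mulr1.
Qed.
End Germ.

Definition basic g : set (Spec A) := [set p | g \notin pideal p].

Lemma basic_open g : zariski_open (basic g).
Proof.
exists [set g]; apply/seteqP; split=> p /=; first by exists g.
by case=> _ -> .
Qed.

Lemma open_basic V p : zariski_open V -> V p -> exists2 g, basic g p & basic g `<=` V.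
Proof.
move=> [E ->] [g Eg gp]; exists g => // q gq; by exists g.
Qed.

Lemma basicM g g' : basic (g * g') = basic g `&` basic g'.
Proof.
by apply/seteqP; split=> q; rewrite /basic /= pidealM => /andP.
Qed.

(** Locally, a section [s] is handled through equations [g * s = a] over basic open sets
    of [g]: such equations add up and multiply without manipulation of fractions. *)
Lemma regular_local V (s : germs A) p : regular V s -> V p ->
  exists g a, [/\ basic g p, basic g `<=` V &
    forall q, basic g q -> const_germ g q * s q = const_germ a q].
Proof.
move=> sV Vp; have [W [Wo Wp WV [a [b sE]]]] := sV p Vp.
have [g gp gW] := open_basic Wo Wp; have [bp _] := sE p Wp.
exists (g * b), (g * a); rewrite basicM; split=> //.
  by move=> q [gq _]; apply: WV; apply: gW.
move=> q [gq bq]; have [bq' ->] := sE q (gW _ gq).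
by rewrite !const_germM -mulrA (@const_germ_frac _ b).
Qed.

Lemma local_regular V (s : germs A) :
  (forall p, V p -> exists g a, [/\ basic g p, basic g `<=` V &
    forall q, basic g q -> const_germ g q * s q = const_germ a q]) ->
  regular V s.
Proof.
move=> H p Vp; have [g [a [gp gV e]]] := H p Vp.
exists (basic g); split=> //; first exact: basic_open.
exists a, g => q gq; exists gq; apply: (@const_germ_inj q g) => //.
by rewrite e// (@const_germ_frac _ g).
Qed.

Definition div_germ a g : germs A := fun q =>
  if insub g is Some s then frac a s else 0.

Lemma div_germE a g q : basic g q -> const_germ g q * div_germ a g q = const_germ a q.
Proof. by move=> gq; rewrite /div_germ insubT; apply: const_germ_frac. Qed.

Lemma div_germ_regular V a g : V `<=` basic g -> zariski_open V ->
  regular V (div_germ a g).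
Proof.
move=> Vg Vo; apply: local_regular => p Vp; have [g' g'p g'V] := open_basic Vo Vp.
exists (g * g'), (g' * a); rewrite basicM; split; first by split=> //; exact: Vg.
  by move=> q [_ /g'V].
move=> q [gq g'q]; rewrite !const_germM [const_germ g q * _]mulrC -mulrA div_germE//.
Qed.

(** Otherwise some prime ideal in the basic open set of [g] would contain the
    annihilator of [x]. *)
Lemma vanishing_locally x g : (forall q, basic g q -> const_germ x q = 0) ->
  exists n, g ^+ n * x = 0.
Proof.
move=> H; apply: contrapT => nx.
have [||q [Jq gq]] := @prime_avoiding [set u | u * x = 0] g.
- by split=> [|a u v /= u0 v0]; rewrite /= ?mul0r// mulrDl -mulrA u0 mulr0 add0r.
- by move=> n /= e; apply: nx; exists n.
have := H q gq; rewrite -const_germ0 => /const_germ_eqP[u uq]; rewrite subr0 => /Jq.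
by rewrite (negbTE uq).
Qed.

(** A partition of unity up to a power of [b]: otherwise some prime ideal in the basic
    open set of [b] would contain all the [ha.1]. *)
Lemma basic_cover (E : set (A * A)) b :
  (forall q, basic b q -> exists2 ha, E ha & basic ha.1 q) ->
  exists n (r : seq (A * (A * A))), (forall c, c \in r -> E c.2) /\
    b ^+ n = \sum_(c <- r) c.1 * c.2.1.
Proof.
move=> cov; apply: contrapT => nx.
have [||q [Jq bq]] := @prime_avoiding
  [set u | exists r : seq (A * (A * A)), (forall c, c \in r -> E c.2) /\
    u = \sum_(c <- r) c.1 * c.2.1] b.
- split=> [|a u v [r [rE ->]] [r' [r'E ->]]]; first by exists [::]; rewrite big_nil.
  exists ([seq (a * c.1, c.2) | c <- r] ++ r'); split.
    move=> c; rewrite mem_cat => /orP[/mapP[c' c'r ->]|/r'E//].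
    exact: (rE c').
  rewrite big_cat big_map mulr_sumr; congr (_ + _); apply: eq_bigr => c _.
  by rewrite mulrA.
- by move=> n [r rE]; apply: nx; exists n, r.
have [ha Eha hq] := cov q bq.
have : ha.1 \in pideal q.
  apply: Jq; exists [:: (1, ha)]; split; last by rewrite big_seq1 mul1r.
  by move=> c; rewrite inE => /eqP->.
by rewrite (negbTE hq).
Qed.

(** A partition of unity selects finitely many local equations [h * t = a]. Multiplying
    them by powers of [h * b] makes them compatible, that is [a * h' = a' * h]. A second
    partition of unity [b ^+ n = \sum r * h] then yields the numerator [\sum r * a]. *)
Lemma basic_section b V (t : germs A) : regular V t -> basic b `<=` V ->
  exists n x, forall q, basic b q -> const_germ (b ^+ n) q * t q = const_germ x q.
Proof.
move=> tV bV.
pose E : set (A * A) := [set ha | forall q, basic (ha.1 * b) q ->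
  const_germ ha.1 q * t q = const_germ ha.2 q].
have Ecov q : basic b q -> exists2 ha, E ha & basic ha.1 q.
  move=> bq; have [g [a [gq gV e]]] := regular_local tV (bV q bq).
  by exists (g, a) => //= q'; rewrite basicM => -[gq' _]; apply: e.
have [n [r [rE bn]]] := basic_cover Ecov.
pose N0 (c c' : A * (A * A)) := fun m : nat => (c.2.1 * c'.2.1 * b) ^+ m * (c.2.2 * c'.2.1 - c'.2.2 * c.2.1) = 0.
have comp (c c' : A * (A * A)) : c \in r -> c' \in r -> exists m, N0 c c' m.
  move=> cr c'r; apply: vanishing_locally => q; rewrite !basicM => -[[cq c'q] bq].
  have e := rE c cr q; have e' := rE c' c'r q; rewrite !basicM in e e'.
  rewrite const_germD -mulN1r !const_germM -(e _)// -(e' _)//; set x := const_germ (-1) q.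
  have -> : x = -1 by apply/eqP; rewrite -addr_eq0 -[1]const_germ1 /x -const_germD addNr.
  by ring.
have [m Hm] : exists m, forall c c', c \in r -> c' \in r -> N0 c c' m.
  pose M (c c' : A * (A * A)) := if pselect (exists m, N0 c c' m) is left e then sval (cid e) else 0%N.
  exists (\max_(c <- r) \max_(c' <- r) M c c')%N => c c' cr c'r.
  have [k ke lek] : exists2 k, N0 c c' k & (k <= M c c')%N.
    rewrite /M; case: pselect => [ex|[]]; last exact: comp.
    by case: cid => k ke; exists k.
  have le : (k <= \max_(c <- r) \max_(c' <- r) M c c')%N.
    apply: leq_trans lek _.
    apply: leq_trans (leq_bigmax_seq _ cr isT).
    exact: leq_bigmax_seq.
  by rewrite /N0 -(subnK le) exprD -mulrA ke mulr0.
pose h (c : A * (A * A)) : A := c.2.1 * (c.2.1 * b) ^+ m.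
pose a (c : A * (A * A)) : A := c.2.2 * (c.2.1 * b) ^+ m.
have ha (c c' : A * (A * A)) : c \in r -> c' \in r -> a c * h c' = a c' * h c.
  move=> cr c'r; apply/eqP; rewrite -subr_eq0; apply/eqP.
  rewrite /a /h -[RHS](mulr0 (b ^+ m)) -(Hm c c' cr c'r) !exprMn.
  by ring.
have tE c : c \in r -> forall q, basic b q -> basic (h c) q ->
    const_germ (h c) q * t q = const_germ (a c) q.
  move=> cr q bq; rewrite /h /a basicM => -[cq _].
  have := rE c cr q; rewrite basicM => /(_ (conj cq bq)) e.
  by rewrite !const_germM -e; ring.
have cov q : basic b q -> exists2 c, c \in r & basic (h c) q.
  move=> bq; apply: contrapT => H.
  have : b ^+ n \in pideal q.
    rewrite bn big_seq; elim/big_rec: _ => [|c y cr yq]; first exact: pideal0.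
    apply: pideal_comb yq; apply: contrapT => /negP cq; apply: H; exists c => //.
    by rewrite /h basicM; split=> //; apply: pidealX; rewrite pidealM cq.
  by rewrite (negbTE (pidealX _ bq)).
have [|n' [r' [r'E bn']]] := @basic_cover [set ha | exists2 c, c \in r & ha = (h c, a c)] b.
  by move=> q /cov[c cr hq]; exists (h c, a c) => //; exists c.
exists n', (\sum_(i <- r') i.1 * i.2.2) => q bq; have [c cr hq] := cov q bq.
apply: (const_germ_inj hq); rewrite mulrCA tE// -!const_germM; congr (const_germ _ q).
rewrite bn' mulr_suml mulr_sumr big_seq [RHS]big_seq; apply: eq_bigr => i ir'.
have [c' c'r ->] := r'E i ir'; rewrite /=.
by rewrite -mulrA [h c' * _]mulrC (ha c c')//; ring.
Qed.

End Primes.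

(** * From a resolution of modules to a resolution of sheaves *)

Lemma fsbig_seqT (T : choiceType) : finite_set [set: T] ->
  exists2 r : seq T, uniq r /\ (forall i, i \in r) &
  forall (V : nmodType) (E : T -> V), \sum_(i \in [set: T]) E i = \sum_(i <- r) E i.
Proof.
move=> fT; exists (fset_set [set: T]) => [|V E]; last exact: fsbig_finite.
by split=> [|i]; rewrite ?fset_uniq// in_fset_set// inE.
Qed.

Section LocalMap.
Variables (A B : comNzRingType) (f : {rmorphism A -> B}) (q : Spec B).
Local Notation p := (spec_map f q).
Implicit Types z w : local_ring p.

Lemma local_mapD z w : local_map (z + w) = local_map z + local_map w.
Proof.
case: (fracP z) (fracP w) => [a [s ->]] [b [t ->]].
rewrite [frac a s + _]loc_addE !local_mapE [RHS]loc_addE; apply: frac_eq.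
by rewrite !dval_dmul /dval /= rmorphD !rmorphM; ring.
Qed.
Lemma local_mapM z w : local_map (z * w) = local_map z * local_map w.
Proof.
case: (fracP z) (fracP w) => [a [s ->]] [b [t ->]].
rewrite [frac a s * _]loc_mulE !local_mapE [RHS]loc_mulE; apply: frac_eq.
by rewrite !dval_dmul /dval /= !rmorphM; ring.
Qed.
Lemma local_map_const a : local_map (const_germ a p) = const_germ (f a) q.
Proof.
by rewrite /const_germ local_mapE; apply: frac_eq; rewrite /dval /= rmorph1.
Qed.

End LocalMap.

Section Resolution.
Variables (A B : comNzRingType) (f : {rmorphism A -> B}) (U : set (Spec A)).
Variables (I : nat -> choiceType) (D : forall m, I m.+1 -> I m -> A) (e : I 0 -> B).
Arguments D {m}.
Hypothesis finI : forall m, finite_set [set: I m].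

Definition mod_diff m (s : I m.+1 -> A) : I m -> A :=
  fun j => \sum_(i \in [set: I m.+1]) D i j * s i.
Definition mod_aug (s : I 0 -> A) : B := \sum_(i \in [set: I 0]) e i * f (s i).

Hypothesis mod_diff_diff : forall m (s : I m.+2 -> A) j, mod_diff (mod_diff s) j = 0.
Hypothesis mod_aug_diff : forall s : I 1 -> A, mod_aug (mod_diff s) = 0.
Hypothesis mod_exact : forall m (s : I m.+1 -> A),
  (forall j, mod_diff s j = 0) -> exists t, forall i, mod_diff t i = s i.
Hypothesis mod_exact0 : forall s : I 0 -> A,
  mod_aug s = 0 -> exists t, forall i, mod_diff t i = s i.
Hypothesis mod_surj : forall x : B, exists s, mod_aug s = x.

(** As there are finitely many components, their local equations can be given the same
    denominator. *)
Lemma common_denominator m V (s : I m -> germs A) p : free_section V s -> V p ->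
  zariski_open V ->
  exists g (a : I m -> A), [/\ basic g p, basic g `<=` V &
    forall j q, basic g q -> const_germ g q * s j q = const_germ (a j) q].
Proof.
move=> sV Vp Vo; have [r [_ rT] _] := fsbig_seqT (@finI m).
have [g0 g0p g0V] := open_basic Vo Vp.
suff [g [a [gp gV H]]] : exists g (a : I m -> A), [/\ basic g p, basic g `<=` V &
    forall j q, j \in r -> basic g q -> const_germ g q * s j q = const_germ (a j) q].
  by exists g, a; split=> // j q; apply: H.
elim: r {rT} => [|i r [g [a [gp gV H]]]]; first by exists g0, (fun=> 0).
have [g' [b [g'p g'V H']]] := regular_local (sV i) Vp.
exists (g * g'), (fun j => if j == i then g * b else g' * a j); rewrite basicM; split=> //.
  by move=> q [gq _]; apply: gV.
move=> j q; rewrite inE; case: eqP => [-> _|_ /= jr] [gq g'q].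
  by rewrite !const_germM -mulrA H'.
by rewrite !const_germM [const_germ g q * _]mulrC -mulrA H.
Qed.

Lemma free_diff_const m (s : I m.+1 -> germs A) (a : I m.+1 -> A) g q :
  (forall i, const_germ g q * s i q = const_germ (a i) q) ->
  forall j, const_germ g q * free_diff (@D) s j q = const_germ (mod_diff a j) q.
Proof.
move=> H j; rewrite /free_diff /mod_diff; have [r _ rE] := fsbig_seqT (@finI m.+1).
rewrite !rE mulr_sumr const_germ_sum; apply: eq_bigr => i _.
by rewrite mulrCA H const_germM.
Qed.

Definition sheaf_aug (V : set (Spec A)) (s : I 0 -> germs A) : germs B :=
  fun q => \sum_(i \in [set: I 0]) const_germ (e i) q * local_map (s i (spec_map f q)).

Lemma sheaf_aug_const V (s : I 0 -> germs A) (a : I 0 -> A) g q :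
  (forall i, const_germ g (spec_map f q) * s i (spec_map f q) =
             const_germ (a i) (spec_map f q)) ->
  const_germ (f g) q * sheaf_aug V s q = const_germ (mod_aug a) q.
Proof.
move=> H; rewrite /sheaf_aug /mod_aug; have [r _ rE] := fsbig_seqT (finI 0).
rewrite !rE mulr_sumr const_germ_sum; apply: eq_bigr => i _.
by rewrite mulrCA -local_map_const -local_mapM H local_map_const const_germM.
Qed.

Lemma div_boundary m (s : I m -> germs A) (t : I m.+1 -> A) (a : I m -> A) u g W :
  W `<=` basic (u * g) -> zariski_open W ->
  (forall i, mod_diff t i = u * a i) ->
  (forall j q, W q -> const_germ g q * s j q = const_germ (a j) q) ->
  exists T : I m.+1 -> germs A, free_section W T /\
    forall j q, W q -> free_diff (@D) T j q = s j q.
Proof.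
move=> Wg Wo tE sE; exists (fun l => div_germ (t l) (u * g)).
split=> [l|j q Wq]; first exact: div_germ_regular.
have ugq := Wg q Wq; apply: (const_germ_inj ugq).
rewrite (@free_diff_const m _ t); last by move=> i; exact: div_germE.
by rewrite tE !const_germM -mulrA sE.
Qed.

(** With a common denominator [g], a cycle has numerators [a] whose differential is
    killed by some [u] invertible at the given point. Then [u * a] is a cycle over the
    ring, and the quotient by [u * g] of a chain that it bounds is the required
    section. *)
Lemma cycles_bound m : exact_at_succ U (@D) m.
Proof.
move=> V s Vo VU sV; split=> [cyc p Vp|bdry j p Vp].
  have [g [a [gp gV H]]] := common_denominator sV Vp Vo.
  have [r [_ rT] _] := fsbig_seqT (@finI m).
  have [u up uE] : exists2 u, basic u p & forall j, u * mod_diff a j = 0.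
    suff [u up uE] : exists2 u, basic u p & forall j, j \in r -> u * mod_diff a j = 0.
      by exists u => // j; apply: uE; exact: rT.
    elim: r {rT} => [|i r [u up IH]]; first by exists 1 => //; exact: pideal1.
    have := free_diff_const (fun i => H i p gp) i; rewrite cyc// mulr0 -const_germ0.
    move=> /esym/const_germ_eqP[v vp]; rewrite subr0 => ve.
    exists (u * v); first by rewrite basicM.
    move=> j; rewrite inE => /orP[/eqP->|jr]; first by rewrite -mulrA ve mulr0.
    by rewrite mulrAC IH// mul0r.
  have [|t tE] := @mod_exact _ (fun i => u * a i).
    move=> j; rewrite -(uE j) /mod_diff; have [r' _ rE] := fsbig_seqT (@finI m.+1).
    by rewrite !rE mulr_sumr; apply: eq_bigr => i _; rewrite mulrCA.
  have [||T [TW TE]] := @div_boundary _ s t a u g (basic (u * g)) _ (basic_open _) tE.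
  - by [].
  - by move=> j q; rewrite basicM => -[_]; apply: H.
  exists (basic (u * g)), T; split=> //; first exact: basic_open.
    by rewrite basicM.
  by move=> q; rewrite basicM => -[_ /gV].
have [W [t [Wo Wp WV tW tE]]] := bdry p Vp.
have [g [a [gp gW H]]] := common_denominator tW Wp Wo.
apply: (const_germ_inj gp); rewrite mulr0 (@free_diff_const m _ (mod_diff a)).
  by rewrite mod_diff_diff.
by move=> i; rewrite -tE//; apply: free_diff_const => l; exact: H.
Qed.

Lemma sheaf_aug_morphism : sheaf_morphism f U sheaf_aug.
Proof.
have [r _ rE] := fsbig_seqT (finI 0).
split=> [V s Vo VU sV|V W s t _ _ _ _ _ _ st q Wq|V a s t Vo VU aV sV tV q Vq].
- apply: local_regular => q Vq.
  have [g [a [gp gV H]]] := common_denominator sV Vq Vo.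
  exists (f g), (mod_aug a); split=> //; first by move=> q' /= ?; apply: gV.
  by move=> q' gq'; apply: sheaf_aug_const => i; apply: H.
- by rewrite /sheaf_aug !rE; apply: eq_bigr => i _; rewrite st.
- rewrite /sheaf_aug !rE mulr_sumr -big_split; apply: eq_bigr => i _.
  by rewrite local_mapD local_mapM mulrDr mulrCA.
Qed.

(** A section over the preimage of a basic open set has the denominator [f g ^+ n],
    which is the image of an element of [A]; lifting its numerator is enough. *)
Lemma sheaf_aug_surjective : sheaf_surjective f U sheaf_aug.
Proof.
move=> V t Vo VU tV p Vp; have [g gp gV] := open_basic Vo Vp.
have [|n [x xE]] := @basic_section _ (f g) _ t tV; first by move=> q gq; exact: (gV (spec_map f q) gq).
have [a aE] := mod_surj x.
exists (basic g), (fun i => div_germ (a i) (g ^+ n)).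
have gn : basic g `<=` basic (g ^+ n) by move=> q; apply: pidealX.
split=> //; first exact: basic_open.
  by move=> i; apply: div_germ_regular => //; exact: basic_open.
move=> q gq; have fgq : basic (f g ^+ n) q by apply: pidealX.
apply: (const_germ_inj fgq); rewrite xE// -rmorphXn (@sheaf_aug_const _ _ a) ?aE//.
by move=> i; apply: div_germE; apply: gn.
Qed.

Lemma sheaf_aug_kernel V (s : I 0 -> germs A) :
  zariski_open V -> V `<=` U -> free_section V s ->
  (forall q, V (spec_map f q) -> sheaf_aug V s q = 0) <-> is_boundary (@D) V s.
Proof.
move=> Vo VU sV; split=> [ker p Vp|bdry q Vq].
  have [g [a [gp gV H]]] := common_denominator sV Vp Vo.
  have [n nE] : exists n, f g ^+ n * mod_aug a = 0.
    apply: vanishing_locally => q gq.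
    rewrite -(@sheaf_aug_const V s a g q); first by rewrite ker ?mulr0//; exact: (gV (spec_map f q) gq).
    by move=> i; apply: H.
  have [|t tE] := @mod_exact0 (fun i => g ^+ n * a i).
    rewrite -nE /mod_aug; have [r _ rE] := fsbig_seqT (finI 0).
    rewrite !rE mulr_sumr; apply: eq_bigr => i _.
    by rewrite rmorphM rmorphXn mulrCA.
  have gng q : basic g q -> basic (g ^+ n * g) q.
    by move=> gq; rewrite basicM; split=> //; apply: pidealX.
  have [||T [TW TE]] := @div_boundary _ s t a (g ^+ n) g (basic g) _ (basic_open _) tE.
  - exact: gng.
  - by move=> j q; apply: H.
  by exists (basic g), T; split=> //; exact: basic_open.
have [W [t [Wo Wp WV tW tE]]] := bdry _ Vq.
have [g [a [gp gW H]]] := common_denominator tW Wp Wo.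
apply: (@const_germ_inj _ q (f g)) => //; rewrite mulr0 (@sheaf_aug_const _ _ (mod_diff a)).
  by rewrite mod_aug_diff.
by move=> i; rewrite -tE//; apply: free_diff_const => l; exact: H.
Qed.

Theorem resolution_of_module : is_resolution_of_pushforward f U (@D).
Proof.
split; first exact: cycles_bound.
exists sheaf_aug; split.
- exact: sheaf_aug_morphism.
- exact: sheaf_aug_surjective.
- exact: sheaf_aug_kernel.
Qed.

End Resolution.

(** * Strata of the periodic arrangement *)

Section Cokernel.
Variables (m n : nat) (M : 'M[int]_(m, n)).

Lemma coker_eqP (u v : 'rV[int]_n) :
  \pi_(coker M) u = \pi_(coker M) v <-> exists w : 'rV[int]_m, u - v = w *m M.
Proof.
split.
  by move/eqP; rewrite -Quotient.idealrBE => /asboolP.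
by move=> e; apply/eqP; rewrite -Quotient.idealrBE; apply/asboolP.
Qed.

(** Two of the multiples of [v] have the same class, by the pigeonhole principle. *)
Lemma coker_multiple (v : 'rV[int]_n) : finite_set [set: coker M] ->
  exists2 N : nat, (0 < N)%N & exists w : 'rV[int]_m, v *+ N = w *m M.
Proof.
move=> fc; pose S := fset_set [set: coker M].
pose g (l : nat) : coker M := \pi_(coker M) (v *+ l).
have : ~~ uniq [seq g l | l <- iota 0 (size S).+1].
  apply/negP => /uniq_leq_size; move=> /(_ S).
  rewrite size_map size_iota ltnn => H; suff : false by [].
  apply: H => x _; by rewrite /S in_fset_set// inE.
move/(uniqPn (g 0%N)) => [i [j [ij]]]; rewrite size_map size_iota => js.
rewrite !(nth_map 0%N) ?size_iota//; last exact: ltn_trans js.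
rewrite !nth_iota//; last exact: ltn_trans js.
rewrite !add0n => /esym/coker_eqP[w e].
exists (j - i)%N; first by rewrite subn_gt0.
by exists w; rewrite mulrnBr ?(ltnW ij).
Qed.
End Cokernel.

Section Geometry.
Variables (R : realType) (n k : nat) (psi : 'M[int]_(n, k)).
Hypothesis finC : finite_set [set: coker psi].
Local Notation V := 'rV[R]_k.
Implicit Types (x y z v : V) (w : 'rV[int]_k) (i : 'I_n).
Local Notation H i x := (eval_psi psi i x).
Local Notation hs := (map_mx intr).

Lemma eval_psiE i x : H i x = \sum_j x 0 j * (psi i j)%:~R.
Proof. by rewrite /eval_psi mxE; apply: eq_bigr => j _; rewrite !mxE. Qed.

Lemma eval_psiZ i a x : H i (a *: x) = a * H i x.
Proof. by rewrite /eval_psi -scalemxAl mxE. Qed.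
Lemma eval_psi0 i : H i (0 : V) = 0.
Proof. by rewrite /eval_psi mul0mx mxE. Qed.
Lemma eval_psi_hs i w : H i (hs w : V) = ((w *m psi^T) 0 i)%:~R.
Proof.
rewrite eval_psiE mxE rmorph_sum; apply: eq_bigr => j _.
by rewrite !mxE rmorphM.
Qed.

(** A multiple of each vector of the standard basis is in the image of [psi]. *)
Lemma eval_psi_inj x : (forall i, H i x = 0) -> x = 0.
Proof.
move=> H0; apply/rowP => j; rewrite mxE.
have [N N0 [w e]] := coker_multiple (delta_mx 0 j) finC.
have : x 0 j *+ N = \sum_i (w 0 i)%:~R * H i x.
  under eq_bigr do rewrite eval_psiE mulr_sumr.
  rewrite exchange_big /=.
  under eq_bigr do under eq_bigr do rewrite mulrCA -intrM.
  have E l : \sum_i (w 0 i * psi i l) = ((delta_mx 0 j : 'rV_k) *+ N) 0 l.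
    by rewrite e mxE.
  under eq_bigr do rewrite -mulr_sumr -rmorph_sum E mulmxnE mxE eqxx /=.
  rewrite (bigD1 j)//= big1 ?addr0 => [|l /negbTE lj].
    by rewrite eqxx rmorphMn rmorph1 mulr_natr.
  by rewrite lj mul0rn rmorph0 mulr0.
rewrite big1 => [|i _]; last by rewrite H0 mulr0.
by move/eqP; rewrite mulrn_eq0 gtn_eqF//= => /eqP.
Qed.

Lemma row_psi_inj w : w *m psi^T = 0 -> w = 0.
Proof.
move=> e; have : hs w = 0 :> V.
  by apply: eval_psi_inj => i; rewrite eval_psi_hs e mxE.
by move/rowP => ew; apply/rowP => j; have := ew j; rewrite !mxE => /eqP; rewrite intr_eq0 => /eqP.
Qed.

Local Notation ss := (same_stratum psi).
Definition stratum_of x : set V := [set y | ss x y].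

Lemma same_stratum_refl x : ss x x. Proof. exact/same_stratumE. Qed.
Lemma same_stratum_sym x y : ss x y -> ss y x.
Proof. by move/same_stratumE => e; apply/same_stratumE => i; have [-> ->] := e i. Qed.
Lemma same_stratum_trans y x z : ss x y -> ss y z -> ss x z.
Proof.
move=> /same_stratumE e /same_stratumE e'; apply/same_stratumE => i.
by have [-> ->] := e i; exact: e'.
Qed.
Hint Resolve same_stratum_refl : core.

Lemma stratum_ofP x y : stratum_of x = stratum_of y <-> ss x y.
Proof.
split=> [e|e].
  by have : stratum_of y y := same_stratum_refl y; rewrite -e.
apply/seteqP; split=> z; rewrite /stratum_of /= => h.
  exact: same_stratum_trans (same_stratum_sym e) h.
exact: same_stratum_trans e h.
Qed.

Lemma same_stratumT x y w : ss (x + hs w) (y + hs w) <-> ss x y.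
Proof.
split=> h; last exact: same_stratumDint.
have := same_stratumDint (- w) h.
by rewrite map_mxN !addrK.
Qed.

Lemma pi_torusP x y : \pi_(torus R k) x = \pi_(torus R k) y <->
  exists w, x = y + hs w.
Proof.
split.
  move/eqP; rewrite -Quotient.idealrBE => /asboolP[w e].
  by exists w; rewrite -e addrC subrK.
move=> [w ->]; apply/eqP; rewrite -Quotient.idealrBE addrAC subrr add0r.
by apply/asboolP; exists w.
Qed.

Definition torus_stratum x : set (torus R k) := \pi_(torus R k) @` stratum_of x.

Lemma torus_stratumP x y : torus_stratum x = torus_stratum y <-> exists w, ss (x + hs w) y.
Proof.
split=> [e|[w e]].
  have : torus_stratum y (\pi_(torus R k) y) by exists y => //; exact: same_stratum_refl.
  rewrite -e => -[z xz /esym/pi_torusP[w ->]].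
  by exists w; apply/same_stratumT.
have key x1 x2 w' : ss (x1 + hs w') x2 -> torus_stratum x1 `<=` torus_stratum x2.
  move=> ab _ [z az <-]; exists (z + hs w'); last by apply/pi_torusP; exists w'.
  by apply: same_stratum_trans (same_stratum_sym ab) _; apply/same_stratumT.
apply/seteqP; split; first exact: key e.
apply: (key _ _ (- w)); rewrite -(same_stratumT _ _ w) map_mxN subrK; exact: same_stratum_sym.
Qed.

Lemma torus_stratumT x w : torus_stratum (x + hs w) = torus_stratum x.
Proof. by apply/torus_stratumP; exists (- w); rewrite map_mxN addrK. Qed.

Definition ceil_vec x : 'rV[int]_n := \row_i Num.ceil (H i x).

Lemma ceil_vec_same x y : ss x y -> ceil_vec x = ceil_vec y.
Proof.
move/same_stratumE => e; apply/rowP => i; rewrite !mxE !ceil_floor.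
by have [-> ->] := e i.
Qed.

Lemma ceil_vecD x w : ceil_vec (x + hs w) = ceil_vec x + w *m psi^T.
Proof.
apply/rowP => i; rewrite [RHS]mxE ![ceil_vec _ 0 i]mxE eval_psiD eval_psi_hs.
by rewrite ceilDrz ?intr_int// intrKceil.
Qed.

Lemma ceilH_stratum_of x i : ceilH psi (stratum_of x) i = ceil_vec x 0 i.
Proof.
have /ceil_vec_same -> : ss x (xget 0 (stratum_of x)) by exact: (xgetPex 0 (ex_intro _ x (same_stratum_refl x))).
by rewrite mxE.
Qed.

(** The signs are those of all the translated functionals [H i - c]. This combinatorial
    form of the closure relation ([closureP]) does not depend on a bound for the
    levels. *)
Definition face_of y x := forall i (c : int),
  sg3 (H i y - c%:~R) = None \/ sg3 (H i y - c%:~R) = sg3 (H i x - c%:~R).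

Lemma same_stratum_sg3 x y : ss x y <-> forall i (c : int),
  sg3 (H i x - c%:~R) = sg3 (H i y - c%:~R).
Proof.
split=> [h i c|h].
  case: (h i) => [[-> _]//|[a [/andP[a1 a2] /andP[a3 a4]]]].
  have [ca|ca] := leP c a.
    have ca' : c%:~R <= a%:~R :> R by rewrite ler_int.
    apply: (@etrans _ _ (Some true)); [|apply: esym]; apply/sg3_pos; lra.
  have ca' : (a + 1)%:~R <= c%:~R :> R by rewrite ler_int; lia.
  apply: (@etrans _ _ (Some false)); [|apply: esym]; apply/sg3_neg; lra.
move=> i; have [xi|xi] := boolP (H i x \is a Num.int).
  left; split=> //; have := h i (Num.floor (H i x)); rewrite floorK// subrr.
  by rewrite (proj2 (sg3_None 0) erefl) => /esym/sg3_None/eqP; rewrite subr_eq0 => /eqP.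
right; exists (Num.floor (H i x)).
have /andP[f1 f2] := floor_itv (H i x).
have f1' : (Num.floor (H i x))%:~R < H i x.
  by rewrite lt_neqAle f1 andbT -intrEfloor.
have e1 : sg3 (H i x - (Num.floor (H i x))%:~R) = Some true.
  by apply/sg3_pos; rewrite subr_gt0.
have e2 : sg3 (H i x - (Num.floor (H i x) + 1)%:~R) = Some false.
  by apply/sg3_neg; rewrite subr_lt0.
rewrite f1' f2; split=> //; have := h i (Num.floor (H i x) + 1); have := h i (Num.floor (H i x)).
rewrite e1 e2 => /esym/sg3_pos; rewrite subr_gt0 => -> /esym/sg3_neg.
by rewrite subr_lt0 => ->.
Qed.

Lemma face_ofT x y w : face_of (y + hs w) (x + hs w) <-> face_of y x.
Proof.
have E z i (c : int) : H i (z + hs w) - c%:~R = H i z - (c - (w *m psi^T) 0 i)%:~R.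
  by rewrite eval_psiD eval_psi_hs intrD rmorphN; ring.
split=> h i c; last by rewrite !E; exact: h.
by have := h i (c + (w *m psi^T) 0 i); rewrite !E addrK.
Qed.

Lemma face_of_le x y i (c : int) : face_of y x -> H i x <= c%:~R -> H i y <= c%:~R.
Proof.
move=> h; rewrite -(subr_le0 _ (H i x)) -(subr_le0 _ (H i y)); have := h i c.
case E: (sg3 (H i y - _)) => [[]|].
- by move=> -[//|/esym/sg3_pos]; rewrite ltNge => /negbTE->.
- by move/sg3_neg: E => /ltW.
- by move/sg3_None: E => ->; rewrite lexx.
Qed.

Lemma face_of_ge x y i (c : int) : face_of y x -> c%:~R <= H i x -> c%:~R <= H i y.
Proof.
move=> h; rewrite -(subr_ge0 _ (H i x)) -(subr_ge0 _ (H i y)); have := h i c.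
case E: (sg3 (H i y - _)) => [[]|].
- by move/sg3_pos: E => /ltW.
- by move=> -[//|/esym/sg3_neg]; rewrite ltNge => /negbTE->.
- by move/sg3_None: E => ->; rewrite lexx.
Qed.

Lemma face_of_ceil_vec x y i : face_of y x -> ceil_vec y 0 i <= ceil_vec x 0 i.
Proof.
move=> h; rewrite !mxE ceil_le_int; apply: face_of_le h _; exact: ceil_ge.
Qed.

End Geometry.

(** * Homogenization *)

Section Homogenize.
Variables (R : realType) (n k : nat) (psi : 'M[int]_(n, k)).
Hypothesis finC : finite_set [set: coker psi].
Local Notation V := 'rV[R]_k.
Local Notation W := 'rV[R]_(1 + k).
Implicit Types (x y z v : V) (w : 'rV[int]_k) (i : 'I_n).
Local Notation H i x := (eval_psi psi i x).
Local Notation ss := (same_stratum psi).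
Local Notation stratum_of := (stratum_of psi).
Local Notation face_of := (face_of psi).

(** Points are sent to the affine hyperplane of height 1, directions to the linear
    hyperplane of height 0. *)
Definition hat x : W := row_mx 1%:M x.
Definition emb m (b : 'M[R]_(m, k)) : 'M[R]_(m, 1 + k) := row_mx 0 b.

Lemma hatB x y : hat y - hat x = emb (y - x).
Proof. by rewrite /hat /emb opp_row_mx add_row_mx subrr. Qed.
Lemma emb_mul m p (P : 'M[R]_(m, p)) b : emb (P *m b) = P *m emb b.
Proof. by rewrite /emb mul_mx_row mulmx0. Qed.
Lemma rank_emb m (b : 'M[R]_(m, k)) : \rank (emb b) = \rank b.
Proof.
by rewrite /emb -mxrank_tr tr_row_mx trmx0 rank_col_0mx mxrank_tr.
Qed.
Lemma row_free_emb m (b : 'M[R]_(m, k)) : row_free (emb b) = row_free b.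
Proof. by rewrite /row_free rank_emb. Qed.
Lemma hat_notin_emb m x (b : 'M[R]_(m, k)) : ~~ (hat x <= emb b)%MS.
Proof.
apply/negP => /submxP[P]; rewrite -emb_mul => /eq_row_mx[/matrixP/(_ 0 0)/eqP].
by rewrite !mxE oner_eq0.
Qed.
Lemma W_split (z : W) : z = lsubmx z 0 0 *: hat 0 + emb (rsubmx z).
Proof.
rewrite /hat /emb scale_row_mx add_row_mx scaler0 add0r addr0 -{1}(hsubmxK z).
by congr row_mx; rewrite scalemx1 -mx11_scalar.
Qed.

Variable N : nat.

(** The index [None] is for the height, the others are for the hyperplanes [H i = c]
    with [-N <= c <= N], encoded by [a] with [c = a - N]. *)
Definition level : finType := option ('I_n * 'I_(N + N).+1).
Definition level_value (a : 'I_(N + N).+1) : int := a%:Z - N%:Z.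
Definition level_sign (a : 'I_(N + N).+1) : R := if a == 0 :> nat then -1 else 1.

(** The signs are chosen so that each constraint which defines the cone over a polytope
    [-N <= H <= u] reads [level_form j <= 0]: the height is nonnegative, the lowest
    levels bound [H] from below, all the other ones from above. *)
Definition level_form (j : level) : 'cV[R]_(1 + k) :=
  match j with
  | None => col_mx (-1)%:M 0
  | Some (i, a) => level_sign a *: col_mx (- level_value a)%:~R%:M (col i (map_mx intr psi)^T)
  end.

Local Notation ev := (Arrangement.ev level_form).
Local Notation cell := (Arrangement.cell level_form [set: level]%SET).
Local Notation dir := (Arrangement.dir level_form [set: level]%SET).
Local Notation dim := (Arrangement.dim level_form [set: level]%SET).
Implicit Types (s t : sgnv level).

Lemma ev_None_hat x : ev None (hat x) = -1.
Proof. by rewrite /Arrangement.ev /hat mul_row_col mulmx0 addr0 mul1mx mxE. Qed.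

Lemma ev_None_emb v : ev None (emb v) = 0.
Proof. by rewrite /Arrangement.ev /emb mul_row_col mulmx0 addr0 mul0mx mxE. Qed.

Lemma col_psiE i x : (x *m col i (map_mx intr psi)^T) 0 0 = H i x.
Proof. by rewrite /eval_psi !mxE; apply: eq_bigr => j _; rewrite !mxE. Qed.

Lemma ev_Some_hat i a x : ev (Some (i, a)) (hat x) = level_sign a * (H i x - (level_value a)%:~R).
Proof.
rewrite /Arrangement.ev /= -scalemxAr mxE /hat mul_row_col mul1mx mxE col_psiE; congr (_ * _).
by rewrite mxE mulr1n rmorphN addrC.
Qed.

Lemma ev_Some_emb i a v : ev (Some (i, a)) (emb v) = level_sign a * H i v.
Proof.
by rewrite /Arrangement.ev /= -scalemxAr mxE /emb mul_row_col mul0mx add0r col_psiE.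
Qed.

Lemma level_sign_neq0 a : level_sign a != 0.
Proof. by rewrite /level_sign; case: ifP; rewrite ?oppr_eq0 oner_eq0. Qed.

Lemma level_sign_sg3 a r r' : sg3 (level_sign a * r) = sg3 (level_sign a * r') <-> sg3 r = sg3 r'.
Proof.
rewrite /level_sign; case: ifP => _; rewrite ?mul1r// !mulN1r.
split; rewrite /sg3 !oppr_eq0 !oppr_gt0; case: (ltgtP r 0); case: (ltgtP r' 0) => //.
Qed.

Lemma level_sign_sg3N a r : sg3 (level_sign a * r) = None <-> sg3 r = None.
Proof.
split=> /sg3_None e; apply/sg3_None; last by rewrite e mulr0.
by apply/eqP; move/eqP: e; rewrite mulf_eq0 (negbTE (level_sign_neq0 a)).
Qed.

(** In this region the levels of absolute value at most [N] see all the strata: the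
    other levels have a constant sign ([out_of_range]). *)
Definition bounded_by x := forall i, `|H i x| <= N%:R.

Lemma bounded_by_lo x i : bounded_by x -> (- N%:Z)%:~R <= H i x.
Proof. by move=> /(_ i); rewrite ler_norml => /andP[]; rewrite rmorphN. Qed.
Lemma bounded_by_hi x i : bounded_by x -> H i x <= (N%:Z)%:~R.
Proof. by move=> /(_ i); rewrite ler_norml => /andP[]. Qed.

Lemma level_value_onto (c : int) : - N%:Z <= c -> c <= N%:Z -> exists a, level_value a = c.
Proof.
move=> c1 c2; have lt : (absz (c + N%:Z)%R < (N + N).+1)%N by lia.
by exists (Ordinal lt); rewrite /level_value /=; lia.
Qed.

Lemma face_of_bounded_by x y : bounded_by x -> face_of y x -> bounded_by y.
Proof.
move=> bx yx i; rewrite ler_norml; apply/andP; split.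
  by have := face_of_ge yx (bounded_by_lo i bx); rewrite rmorphN.
exact: face_of_le yx (bounded_by_hi i bx).
Qed.

Lemma out_of_range x y i (c : int) : bounded_by x -> bounded_by y -> ~ (- N%:Z <= c <= N%:Z) ->
  sg3 (H i y - c%:~R) = sg3 (H i x - c%:~R).
Proof.
move=> bx byy hc; have := bounded_by_lo i bx; have := bounded_by_hi i bx.
have := bounded_by_lo i byy; have := bounded_by_hi i byy.
have [cN|cN] := ltP c (- N%:Z).
  have : c%:~R < (- N%:Z)%:~R :> R by rewrite ltr_int.
  move=> *; apply: (@etrans _ _ (Some true)); [|apply: esym]; apply/sg3_pos; lra.
have : (N%:Z)%:~R < c%:~R :> R by rewrite ltr_int; lia.
move=> *; apply: (@etrans _ _ (Some false)); [|apply: esym]; apply/sg3_neg; lra.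
Qed.

Lemma face_hatP x y : bounded_by x -> bounded_by y -> face (cell (hat y)) (cell (hat x)) <-> face_of y x.
Proof.
move=> bx byy; split.
  move=> /faceP f i c; have [/andP[c1 c2]|hc] := boolP (- N%:Z <= c <= N%:Z); last first.
    by right; apply: out_of_range => //; apply/negP.
  have [a <-] := level_value_onto c1 c2.
  have := f (Some (i, a)); rewrite !cell_in ?inE// !ev_Some_hat.
  by case=> [/level_sign_sg3N|/level_sign_sg3]; [left|right].
move=> h; apply/faceP => -[[i a]|]; rewrite !cell_in ?inE//.
  by rewrite !ev_Some_hat; case: (h i (level_value a)) => [/level_sign_sg3N|/level_sign_sg3 ->]; [left|right].
by right; rewrite !ev_None_hat.
Qed.

Lemma same_stratum_face_of x y : ss x y -> face_of x y.
Proof. by move/same_stratum_sg3 => h i c; right. Qed.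

Lemma same_bounded_by x y : ss x y -> bounded_by x -> bounded_by y.
Proof. by move=> /same_stratum_sym/same_stratum_face_of h bx; exact: face_of_bounded_by h. Qed.

Lemma cell_eq_bounded_by x y : bounded_by x -> cell (hat x) = cell (hat y) -> bounded_by y.
Proof.
move=> bx e i.
have E a : sg3 (H i x - (level_value a)%:~R) = sg3 (H i y - (level_value a)%:~R).
  have := congr1 (fun s : sgnv level => s (Some (i, a))) e.
  by rewrite !cell_in ?inE// !ev_Some_hat => /level_sign_sg3.
rewrite ler_norml; apply/andP; split.
  have [|a ea] := @level_value_onto (- N%:Z) (lexx _); first by lia.
  have := E a; rewrite ea rmorphN leNgt => e1; apply/negP => lt.
  have := bounded_by_lo i bx; rewrite leNgt => /negP; apply.
  have : sg3 (H i y - - (N%:Z)%:~R) = Some false by apply/sg3_neg; rewrite subr_lt0.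
  by rewrite -e1 => /sg3_neg; rewrite subr_lt0 rmorphN.
have [|a ea] := @level_value_onto (N%:Z) _ (lexx _); first by lia.
have := E a; rewrite ea leNgt => e1; apply/negP => lt.
have := bounded_by_hi i bx; rewrite leNgt => /negP; apply.
have : sg3 (H i y - (N%:Z)%:~R) = Some true by apply/sg3_pos; rewrite subr_gt0.
by rewrite -e1 => /sg3_pos; rewrite subr_gt0.
Qed.

Lemma hat_cellP x y : bounded_by x -> (cell (hat x) = cell (hat y) <-> ss x y).
Proof.
move=> bx; split=> [e|e].
  have byy := cell_eq_bounded_by bx e.
  apply/same_stratum_sg3 => i c.
  have [/andP[c1 c2]|hc] := boolP (- N%:Z <= c <= N%:Z); last first.
    by apply: out_of_range => //; apply/negP.
  have [a <-] := level_value_onto c1 c2.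
  have := congr1 (fun s : sgnv level => s (Some (i, a))) e.
  by rewrite !cell_in ?inE// !ev_Some_hat => /level_sign_sg3.
apply/eq_cellP => -[[i a]|] _; last by rewrite !ev_None_hat.
by rewrite !ev_Some_hat; apply/level_sign_sg3; move/same_stratum_sg3: e.
Qed.

(** The linear parts of the forms define the direction of a stratum in the original
    space, that is, the part of height 0 of the direction of its cone ([dirLP]). *)
Definition dirL s : 'M[R]_k := Arrangement.dir (fun j => dsubmx (level_form j)) [set: level]%SET s.

Lemma dirLP s v : (v <= dirL s)%MS = (emb v <= dir s)%MS.
Proof.
have E j : Arrangement.ev (fun j => dsubmx (level_form j)) j v = ev j (emb v).
  by rewrite /Arrangement.ev /emb -{2}(vsubmxK (level_form j)) mul_row_col mul0mx add0r.
apply/dirP/dirP => h j jT sj; [rewrite -E|rewrite E]; exact: h.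
Qed.

Lemma dirL_emb m (b : 'M[R]_(m, k)) s : (b <= dirL s)%MS = (emb b <= dir s)%MS.
Proof.
have re j : row j (emb b) = emb (row j b).
  by rewrite !rowE emb_mul.
apply/row_subP/row_subP => h j; have := h j; rewrite ?re ?dirLP//.
Qed.

(** The cone over a stratum has one dimension more than the stratum: its direction is
    spanned by a point and the directions of the stratum. *)
Lemma hat_frame x m (b : 'M[R]_(m, k)) :
  row_free b -> (b :=: dirL (cell (hat x)))%MS ->
  row_free (col_mx (hat x) (emb b)) /\
  (col_mx (hat x) (emb b) :=: dir (cell (hat x)))%MS.
Proof.
move=> bf bL; split; first by rewrite row_free_col ?row_free_emb// hat_notin_emb.
apply/eqmxP/andP; split.
  by rewrite col_mx_sub cell_dir -dirL_emb bL submx_refl.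
apply/row_subP => j; set z := row j _.
have zd : (z <= dir (cell (hat x)))%MS by exact: row_sub.
pose t := lsubmx z 0 0.
have zE : z = t *: hat x + emb (rsubmx z - t *: x).
  have hx : hat x = hat 0 + emb x by rewrite /hat /emb add_row_mx addr0 add0r.
  have eB : emb (rsubmx z - t *: x) = emb (rsubmx z) - t *: emb x.
    by rewrite /emb scale_row_mx scaler0 opp_row_mx add_row_mx subr0.
  rewrite [LHS]W_split -/t hx eB scalerDr addrA.
  by rewrite [_ + _ + emb (rsubmx z)]addrAC addrK.
have : (emb (rsubmx z - t *: x) <= dir (cell (hat x)))%MS.
  rewrite (_ : emb _ = z - t *: hat x); last by apply/eqP; rewrite eq_sym subr_eq addrC; apply/eqP.
  by rewrite addmx_sub// eqmx_opp scalemx_sub// cell_dir.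
rewrite -dirLP -bL => /submxP[c ce].
apply/submxP; exists (row_mx t%:M c); rewrite mul_row_col mul_scalar_mx -emb_mul -ce.
exact: zE.
Qed.

Lemma dim_hat x : dim (cell (hat x)) = (\rank (dirL (cell (hat x)))).+1.
Proof.
have [/eqP f e] := hat_frame (row_base_free _) (eq_row_base (dirL (cell (hat x)))).
by rewrite /Arrangement.dim -e f.
Qed.

Lemma stratum_of_move x v : bounded_by x -> (v <= dirL (cell (hat x)))%MS ->
  exists2 e : R, 0 < e & ss x (x + e *: v).
Proof.
move=> bx; rewrite dirLP => /dirP vd.
have [e e0 he] := small_move level_form (hat x) (emb v).
have hE : hat x + e *: emb v = hat (x + e *: v).
  by rewrite /hat /emb scale_row_mx scaler0 add_row_mx addr0.
exists e => //; apply/hat_cellP => //; rewrite -hE; apply/eq_cellP => j jT.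
have [xj|xj] := eqVneq (Arrangement.ev level_form j (hat x)) 0; last by rewrite he.
by rewrite evD evZ vd// ?mulr0 ?addr0// cell_in//; apply/sg3_None.
Qed.

Lemma direction_basisP x m (b : 'M[R]_(m, k)) : bounded_by x ->
  direction_basis b (stratum_of x) <-> row_free b /\ (b :=: dirL (cell (hat x)))%MS.
Proof.
move=> bx.
have key (U : 'M[R]_k) : (dirL (cell (hat x)) <= U)%MS <->
    (forall y z, stratum_of x y -> stratum_of x z -> (z - y <= U)%MS).
  split=> [h y z xy xz|h].
    apply: submx_trans _ h; rewrite dirLP -hatB.
    have H0 z' : stratum_of x z' -> (hat z' <= dir (cell (hat x)))%MS.
      by move=> /(proj2 (hat_cellP _ bx)) ->; exact: cell_dir.
    by rewrite addmx_sub ?eqmx_opp ?H0.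
  apply/row_subP => j; have [e e0 xe] := stratum_of_move bx (row_sub j (dirL (cell (hat x)))).
  have := h x _ (same_stratum_refl psi x) xe; rewrite addrAC subrr add0r eqmx_scale// gt_eqF//.
split=> [[bf h]|[bf h]]; split=> //.
  apply/eqmxP/andP; split; first by apply/h/key.
  rewrite -(genmxE b) ; apply/key/h; by rewrite genmxE.
by move=> U; rewrite h; exact: key.
Qed.

Lemma strata_upP x m : bounded_by x -> (strata_up psi m (stratum_of x) <-> dim (cell (hat x)) = m.+1).
Proof.
move=> bx; split.
  move=> [_ [b /(direction_basisP _ bx)[/eqP bf bL]]].
  by rewrite dim_hat -bL bf.
rewrite dim_hat => -[e]; split; first by exists x.
exists (castmx (e, erefl) (row_base (dirL (cell (hat x))))).
apply/direction_basisP => //; case: _ / e => /=; rewrite castmx_id.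
by split; [exact: row_base_free|exact: eq_row_base].
Qed.

(** Weak inequalities pass to the closure. Conversely, the half-open segment from a
    point of the stratum of [x] to a point of a face lies in the stratum of [x]. *)
Lemma closure_boundedP x y : bounded_by x -> bounded_by y -> (stratum_of y `<=` closure (stratum_of x)) <-> face_of y x.
Proof.
move=> bx byy; split=> [h i c|h z yz].
  have : closure (stratum_of x) y by apply: h; exact: same_stratum_refl.
  have cont : continuous (fun z : V => H i z - c%:~R).
    move=> z; have := @continuous_eval_psi R n k psi i z.
    by move/cvgB; apply; exact: cvg_cst.
  case E: (sg3 (H i x - c%:~R)) => [[]|].
  - move=> cl; have : closure [set z : V | 0 <= H i z - c%:~R] y.
      apply: closure_subset cl => z /same_stratum_sg3/(_ i c); rewrite E => /esym/sg3_pos.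
      exact: ltW.
    rewrite -(closure_id _).1 /=; last first.
      by apply: (@closed_comp _ _ (fun z : V => H i z - c%:~R) [set r | 0 <= r]);
        [move=> *; exact: cont|exact: closed_ge].
    by rewrite le_eqVlt => /predU1P[<-|/sg3_pos]; [left; apply/sg3_None|right].
  - move=> cl; have : closure [set z : V | H i z - c%:~R <= 0] y.
      apply: closure_subset cl => z /same_stratum_sg3/(_ i c); rewrite E => /esym/sg3_neg.
      exact: ltW.
    rewrite -(closure_id _).1 /=; last first.
      by apply: (@closed_comp _ _ (fun z : V => H i z - c%:~R) [set r | r <= 0]);
        [move=> *; exact: cont|exact: closed_le].
    by rewrite le_eqVlt => /predU1P[->|/sg3_neg]; [left; apply/sg3_None|right].
  - move=> cl; have : closure [set z : V | H i z - c%:~R = 0] y.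
      apply: closure_subset cl => z /same_stratum_sg3/(_ i c); rewrite E => /esym/sg3_None.
      by [].
    rewrite -(closure_id _).1 /=; last first.
      by apply: (@closed_comp _ _ (fun z : V => H i z - c%:~R) [set r | r = 0]);
        [move=> *; exact: cont|exact: closed_eq].
    by move/sg3_None; left.
have bz : bounded_by z by exact: same_bounded_by yz byy.
have zx : face (cell (hat z)) (cell (hat x)).
  have <- : cell (hat y) = cell (hat z) by apply/hat_cellP.
  exact/face_hatP.
have inx (e : R) : 0 < e -> e < 1 -> stratum_of x (z + e *: (x - z)).
  move=> e0 e1; apply/hat_cellP => //.
  have a0 : 0 < 1 - e by rewrite subr_gt0.
  have -> : hat (z + e *: (x - z)) = (1 - e) *: (hat z + (e / (1 - e)) *: hat x).
    apply/rowP => j; rewrite !mxE; case: splitP => l _; rewrite !mxE; field; rewrite gt_eqF//.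
  rewrite -(face_move zx (e := e / (1 - e))); last by rewrite divr_gt0.
  by apply/eq_cellP => j _; rewrite evZ sg3Z.
have cont : (fun e : R => z + e *: (x - z)) @ (0 : R) --> z.
  suff : (fun e : R => z + e *: (x - z)) @ (0 : R) --> z + 0 *: (x - z).
    by rewrite scale0r addr0.
  by apply: cvgD; [exact: cvg_cst|apply: cvgZr_tmp; exact: cvg_id].
move=> U /cont /= [e /= e0 he].
pose e' : R := Num.min (e / 2) (1 / 2).
have e'0 : 0 < e' by rewrite lt_min !divr_gt0.
exists (z + e' *: (x - z)); split.
  by apply: inx => //; rewrite gt_min; apply/orP; right; lra.
apply: he; rewrite /= sub0r normrN gtr0_norm//.
by rewrite gt_min; apply/orP; left; lra.
Qed.

End Homogenize.

(** * Comparison of orientations *)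

Section Signs.
Variables (R : realType) (n k : nat) (psi : 'M[int]_(n, k)).
Variables (o : forall m, strata R psi m -> 'M[R]_(m, k) -> int).
Hypothesis oP : is_orientation o.
Local Notation V := 'rV[R]_k.
Implicit Types (x y z v : V) (w : 'rV[int]_k) (i : 'I_n).
Local Notation H i x := (eval_psi psi i x).
Local Notation hs := (map_mx intr).
Local Notation ss := (same_stratum psi).
Local Notation stratum_of := (stratum_of psi).
Local Notation torus_stratum := (torus_stratum psi).
Local Notation face_of := (face_of psi).
Local Notation bounded_by := (bounded_by psi).
Local Notation level := (level n).
Local Notation cell N := (Arrangement.cell (@level_form R n k psi N) [set: level N]%SET).
Local Notation dim N := (Arrangement.dim (@level_form R n k psi N) [set: level N]%SET).
Local Notation inc N := (Arrangement.inc (@level_form R n k psi N) [set: level N]%SET).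

Lemma bounded_by_ex x : exists N, bounded_by N x.
Proof.
exists (\max_i absz (Num.floor `|H i x| + 1)%R)%N => i.
have h : (absz (Num.floor `|H i x| + 1)%R <= \max_i absz (Num.floor `|H i x| + 1)%R)%N.
  by apply: (@leq_bigmax _ (fun i => absz (Num.floor `|H i x| + 1)%R)).
apply: (@le_trans _ _ (absz (Num.floor `|H i x| + 1)%R)%:R); last by rewrite ler_nat.
rewrite natr_absz [X in X%:~R]ger0_norm; last by rewrite addr_ge0 ?floor_ge0.
by apply: ltW; have /andP[] := floor_itv `|H i x|.
Qed.

Lemma bounded_by_mono N N' x : (N <= N')%N -> bounded_by N x -> bounded_by N' x.
Proof. by move=> le h i; apply: le_trans (h i) _; rewrite ler_nat. Qed.

Lemma direction_basisT m (b : 'M[R]_(m, k)) x w :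
  direction_basis b (stratum_of (x + hs w)) <-> direction_basis b (stratum_of x).
Proof.
have key a w' : direction_basis b (stratum_of a) -> direction_basis b (stratum_of (a + hs w')).
  move=> [bf h]; split=> // U; rewrite h; split=> h' y z ay az.
    have -> : z - y = (z - hs w') - (y - hs w') by rewrite opprB addrA subrK.
    by apply: h'; apply/(same_stratumT _ _ _ w'); rewrite subrK.
  have -> : z - y = (z + hs w') - (y + hs w') by rewrite opprD addrACA subrr addr0.
  by apply: h'; apply/same_stratumT.
split; last exact: key.
by move/(key _ (- w)); rewrite map_mxN addrK.
Qed.

Lemma direction_basis_ori m (sig : strata R psi m) x b :
  val sig = torus_stratum x -> direction_basis b (stratum_of x) ->
  (o sig b = 1 \/ o sig b = -1) /\
  forall P : 'M[R]_m, P \in unitmx -> o sig (P *m b) = sgz (\det P) * o sig b.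
Proof.
move=> sx bb; have up : strata_up psi m (stratum_of x) by split; [exists x|exists b].
by apply: (oP up (esym sx)).
Qed.

Lemma o_sqr m (sig : strata R psi m) x b :
  val sig = torus_stratum x -> direction_basis b (stratum_of x) -> o sig b * o sig b = 1.
Proof. by move=> sx /(direction_basis_ori sx)[[->|->] _]. Qed.

Lemma sgz_sqr (d : R) : d != 0 -> sgz d * sgz d = 1.
Proof. by rewrite -expr2; case: sgzP. Qed.

(** The given orientation [o] of the strata and the canonical orientation of the cones
    over them differ by this sign. It is the factor by which a cell must be rescaled for
    the boundary of the strata to become that of the arrangement
    ([boundary_sgn_inc]). *)
Definition eps m (sig : strata R psi m) x : int :=
  let b := xget 0 [set b : 'M[R]_(m, k) | direction_basis b (stratum_of x)] in
  o sig b * ori (col_mx (hat x) (emb b)).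

(** Two points of a stratum differ by a vector of its direction, which does not affect
    the orientation of the cone. *)
Lemma epsE m (sig : strata R psi m) x x' b :
  val sig = torus_stratum x -> ss x x' -> direction_basis b (stratum_of x) ->
  eps sig x = o sig b * ori (col_mx (hat x') (emb b)).
Proof.
move=> sx xx' bb; rewrite /eps; set b0 := xget _ _.
have bb0 : direction_basis b0 (stratum_of x) by
    apply: (@xgetPex _ 0 [set b : 'M[R]_(m, k) | direction_basis b (stratum_of x)]); exists b.
have [N bx] := bounded_by_ex x.
have [bf bL] := (direction_basisP b bx).1 bb.
have [b0f b0L] := (direction_basisP b0 bx).1 bb0.
have [||P Pu Pe] := @basis_change _ _ _ b b0; rewrite ?b0L ?bL//.
have /submxP[c ce] : (x - x' <= b)%MS.
  have [_ h] := bb; have := (h <<b>>%MS).1; rewrite !genmxE submx_refl.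
  by move=> /(_ isT x' x xx' (same_stratum_refl psi x)); rewrite genmxE.
have -> : o sig b0 = sgz (\det P) * o sig b.
  by rewrite Pe; apply: (proj2 (direction_basis_ori sx bb)).
have -> : hat x = 1 *: hat x' + c *m emb b.
  by rewrite scale1r -emb_mul -ce -hatB addrC subrK.
rewrite Pe emb_mul ori_frame mul1r mulrACA sgz_sqr ?mul1r//.
by move: Pu; rewrite unitmxE unitfE.
Qed.

Lemma eps_same m (sig : strata R psi m) x x' (b : 'M[R]_(m, k)) :
  val sig = torus_stratum x -> ss x x' -> direction_basis b (stratum_of x) -> eps sig x = eps sig x'.
Proof.
move=> sx xx' bb; have e := proj2 (stratum_ofP psi x x') xx'.
rewrite (epsE sx xx' bb) (@epsE _ sig x' x' b) -?e ?same_stratum_refl//; last exact: same_stratum_refl.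
by rewrite sx /torus_stratum e.
Qed.

Lemma eps_sqr m (sig : strata R psi m) x (b : 'M[R]_(m, k)) :
  val sig = torus_stratum x -> direction_basis b (stratum_of x) -> eps sig x * eps sig x = 1.
Proof.
move=> sx bb; rewrite (epsE sx (same_stratum_refl psi x) bb) mulrACA (o_sqr sx bb) mul1r ori_sqr//.
have [N bx] := bounded_by_ex x.
have [bf bL] := (direction_basisP b bx).1 bb.
by have [] := hat_frame bf bL.
Qed.

Section Facet.
Variables (N m : nat) (x y : V) (sig : strata R psi m.+1) (tau : strata R psi m).
Variable b : 'M[R]_(m, k).
Hypotheses (bx : bounded_by N x) (byy : bounded_by N y).
Hypotheses (sx : val sig = torus_stratum x) (ty : val tau = torus_stratum y).
Hypotheses (dx : dim N (cell N (hat x)) = m.+2) (yx : face_of y x).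
Hypothesis bb : direction_basis b (stratum_of y).

(** Both incidence numbers are read on unimodularly equivalent bases of the direction of
    the cone over the stratum of [x]: the point [x] followed by [y - x] and [b] for the
    stratum, the points [x] and [y] followed by [b] for the cone. *)
Lemma facet_basis : direction_basis (col_mx (y - x) b : 'M[R]_(1 + m, k)) (stratum_of x) /\
  o sig (col_mx (y - x) b) * o tau b =
    eps sig x * eps tau y * inc N (cell N (hat x)) (cell N (hat y)).
Proof.
have f : face (cell N (hat y)) (cell N (hat x)) by exact/face_hatP.
have [bf bL] := (direction_basisP b byy).1 bb.
have [Bf BL] := hat_frame bf bL.
have dy : dim N (cell N (hat y)) = m.+1 by rewrite dim_hat -bL (eqP bf).
have e : dim N (cell N (hat x)) = (dim N (cell N (hat y))).+1 by rewrite dx dy.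
have [Cf CL] := facet_frame f e Bf BL.
have unip : emb (col_mx (y - x) b) =
    col_mx (-1)%:M 0 *m hat x + 1%:M *m col_mx (hat y) (emb b).
  rewrite mul1mx mul_col_mx mul_scalar_mx mul0mx add_col_mx add0r scaleN1r [- hat x + _]addrC hatB.
  by rewrite /emb -block_mxEv block_mxEh col_mx0.
have cf : row_free (col_mx (hat x) (emb (col_mx (y - x) b))).
  rewrite unip.
  have -> : col_mx (hat x) (col_mx (-1)%:M 0 *m hat x + 1%:M *m col_mx (hat y) (emb b)) =
     block_mx 1%:M 0 (col_mx (-1)%:M 0) 1%:M *m col_mx (hat x) (col_mx (hat y) (emb b)).
    by rewrite mul_block_col !mul1mx mul0mx addr0.
  rewrite /row_free mxrankMfree// -/(row_free _) row_free_unit unitmxE det_lblock !det1 mul1r.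
  exact: unitr1.
have bbx : direction_basis (col_mx (y - x) b : 'M[R]_(1 + m, k)) (stratum_of x).
  apply/(direction_basisP _ bx).
  have cbf : row_free (col_mx (y - x) b : 'M[R]_(1 + m, k)).
    rewrite -row_free_emb; move: cf; rewrite /row_free -addsmxE => /eqP E.
    rewrite eqn_leq rank_leq_row /=.
    have := mxrank_adds_leqif (hat x) (emb (col_mx (y - x) b)) => -[+ _].
    rewrite E => h; have := leq_trans h (leq_add (rank_leq_row (hat x)) (leqnn _)).
    by rewrite leq_add2l.
  split=> //.
  have sub : (col_mx (y - x) b <= dirL R psi (cell N (hat x)))%MS.
    rewrite col_mx_sub; apply/andP; split.
      rewrite dirLP -hatB addmx_sub ?eqmx_opp ?cell_dir//.
      by apply: submx_trans (face_dir _ _ f); exact: cell_dir.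
    rewrite dirL_emb; apply: submx_trans (face_dir _ _ f).
    by rewrite -dirL_emb bL submx_refl.
  apply/eqmxP; rewrite sub /=.
  have [_ <-] := mxrank_leqif_sup sub.
  by move: dx; rewrite dim_hat => -[->]; rewrite (eqP cbf) add1n.
split=> //.
rewrite (epsE sx (same_stratum_refl psi x) bbx) (epsE ty (same_stratum_refl psi y) bb).
have iE := incE (real_cell _ _ _) f e Bf BL.
rewrite iE unip ori_frame2 det1 sgz1 mul1r.
set p := ori (col_mx (hat x) _); set q := ori (col_mx (hat y) _).
have pp : p * p = 1 by exact: ori_sqr.
have qq : q * q = 1 by exact: ori_sqr.
by rewrite [RHS](_ : _ = o sig (col_mx (y - x) b) * o tau b * (p * p) * (q * q));
  [rewrite pp qq !mulr1|ring].
Qed.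

End Facet.

Lemma boundary_sgn_inc N m x y (sig : strata R psi m.+1) (tau : strata R psi m) :
  bounded_by N x -> bounded_by N y -> val sig = torus_stratum x -> val tau = torus_stratum y ->
  dim N (cell N (hat x)) = m.+2 -> dim N (cell N (hat y)) = m.+1 -> face_of y x ->
  boundary_sgn (o sig) (o tau) (stratum_of x) (stratum_of y) =
    eps sig x * eps tau y * inc N (cell N (hat x)) (cell N (hat y)).
Proof.
move=> bx byy sx ty dx dy yx; rewrite /boundary_sgn.
have xs : ss x (xget 0 (stratum_of x)) by apply: (@xgetPex _ 0 (stratum_of x)); exists x; exact: same_stratum_refl.
have ys : ss y (xget 0 (stratum_of y)) by apply: (@xgetPex _ 0 (stratum_of y)); exists y; exact: same_stratum_refl.
have [_ [b0 bb0]] := (strata_upP m byy).2 dy.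
set b := xget 0 [set b : 'M[R]_(m, k) | direction_basis b (stratum_of y)].
have bb : direction_basis b (stratum_of y) by
    apply: (@xgetPex _ 0 [set b : 'M[R]_(m, k) | direction_basis b (stratum_of y)]); exists b0.
move: xs ys; set x' := xget 0 (stratum_of x); set y' := xget 0 (stratum_of y) => xs ys.
have ex := (hat_cellP x' bx).2 xs; have ey := (hat_cellP y' byy).2 ys.
have [] := @facet_basis N m x' y' sig tau b.
- exact: same_bounded_by xs bx.
- exact: same_bounded_by ys byy.
- by rewrite sx /torus_stratum (proj2 (stratum_ofP _ _ _) xs).
- by rewrite ty /torus_stratum (proj2 (stratum_ofP _ _ _) ys).
- by rewrite -ex.
- apply/(@face_hatP _ _ _ _ N); [exact: same_bounded_by xs bx|exact: same_bounded_by ys byy|].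
  by rewrite -ex -ey; apply/face_hatP.
- by rewrite -(proj2 (stratum_ofP _ _ _) ys).
move=> _ ->; rewrite -ex -ey.
rewrite (eps_same ty ys bb).
have [_ [b1 bb1]] := (strata_upP m.+1 bx).2 dx.
by rewrite (eps_same sx xs bb1).
Qed.

(** Orientations are attached to directions, which translations preserve. This lets the
    sum over the facets of the chosen lift be moved to any other lift. *)
Lemma boundary_sgnT N m x y w (sig : strata R psi m.+1) (tau : strata R psi m) :
  bounded_by N x -> bounded_by N y -> val sig = torus_stratum x -> val tau = torus_stratum y ->
  dim N (cell N (hat x)) = m.+2 -> dim N (cell N (hat y)) = m.+1 -> face_of y x ->
  boundary_sgn (o sig) (o tau) (stratum_of (x + hs w)) (stratum_of (y + hs w)) =
  boundary_sgn (o sig) (o tau) (stratum_of x) (stratum_of y).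
Proof.
move=> bx byy sx ty dx dy yx.
have [N1 b1] := bounded_by_ex (x + hs w); have [N2 b2] := bounded_by_ex (y + hs w).
pose N' := maxn N1 N2.
have bx' : bounded_by N' (x + hs w) by apply: bounded_by_mono b1; exact: leq_maxl.
have by' : bounded_by N' (y + hs w) by apply: bounded_by_mono b2; exact: leq_maxr.
have dirT m' N0 N0' z : bounded_by N0 z -> bounded_by N0' (z + hs w) ->
    dim N0 (cell N0 (hat z)) = m'.+1 -> dim N0' (cell N0' (hat (z + hs w))) = m'.+1.
  move=> bz bz' /(strata_upP _ bz)[_ [b bb]]; apply/(strata_upP _ bz').
  by split; [exists (z + hs w)|exists b; apply/direction_basisT].
have sx' : val sig = torus_stratum (x + hs w) by rewrite torus_stratumT.
have ty' : val tau = torus_stratum (y + hs w) by rewrite torus_stratumT.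
have dx' := dirT _ _ _ _ bx bx' dx; have dy' := dirT _ _ _ _ byy by' dy.
have yx' : face_of (y + hs w) (x + hs w) by apply/face_ofT.
rewrite (boundary_sgn_inc bx' by' sx' ty' dx' dy' yx').
rewrite (boundary_sgn_inc bx byy sx ty dx dy yx).
have [_ [b bb]] := (strata_upP m byy).2 dy.
have bb' : direction_basis b (stratum_of (y + hs w)) by apply/direction_basisT.
have [_ <-] := facet_basis bx byy sx ty dx yx bb.
have [_ <-] := facet_basis bx' by' sx' ty' dx' yx' bb'.
by rewrite opprD addrACA subrr addr0.
Qed.

End Signs.

(** * The multigraded pieces as cellular chains *)

Lemma fsbig_fin (V : nmodType) (T : finType) (P : pred T) (E : T -> V) :
  \sum_(t \in [set t | P t]) E t = \sum_(t | P t) E t.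
Proof.
have -> : [set t | P t] = [set` enum P].
  by apply/seteqP; split=> t /=; rewrite mem_enum.
by rewrite -fsbig_seq ?enum_uniq// big_enum.
Qed.

Section Push.
Variables (R : realType) (n k : nat) (psi : 'M[int]_(n, k)).
Hypothesis finC : finite_set [set: coker psi].
Variables (o : forall m, strata R psi m -> 'M[R]_(m, k) -> int).
Variables (lift : forall m, strata R psi m -> set 'rV[R]_k).
Hypotheses (oP : is_orientation o) (liftP : is_lift lift).
Local Notation F := (complex R).
Local Notation A := {mpoly F[n]}.
Local Notation V := 'rV[R]_k.
Implicit Types (x y z : V) (w : 'rV[int]_k) (i : 'I_n) (u : 'rV[int]_n).
Local Notation H i x := (eval_psi psi i x).
Local Notation hs := (map_mx intr).
Local Notation ss := (same_stratum psi).
Local Notation stratum_of := (stratum_of psi).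
Local Notation torus_stratum := (torus_stratum psi).
Local Notation face_of := (face_of psi).
Local Notation bounded_by := (bounded_by psi).
Local Notation ceil_vec := (ceil_vec psi).
Local Notation eps := (eps o).
Local Notation level := (level n).
Local Notation level_form N := (@level_form R n k psi N).
Local Notation cell N := (Arrangement.cell (level_form N) [set: level N]%SET).
Local Notation dim N := (Arrangement.dim (level_form N) [set: level N]%SET).
Local Notation inc N := (Arrangement.inc (level_form N) [set: level N]%SET).
Local Notation bd N := (Arrangement.bd (level_form N) [set: level N]%SET).
Local Notation real N := (Arrangement.real (level_form N) [set: level N]%SET).

Lemma strata_upT m z w : strata_up psi m (stratum_of (z + hs w)) <-> strata_up psi m (stratum_of z).
Proof.
split=> -[_ [b bb]]; split; try by [exists z|exists (z + hs w)].
  by exists b; move/direction_basisT: bb.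
by exists b; apply/direction_basisT.
Qed.

Lemma closureP x y : (stratum_of y `<=` closure (stratum_of x)) <-> face_of y x.
Proof.
have [N1 b1] := bounded_by_ex psi x; have [N2 b2] := bounded_by_ex psi y.
apply: (@closure_boundedP _ _ _ _ (maxn N1 N2)).
  by apply: bounded_by_mono b1; exact: leq_maxl.
by apply: bounded_by_mono b2; exact: leq_maxr.
Qed.

Lemma strata_up_point m (s : set V) : strata_up psi m s -> exists x, s = stratum_of x.
Proof. by move=> [[x ->] _]; exists x. Qed.

(** The multidegree [u] corresponds to the polyhedron [H <= u]; the lower bound makes it
    a polytope, with finitely many strata. *)
Definition in_polytope N u x := forall i, (- N%:Z)%:~R <= H i x /\ H i x <= (u 0 i)%:~R.
Definition degree_bounded N u := forall i, `|u 0 i| < N%:Z.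

Lemma in_polytope_bounded N u x : degree_bounded N u -> in_polytope N u x -> bounded_by N x.
Proof.
move=> ub xP i; have [] := xP i; rewrite rmorphN => lo hi; rewrite ler_norml lo /=.
by apply: le_trans hi _; rewrite -[N%:R]/(N%:Z%:~R) ler_int; have := ub i; lia.
Qed.

Lemma in_polytope_face_of N u x y : face_of y x -> in_polytope N u x -> in_polytope N u y.
Proof.
by move=> yx xP i; have [lo hi] := xP i; split; [exact: face_of_ge yx lo|exact: face_of_le yx hi].
Qed.

Definition cell_point N (s : sgnv (level N)) : V :=
  if pselect (exists x, s = cell N (hat x) /\ bounded_by N x) is left e then sval (cid e) else 0.

(** The cone over a stratum has one dimension more than the stratum, whence the
    shift. *)
Definition good N u m (s : sgnv (level N)) : bool :=
  `[< exists x, [/\ s = cell N (hat x), in_polytope N u x & dim N s = m.+1] >].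

Lemma good_cell N u m x : in_polytope N u x -> dim N (cell N (hat x)) = m.+1 ->
  good u m (cell N (hat x)).
Proof. by move=> xP dx; apply/asboolP; exists x. Qed.

Section FixedN.
Variables (N : nat) (u : 'rV[int]_n).
Hypothesis ub : degree_bounded N u.
Implicit Types (s t : sgnv (level N)).

Lemma cell_pointP x : bounded_by N x -> ss x (cell_point (cell N (hat x))) /\
  cell N (hat (cell_point (cell N (hat x)))) = cell N (hat x).
Proof.
move=> bx; rewrite /cell_point; case: pselect => [e|[]]; last by exists x.
case: cid => y /= [e' byy]; split=> //.
by apply/hat_cellP/esym.
Qed.

Lemma goodP m s : good u m s -> [/\ cell N (hat (cell_point s)) = s, bounded_by N (cell_point s),
  in_polytope N u (cell_point s) & dim N s = m.+1].
Proof.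
move=> /asboolP[x [sx xP ds]]; have bx := in_polytope_bounded ub xP.
have [xs e] := cell_pointP bx; rewrite -sx in xs e.
split=> //; first exact: same_bounded_by xs bx.
by apply: in_polytope_face_of xP; apply: same_stratum_face_of; exact: same_stratum_sym.
Qed.

Definition constraints : {set level N} := [set j : level N |
  if j is Some ia then (ia.2 == 0%N :> nat) || (level_value ia.2 == u 0 ia.1) else true]%SET.

Lemma constraints_hat x : bounded_by N x ->
  (forall j, j \in constraints -> Arrangement.ev (level_form N) j (hat x) <= 0) <-> in_polytope N u x.
Proof.
move=> bx; split=> [h i|xP [[i a]|]]; last 2 first.
- rewrite inE ev_Some_hat /level_sign /= => /orP[/eqP a0|/eqP la].
    rewrite a0 eqxx mulN1r oppr_le0 subr_ge0 /level_value a0 sub0r.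
    by have [] := xP i.
  case: ifP => [/eqP a0|_].
    rewrite mulN1r oppr_le0 subr_ge0 /level_value a0 sub0r; by have [] := xP i.
  by rewrite mul1r subr_le0 la; have [] := xP i.
- by rewrite ev_None_hat oppr_le0.
split; first exact: bounded_by_lo.
have [||a la] := @level_value_onto N (u 0 i); try by have := ub i; lia.
have := h (Some (i, a)); rewrite inE la eqxx orbT => /(_ isT).
rewrite ev_Some_hat /level_sign; case: ifP => [/eqP a0|_]; last by rewrite mul1r subr_le0 la.
by move: la; rewrite /level_value a0 => e; have := ub i; lia.
Qed.

Lemma dim_cell0 : dim N (cell N 0) = 0%N.
Proof.
rewrite /Arrangement.dim; apply/eqP; rewrite mxrank_eq0; apply/eqP/row_matrixP => j.
rewrite row0; set r := row j _.
have rd : (r <= Arrangement.dir (level_form N) [set: level N]%SET (cell N 0))%MS by exact: row_sub.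
have rj j' : Arrangement.ev (level_form N) j' r = 0.
  move/dirP: rd; apply; rewrite ?inE// cell_in ?inE// ev0; exact/sg3_None.
have := W_split r; set t' := lsubmx r 0 0; set y' := rsubmx r => rE.
have t'0 : t' = 0.
  have := rj None; rewrite rE evD evZ ev_None_hat ev_None_emb addr0 mulrN1.
  by move/eqP; rewrite oppr_eq0 => /eqP.
have y'0 : y' = 0.
  apply: (eval_psi_inj finC) => i; have := rj (Some (i, ord0)).
  rewrite rE t'0 scale0r add0r ev_Some_emb => /eqP.
  by rewrite mulf_eq0 (negbTE (level_sign_neq0 R _)) => /eqP.
by rewrite rE t'0 y'0 scale0r add0r /emb row_mx0.
Qed.

(** A cell of the closed cone that is not over a stratum would have height 0. But there
    the constraints read [0 <= H <= 0], which only the origin satisfies. *)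
Lemma good_closed_cone m s : real N s -> in_closed_cone finset.set0 constraints s -> dim N s = m.+1 -> good u m s.
Proof.
move=> /realP[z sz] sQ ds.
have zle j : j \in constraints -> Arrangement.ev (level_form N) j z <= 0.
  move: sQ; rewrite sz => /in_closed_cone_cell[]; rewrite ?finset.sub0set ?finset.subsetT//.
  by move=> _; apply.
pose t := lsubmx z 0 0; pose y := rsubmx z.
have zE : z = t *: hat 0 + emb y by exact: W_split.
have hN : Arrangement.ev (level_form N) None z = - t.
  by rewrite zE evD evZ ev_None_hat ev_None_emb addr0 mulrN1.
have hS i (a : 'I_(N + N).+1) : Arrangement.ev (level_form N) (Some (i, a)) z =
    level_sign R a * (H i y - (level_value a)%:~R * t).
  by rewrite zE evD evZ ev_Some_hat ev_Some_emb eval_psi0; ring.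
have t0 : 0 <= t.
  by have := zle None; rewrite inE => /(_ isT); rewrite hN oppr_le0.
have upper i : H i y <= (u 0 i)%:~R * t.
  have [||a la] := @level_value_onto N (u 0 i); try by have := ub i; lia.
  have := zle (Some (i, a)); rewrite inE la eqxx orbT => /(_ isT).
  rewrite hS /level_sign; case: ifP => [/eqP a0|_]; last by rewrite mul1r subr_le0 la.
  by move: la; rewrite /level_value a0 => e; have := ub i; lia.
have lower i : (- N%:Z)%:~R * t <= H i y.
  have := zle (Some (i, ord0)); rewrite inE eqxx => /(_ isT).
  by rewrite hS /level_sign eqxx mulN1r oppr_le0 subr_ge0 /level_value sub0r.
have tp : 0 < t.
  rewrite lt_neqAle t0 andbT; apply/negP => /eqP t00.
  have y0 : y = 0.
    apply: (eval_psi_inj finC) => i; apply/eqP; rewrite eq_le.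
    by have := upper i; have := lower i; rewrite -t00 !mulr0 => -> ->.
  have z0 : z = 0.
    by rewrite zE -t00 scale0r add0r y0 /emb row_mx0.
  by move: ds; rewrite sz z0 dim_cell0.
pose x := t^-1 *: y.
have hx : hat x = t^-1 *: z.
  have h0 : hat x = hat 0 + emb x by rewrite /hat /emb add_row_mx addr0 add0r.
  rewrite h0 zE scalerDr scalerA mulVf ?gt_eqF// scale1r.
  by rewrite /x /emb scale_row_mx scaler0.
have sx : s = cell N (hat x).
  by rewrite sz; apply/eq_cellP => j _; rewrite hx evZ sg3Z ?invr_gt0.
rewrite sx; apply: good_cell; last by rewrite -sx.
move=> i; rewrite /x eval_psiZ mulrC ler_pdivlMr// ler_pdivrMr//.
Qed.

Lemma good_in_closed_cone m s : good u m s -> in_closed_cone finset.set0 constraints s.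
Proof.
move=> /goodP[e bx xP _]; rewrite -e; apply/in_closed_cone_cell; rewrite ?finset.sub0set ?finset.subsetT//.
by split=> [j|]; [rewrite finset.inE|exact: (proj2 (constraints_hat bx) xP)].
Qed.

Lemma good_real m s : good u m s -> real N s.
Proof. by move=> /goodP[<- _ _ _]; exact: real_cell. Qed.

Lemma good_face m m' s t : good u m s -> real N t -> face t s -> dim N t = m'.+1 ->
  good u m' t.
Proof.
move=> gs rt f dt; apply: good_closed_cone => //; apply: in_closed_cone_face f _; exact: good_in_closed_cone gs.
Qed.

Lemma acyclic_polytope x : in_polytope N u x ->
  acyclic (level_form N) F [set: level N]%SET (in_closed_cone finset.set0 constraints).
Proof.
move=> xP; have bx := in_polytope_bounded ub xP.
apply: (@acyclic_cone _ _ _ _ _ _ _ _ (hat x) None); rewrite ?finset.sub0set ?finset.subsetT//.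
- by move=> j; rewrite finset.inE.
- exact: (proj2 (constraints_hat bx) xP).
- by rewrite finset.inE.
- by rewrite ev_None_hat oppr_lt0.
Qed.

Lemma good_strata m s : good u m s -> {sig : strata R psi m | val sig = torus_stratum (cell_point s)}.
Proof.
move=> gs; apply: cid; have [e bx _ ds] := goodP gs.
have up : strata_up psi m (stratum_of (cell_point s)) by apply/(strata_upP _ bx); rewrite e.
have H0 : strata R psi m (torus_stratum (cell_point s)) by exists (stratum_of (cell_point s)).
by exists (SigSub (mem_set H0)).
Qed.

End FixedN.

Definition monom_of u : 'X_{1..n} := [multinom absz (u 0%R i) | i < n].

Lemma monom_of_inj u u' : (forall i, 0 <= u 0 i) -> (forall i, 0 <= u' 0 i) ->
  monom_of u = monom_of u' -> u = u'.
Proof.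
move=> h h' /mnmP e; apply/rowP => i; have := e i; rewrite !mnmE.
by have := h i; have := h' i; lia.
Qed.

Lemma monom_ofD u u' : (forall i, 0 <= u 0 i) -> (forall i, 0 <= u' 0 i) ->
  monom_of (u + u') = (monom_of u + monom_of u')%MM.
Proof.
have e (a b : int) : 0 <= a -> 0 <= b -> absz (a + b) = (absz a + absz b)%N by lia.
by move=> h h'; apply/mnmP => i; rewrite mnmDE !mnmE mxE; apply: e.
Qed.

Lemma ceil_vec_le N u x i : in_polytope N u x -> 0 <= (u - ceil_vec x) 0 i.
Proof.
by move=> xP; rewrite !mxE subr_ge0 ceil_le_int; have [] := xP i.
Qed.

Definition lies_over N m (sig : strata R psi m) (s : sgnv (level N)) : bool :=
  `[< val sig = torus_stratum (cell_point s) >].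

(** The cell over the stratum of [x] is sent to the generator of the image in the torus,
    times the monomial that raises its degree [ceil (H x)] to [u]. *)
Definition push N u m (c : sgnv (level N) -> F) (sig : strata R psi m) : A :=
  \sum_(s | good u m s && lies_over sig s)
    (c s * (eps sig (cell_point s))%:~R) *: 'X_[monom_of (u - ceil_vec (cell_point s))].

Section FixedN2.
Variables (N : nat) (u : 'rV[int]_n).
Hypothesis ub : degree_bounded N u.
Implicit Types (s t : sgnv (level N)).

(** The differential of one generator, computed with the lift given by [s] in place of
    the chosen one: translating by [w] puts the facets of the two lifts in bijection and
    changes neither the signs nor the exponents. *)
Lemma hhl_coeff_cell m s (sig : strata R psi m.+1) (tau : strata R psi m) :
  good u m.+1 s -> val sig = torus_stratum (cell_point s) ->
  hhl_coeff F o lift m sig tau * ((eps sig (cell_point s))%:~R *: 'X_[monom_of (u - ceil_vec (cell_point s))]) =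
  \sum_(t | good u m t && lies_over tau t)
    ((inc N s t)%:~R * (eps tau (cell_point t))%:~R) *: 'X_[monom_of (u - ceil_vec (cell_point t))].
Proof.
move=> gs sx; have [es bx xP ds] := goodP ub gs; set x := cell_point s in es bx xP sx *.
have [lup lim] := liftP sig; have [x0 lx0] := strata_up_point lup.
have [w xw] : exists w, ss (x + hs w) x0.
  by apply/torus_stratumP; rewrite -sx -lim lx0.
have lx : lift sig = stratum_of (x + hs w) by rewrite lx0; apply/esym/stratum_ofP.
rewrite /hhl_coeff lx.
pose G := [set t | [&& good u m t, lies_over tau t & face t s]].
pose h t := stratum_of (cell_point t + hs w).
rewrite (@reindex_fsbig _ _ _ _ _ h G); last first.
  split.
  - move=> t /and3P[gt /asboolP tt f]; have [et byy yP dt] := goodP ub gt.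
    have yx : face_of (cell_point t) x by apply/(face_hatP bx byy); rewrite et es.
    split; last by rewrite -[LHS]/(torus_stratum (cell_point t + hs w)) torus_stratumT.
    split; first by apply/strata_upT/(strata_upP _ byy); rewrite et.
    by apply/closureP/face_ofT.
  - move=> t t'; rewrite !inE => /and3P[gt _ _] /and3P[gt' _ _] /stratum_ofP/same_stratumT tt'.
    have [et byy _ _] := goodP ub gt; have [et' _ _ _] := goodP ub gt'.
    by rewrite -et -et'; apply/(hat_cellP _ byy).
  - move=> t' [[/= tup tcl] tim]; have [y0 ty0] := strata_up_point tup.
    pose y := y0 - hs w.
    have y0E : y0 = y + hs w by rewrite subrK.
    have yx : face_of y x by rewrite -(face_ofT _ _ _ w) -y0E -closureP -ty0.
    have yP : in_polytope N u y by exact: in_polytope_face_of yx xP.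
    have byy : bounded_by N y by exact: in_polytope_bounded yP.
    have dy : dim N (cell N (hat y)) = m.+1.
      by apply/(strata_upP _ byy); rewrite -(strata_upT _ _ w) -y0E -ty0.
    have [yy' ey'] := cell_pointP byy.
    exists (cell N (hat y)).
      apply/and3P; split; first exact: good_cell.
        apply/asboolP; apply: etrans (esym tim) _; rewrite ty0 -[LHS]/(torus_stratum y0) y0E torus_stratumT.
        by rewrite /torus_stratum (proj2 (stratum_ofP _ _ _) yy').
      by rewrite -es; apply/face_hatP.
    by rewrite /h ty0 y0E; apply/stratum_ofP/same_stratumT/same_stratum_sym.
rewrite fsbig_fin mulr_suml [RHS](bigID (fun t => face t s)) /=.
rewrite [X in _ = _ + X]big1 ?addr0; last first.
  by move=> t /andP[_ f]; rewrite /Arrangement.inc (negbTE f) !andbF mul0r scale0r.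
apply: eq_big => [t|t /and3P[gt /asboolP tt f]]; first by rewrite andbA.
  have [et byy yP dt] := goodP ub gt; set y := cell_point t in et byy yP tt *.
  have yx : face_of y x by apply/(face_hatP bx byy); rewrite et es.
  have dx : dim N (cell N (hat x)) = m.+2 by rewrite es.
  have dy : dim N (cell N (hat y)) = m.+1 by rewrite et.
  rewrite (boundary_sgnT oP w bx byy sx tt dx dy yx).
  rewrite (boundary_sgn_inc oP bx byy sx tt dx dy yx) es et.
  have -> : [multinom absz (ceilH psi (stratum_of (x + hs w)) i - ceilH psi (stratum_of (y + hs w)) i) | i < n] =
      monom_of (ceil_vec x - ceil_vec y).
    apply/mnmP => i; rewrite !mnmE !ceilH_stratum_of !ceil_vecD !mxE; congr absz.
    by rewrite opprD addrACA subrr addr0.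
  have -> : monom_of (u - ceil_vec y) = (monom_of (ceil_vec x - ceil_vec y) + monom_of (u - ceil_vec x))%MM.
    rewrite -monom_ofD.
    - by congr monom_of; rewrite [RHS]addrC addrA subrK.
    - by move=> i; rewrite !mxE subr_ge0; have := face_of_ceil_vec i yx; rewrite !mxE.
    - by move=> i; exact: ceil_vec_le xP.
  have [_ [b bb]] := (strata_upP m.+1 bx).2 dx.
  have e2 := eps_sqr oP sx bb.
rewrite mpolyXD -scaler_int -scalerAl -scalerAr scalerA -!intrM.
congr (_%:~R *: _); rewrite [RHS](_ : _ = (eps sig x * eps sig x) * (inc N s t * eps tau y)).
  by ring.
by rewrite e2 mul1r.
Qed.

Lemma finite_strataT m : finite_set [set: strata R psi m].
Proof.
have -> : [set: strata R psi m] = val @^-1` strata R psi m.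
  by apply/seteqP; split=> s // _; exact: set_valP.
apply: finite_preimage; first by move=> ? ? _ _ /val_inj.
exact: finite_strata.
Qed.

Lemma push_diff m (c : sgnv (level N) -> F) (tau : strata R psi m) :
  (forall s, c s != 0 -> good u m.+1 s) ->
  mod_diff (hhl_coeff F o lift) (push u c (m := m.+1)) tau = push u (bd N c) tau.
Proof.
move=> cg; rewrite /mod_diff; have [r [ru rT] rE] := fsbig_seqT (@finite_strataT m.+1).
rewrite rE /push.
under eq_bigr do rewrite mulr_sumr big_mkcond /=.
rewrite exchange_big /=.
transitivity (\sum_s \sum_(t | good u m t && lies_over tau t)
    (c s * (inc N s t)%:~R * (eps tau (cell_point t))%:~R) *: 'X_[monom_of (u - ceil_vec (cell_point t))] : A).
  apply: eq_bigr => s _.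
  have [c0|c0] := eqVneq (c s) 0.
    rewrite !big1// => [t _|sig _]; first by rewrite c0 !mul0r scale0r.
    by rewrite c0 mul0r scale0r mulr0 if_same.
  have gs := cg s c0; have [sig sx] := good_strata ub gs.
  rewrite (bigD1_seq sig)//= big1 ?addr0 => [|sig' ss']; last first.
    rewrite gs /lies_over; case: asboolP => // sx'; move/eqP: ss'; case.
    by apply: val_inj; rewrite sx' -sx.
  have -> : lies_over sig s by apply/asboolP.
  rewrite gs /= -scalerA -scalerAr hhl_coeff_cell// scaler_sumr.
  by apply: eq_bigr => t _; rewrite scalerA mulrA.
rewrite exchange_big /=; apply: eq_bigr => t _.
by rewrite -scaler_suml -mulr_suml.
Qed.

End FixedN2.

(** A monomial times [e_sigma] determines the stratum up to translation and the degree
    modulo the lattice of translations. Fixing one representative of the degree leaves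
    no translation, by [row_psi_inj]. *)
Lemma push_coef N u u' m (c : sgnv (level N) -> F) t (sig : strata R psi m) :
  degree_bounded N u -> degree_bounded N u' ->
  ((exists w, u' - u = w *m psi^T) -> u' = u) ->
  good u m t -> val sig = torus_stratum (cell_point t) ->
  (push u' c sig)@_(monom_of (u - ceil_vec (cell_point t))) = if u' == u then c t * (eps sig (cell_point t))%:~R else 0.
Proof.
move=> ub ub' hu gt tx; have [et bx xP dt] := goodP ub gt.
have key s : good u' m s -> lies_over sig s ->
    monom_of (u' - ceil_vec (cell_point s)) = monom_of (u - ceil_vec (cell_point t)) -> u' = u /\ s = t.
  move=> gs /asboolP sx e; have [es byy yP ds] := goodP ub' gs.
  have e' : u' - ceil_vec (cell_point s) = u - ceil_vec (cell_point t).
    by apply: monom_of_inj e => i; [exact: ceil_vec_le yP|exact: ceil_vec_le xP].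
  have [w xw] : exists w, ss (cell_point t + hs w) (cell_point s) by apply/torus_stratumP; rewrite -sx -tx.
  have cs : ceil_vec (cell_point s) = ceil_vec (cell_point t) + w *m psi^T.
    by rewrite -ceil_vecD; apply/esym/ceil_vec_same.
  have uu : u' - u = w *m psi^T.
    have -> : u' = u - ceil_vec (cell_point t) + ceil_vec (cell_point s) by rewrite -e' subrK.
    by rewrite cs addrA subrK addrAC subrr add0r.
  have uE : u' = u by apply: hu; exists w.
  split=> //; move: uu; rewrite uE subrr => /esym/(row_psi_inj R finC) w0.
  move: xw; rewrite w0 map_mx0 addr0 => xw.
  by rewrite -es -et; apply/esym/(hat_cellP _ bx).
rewrite /push raddf_sum /=; have [uE|uE] := eqVneq u' u; last first.
  rewrite big1// => s /andP[gs sx]; rewrite mcoeffZ mcoeffX.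
  case: eqP => [/(key s gs sx)[e _]|_]; last by rewrite mulr0.
  by rewrite e eqxx in uE.
rewrite (bigD1 t) /=; last by rewrite uE gt; apply/asboolP.
rewrite big1 ?addr0 => [|s /andP[/andP[gs sx] st]].
  by rewrite mcoeffZ mcoeffX uE eqxx mulr1.
rewrite mcoeffZ mcoeffX; case: eqP => [/(key s gs sx)[_ e]|_]; last by rewrite mulr0.
by rewrite e eqxx in st.
Qed.

End Push.

(** * Exactness over the polynomial ring *)

Lemma seq_bound (T : eqType) (P : T -> nat -> Prop) (r : seq T) :
  (forall x N N', (N <= N')%N -> P x N -> P x N') -> (forall x, exists N, P x N) ->
  exists N, forall x, x \in r -> P x N.
Proof.
move=> mono ex; elim: r => [|y r [N IH]]; first by exists 0%N.
have [N' yN] := ex y; exists (maxn N N') => x; rewrite inE => /orP[/eqP->|xr].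
  by apply: mono yN; exact: leq_maxr.
by apply: mono (IH x xr); exact: leq_maxl.
Qed.

Section Exact.
Variables (R : realType) (n k : nat) (psi : 'M[int]_(n, k)).
Hypothesis finC : finite_set [set: coker psi].
Variables (o : forall m, strata R psi m -> 'M[R]_(m, k) -> int).
Variables (lift : forall m, strata R psi m -> set 'rV[R]_k).
Hypotheses (oP : is_orientation o) (liftP : is_lift lift).
Local Notation F := (complex R).
Local Notation A := {mpoly F[n]}.
Local Notation V := 'rV[R]_k.
Implicit Types (x y z : V) (w : 'rV[int]_k) (i : 'I_n) (u : 'rV[int]_n).
Local Notation H i x := (eval_psi psi i x).
Local Notation hs := (map_mx intr).
Local Notation stratum_of := (stratum_of psi).
Local Notation torus_stratum := (torus_stratum psi).
Local Notation bounded_by := (bounded_by psi).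
Local Notation ceil_vec := (ceil_vec psi).
Local Notation eps := (eps o).
Local Notation level := (level n).
Local Notation level_form N := (@level_form R n k psi N).
Local Notation cell N := (Arrangement.cell (level_form N) [set: level N]%SET).
Local Notation dim N := (Arrangement.dim (level_form N) [set: level N]%SET).
Local Notation inc N := (Arrangement.inc (level_form N) [set: level N]%SET).
Local Notation bd N := (Arrangement.bd (level_form N) [set: level N]%SET).
Local Notation good := (@good R n k psi _).
Local Notation cell_point N := (@cell_point R n k psi N).

Lemma degree_bounded_ex u : exists N, degree_bounded N u.
Proof.
exists (\max_i absz (u 0%R i)).+1 => i.
have := @leq_bigmax _ (fun i => absz (u 0 i)) i; rewrite /=; lia.
Qed.

Lemma bd_neq0 N (c : sgnv (level N) -> F) t : bd N c t != 0 ->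
  exists s, c s != 0 /\ inc N s t != 0.
Proof.
move=> b0; apply: contrapT => nx; move/negP: b0; apply; rewrite /Arrangement.bd big1// => s _.
have [->|c0] := eqVneq (c s) 0; first by rewrite mul0r.
have [->|i0] := eqVneq (inc N s t) 0; first by rewrite mulr0.
by case: nx; exists s.
Qed.

Lemma bd_good N u m (c : sgnv (level N) -> F) : degree_bounded N u ->
  (forall s, c s != 0 -> good u m.+1 s) -> forall t, bd N c t != 0 -> good u m t.
Proof.
move=> ub cg t /bd_neq0[s [/cg gs /inc_neq0[_ rt f e]]].
apply: (good_face finC ub gs rt f); have [_ _ _ ds] := goodP ub gs.
by apply/eqP; rewrite -eqSS -e ds.
Qed.

Lemma bd_dim N m (b : sgnv (level N) -> F) t : dim N t = m ->
  bd N (fun s => if dim N s == m.+1 then b s else 0) t = bd N b t.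
Proof.
move=> dt; apply: eq_bigr => s _; case: eqP => // ds; rewrite mul0r.
suff -> : inc N s t = 0 by rewrite mulr0.
by apply/eqP; apply: contraT => /inc_neq0[_ _ _ e]; rewrite e dt in ds.
Qed.

Lemma bd_dim0 N m (b : sgnv (level N) -> F) t : dim N t <> m ->
  bd N (fun s => if dim N s == m.+1 then b s else 0) t = 0.
Proof.
move=> dt; apply/eqP; apply: contraT => /bd_neq0[s [/=]].
case: (eqVneq (dim N s) m.+1) => [ds _|_]; last by rewrite eqxx.
by move=> /inc_neq0[_ _ _ e]; case: dt; apply/eqP; rewrite -eqSS -e ds.
Qed.

(** When the chain is nonzero, the polytope is nonempty and the closed cone over it is
    acyclic. Only the component of the right dimension of the bounding chain matters. *)
Lemma chain_exact N u m (c : sgnv (level N) -> F) : degree_bounded N u ->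
  (forall s, c s != 0 -> good u m s) -> (forall t, bd N c t = 0) ->
  exists2 b, (forall s, b s != 0 -> good u m.+1 s) & forall t, bd N b t = c t.
Proof.
move=> ub cg cyc.
have [[s c0]|nc] := pselect (exists s, c s != 0); last first.
  have c0 s : c s = 0 by apply/eqP; apply: contraT => c0; case: nc; exists s.
  exists (fun=> 0) => [s|t]; first by rewrite eqxx.
  by rewrite c0 /Arrangement.bd big1// => s _; rewrite mul0r.
have [_ _ xP _] := goodP ub (cg s c0).
have [|//|b bQ bE] := acyclic_polytope ub xP (c := c).
  by move=> t /cg gt; rewrite (good_real ub gt) (good_in_closed_cone ub gt).
exists (fun s => if dim N s == m.+2 then b s else 0) => [t /=|t].
  case: (eqVneq (dim N t) m.+2) => [dt /bQ/andP[rt Qt]|_]; last by rewrite eqxx.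
  exact: good_closed_cone.
have [dt|dt] := eqVneq (dim N t) m.+1; first by rewrite bd_dim.
rewrite bd_dim0; last exact/eqP.
apply/esym/eqP; apply: contraT => /cg gt; have [_ _ _ dt'] := goodP ub gt.
by rewrite dt' eqxx in dt.
Qed.

(** One representative of each degree, that is of each class modulo the lattice of
    translations. *)
Definition is_canonical u := repr (\pi_(coker psi^T) u) = u.

Lemma is_canonical_repr u : is_canonical (repr (\pi_(coker psi^T) u)).
Proof. by rewrite /is_canonical reprK. Qed.

Lemma is_canonicalP u u' : is_canonical u -> is_canonical u' -> (exists w, u' - u = w *m psi^T) -> u' = u.
Proof. by move=> cu cu' /coker_eqP e; rewrite -cu -cu' e. Qed.

Definition lift_point m (sig : strata R psi m) : V :=
  sval (cid (strata_up_point (proj1 (liftP sig)))).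
Lemma lift_pointP m (sig : strata R psi m) : lift sig = stratum_of (lift_point sig).
Proof. exact: (svalP (cid (strata_up_point (proj1 (liftP sig))))). Qed.
Lemma torus_stratum_lift m (sig : strata R psi m) : val sig = torus_stratum (lift_point sig).
Proof. by have [_ <-] := liftP sig; rewrite lift_pointP. Qed.

Definition row_of_mnm (a : 'X_{1..n}) : 'rV[int]_n := \row_i (a i)%:Z.
Lemma monom_of_row a : monom_of (row_of_mnm a) = a.
Proof. by apply/mnmP => i; rewrite mnmE mxE. Qed.

(** A monomial [x^a e_sigma] has degree the class of [a + ceil (H x)], where [x] is in
    the lift of [sigma]; the translation to the canonical representative of this class
    gives the stratum from which the monomial comes. One [N] is large enough for the
    finitely many monomials involved. *)
Lemma push_decomp m (s : strata R psi m -> A) :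
  exists N (us : seq 'rV[int]_n) (c : 'rV[int]_n -> sgnv (level N) -> F),
    [/\ uniq us, forall u, u \in us -> is_canonical u /\ degree_bounded N u,
        forall u t, u \in us -> c u t != 0 -> good u m t &
        forall sig, s sig = \sum_(u <- us) push o u (c u) sig].
Proof.
have [r [ru rT] _] := fsbig_seqT (@finite_strataT R n k psi m).
pose uu (p : strata R psi m * 'X_{1..n}) :=
  repr (\pi_(coker psi^T) (row_of_mnm p.2 + ceil_vec (lift_point p.1))).
have uuP p : exists w, uu p = row_of_mnm p.2 + ceil_vec (lift_point p.1) + w *m psi^T.
  have /coker_eqP[w e] : \pi_(coker psi^T) (uu p) =
     \pi_(coker psi^T) (row_of_mnm p.2 + ceil_vec (lift_point p.1)) by rewrite reprK.
  by exists w; rewrite -e addrC subrK.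
pose ww p := sval (cid (uuP p)).
have wwP p : uu p = row_of_mnm p.2 + ceil_vec (lift_point p.1) + ww p *m psi^T := svalP (cid (uuP p)).
pose L := [seq (sig, a) | sig <- r, a <- msupp (s sig)].
have [||N NP] := @seq_bound _
    (fun p N => degree_bounded N (uu p) /\ bounded_by N (lift_point p.1 + hs (ww p))) L.
- move=> p N N' le [h1 h2]; split; last exact: bounded_by_mono le h2.
  by move=> i; apply: lt_le_trans (h1 i) _; rewrite lez_nat.
- move=> p; have [N1 h1] := degree_bounded_ex (uu p); have [N2 h2] := bounded_by_ex psi (lift_point p.1 + hs (ww p)).
  exists (maxn N1 N2); split; last by apply: bounded_by_mono h2; exact: leq_maxr.
  by move=> i; apply: lt_le_trans (h1 i) _; rewrite lez_nat leq_maxl.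
pose c u (t : sgnv (level N)) : F := if good u m t then
  \sum_(sig <- r | lies_over sig t) (eps sig (cell_point N t))%:~R * (s sig)@_(monom_of (u - ceil_vec (cell_point N t)))
  else 0.
have overE (t : sgnv (level N)) (sig : strata R psi m) : val sig = torus_stratum (cell_point N t) ->
    forall sig' : strata R psi m, lies_over sig' t = (sig' == sig).
  move=> e sig'; apply/asboolP/eqP => [e'|->//].
  by apply: val_inj; rewrite e' e.
have cE u (t : sgnv (level N)) (sig : strata R psi m) : good u m t -> val sig = torus_stratum (cell_point N t) ->
    c u t = (eps sig (cell_point N t))%:~R * (s sig)@_(monom_of (u - ceil_vec (cell_point N t))).
  move=> gt tx; rewrite /c gt (eq_bigl (pred1 sig)); last by move=> sig'; exact: overE.
  by rewrite -big_filter filter_pred1_uniq// big_seq1.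
exists N, (undup [seq uu p | p <- L]), c; split; first exact: undup_uniq.
- move=> u; rewrite mem_undup => /mapP[p pL ->].
  by split; [exact: is_canonical_repr|have [] := NP p pL].
- by move=> u t _; rewrite /c; case: ifP; rewrite ?eqxx.
move=> sig; apply/mpolyP => a; rewrite raddf_sum /=.
have [a0|a0] := eqVneq (s sig)@_a 0.
  rewrite a0 big1// => u _; rewrite /push raddf_sum big1//= => t /andP[gt /asboolP tx].
  rewrite mcoeffZ mcoeffX; case: eqP => [e|_]; last by rewrite mulr0.
  by rewrite (cE _ _ sig)// e a0 mulr0 !mul0r.
pose p := (sig, a).
have pL : p \in L.
  by apply/allpairsPdep; exists sig, a; rewrite rT mcoeff_msupp a0.
have uL : uu p \in undup [seq uu p | p <- L] by rewrite mem_undup map_f.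
have [ub bx] := NP p pL; set x := lift_point p.1 + hs (ww p) in bx.
have xE : uu p - ceil_vec x = row_of_mnm a by rewrite ceil_vecD wwP opprD addrACA addrK subrr addr0.
have imx : val sig = torus_stratum x by rewrite torus_stratumT torus_stratum_lift.
have xP : in_polytope psi N (uu p) x.
  move=> i; split; first exact: bounded_by_lo.
  apply: le_trans (ceil_ge _) _; rewrite ler_int -subr_ge0.
  by have := congr1 (fun v : 'rV_n => v 0 i) xE; rewrite !mxE => ->.
have gx : good (uu p) m (cell N (hat x)).
  apply: good_cell => //; apply/(strata_upP _ bx).
  by apply/strata_upT; rewrite -lift_pointP; have [] := liftP sig.
have [xx' ex'] := cell_pointP bx.
have tx : val sig = torus_stratum (cell_point N (cell N (hat x))).
  by rewrite imx /torus_stratum (proj2 (stratum_ofP _ _ _) xx').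
have aE : a = monom_of (uu p - ceil_vec (cell_point N (cell N (hat x)))).
  by rewrite -(ceil_vec_same xx') xE monom_of_row.
rewrite (bigD1_seq (uu p))//= ?undup_uniq// big1_seq ?addr0; last first.
  move=> u /andP[up]; rewrite mem_undup => /mapP[q qL uq].
  rewrite {1}aE (push_coef finC o (u := uu p) _ ub)//; last first.
  - by apply: is_canonicalP; rewrite ?uq; exact: is_canonical_repr.
  - by rewrite uq; have [] := NP q qL.
  by rewrite (negbTE up).
rewrite {2}aE (push_coef finC o (u := uu p) _ ub)// eqxx (cE _ _ sig)// -aE.
rewrite mulrAC -intrM.
have [_ [b bb]] : strata_up psi m (stratum_of (cell_point N (cell N (hat x)))).
  rewrite -(proj2 (stratum_ofP _ _ _) xx'); apply/strata_upT; rewrite -lift_pointP.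
  by have [] := liftP sig.
by rewrite (eps_sqr oP tx bb) mul1r.
Qed.

End Exact.

Section MonoidAlgebraTheory.
Variables (K : nmodType) (F : comNzRingType).
Implicit Types (a b : F) (c : K).
Local Notation B := (monoid_algebra K F).

Lemma ma_monomialM a b c c' :
  (ma_monomial a c : B) * ma_monomial b c' = ma_monomial (a * b) (c + c').
Proof. exact: ma_mulUU. Qed.

Lemma ma_charD c c' : (ma_char F c : B) * ma_char F c' = ma_char F (c + c').
Proof. by rewrite /ma_char ma_monomialM mulr1. Qed.

Lemma ma_const_char a c : (ma_const K a : B) * ma_char F c = ma_monomial a c.
Proof. by rewrite /ma_const /ma_char ma_monomialM mulr1 add0r. Qed.

Lemma ma_charX c j : (ma_char F c : B) ^+ j = ma_char F (c *+ j).
Proof.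
elim: j => [|j IH]; first by rewrite expr0 mulr0n.
by rewrite exprS IH ma_charD mulrS.
Qed.

Lemma ma_char_prod (I : Type) (r : seq I) (E : I -> K) :
  \prod_(i <- r) (ma_char F (E i) : B) = ma_char F (\sum_(i <- r) E i).
Proof.
elim: r => [|i r IH]; first by rewrite !big_nil.
by rewrite !big_cons IH ma_charD.
Qed.

Lemma ma_coeff_sum c (I : Type) (r : seq I) (P : pred I) (E : I -> B) :
  monalg.mcoeff c (\sum_(i <- r | P i) E i) = \sum_(i <- r | P i) monalg.mcoeff c (E i).
Proof.
elim/big_rec2: _ => [|i y1 y2 _ <-]; first exact: monalg.mcoeff0.
by rewrite monalg.mcoeffD.
Qed.

End MonoidAlgebraTheory.

Section ModuleResolution.
Variables (R : realType) (n k : nat) (psi : 'M[int]_(n, k)).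
Hypothesis finC : finite_set [set: coker psi].
Variables (o : forall m, strata R psi m -> 'M[R]_(m, k) -> int).
Variables (lift : forall m, strata R psi m -> set 'rV[R]_k).
Hypotheses (oP : is_orientation o) (liftP : is_lift lift).
Local Notation F := (complex R).
Local Notation A := {mpoly F[n]}.
Local Notation V := 'rV[R]_k.
Implicit Types (x y z : V) (w : 'rV[int]_k) (i : 'I_n) (u : 'rV[int]_n).
Local Notation H i x := (eval_psi psi i x).
Local Notation hs := (map_mx intr).
Local Notation ss := (same_stratum psi).
Local Notation stratum_of := (stratum_of psi).
Local Notation torus_stratum := (torus_stratum psi).
Local Notation bounded_by := (bounded_by psi).
Local Notation ceil_vec := (ceil_vec psi).
Local Notation eps := (eps o).
Local Notation level := (level n).
Local Notation level_form N := (@level_form R n k psi N).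
Local Notation cell N := (Arrangement.cell (level_form N) [set: level N]%SET).
Local Notation dim N := (Arrangement.dim (level_form N) [set: level N]%SET).
Local Notation inc N := (Arrangement.inc (level_form N) [set: level N]%SET).
Local Notation bd N := (Arrangement.bd (level_form N) [set: level N]%SET).
Local Notation real N := (Arrangement.real (level_form N) [set: level N]%SET).
Local Notation good := (@good R n k psi _).
Local Notation D := (hhl_coeff F o lift).
Local Notation cell_point N := (@cell_point R n k psi N).

Local Notation lift_point := (lift_point liftP).

Lemma mod_diff_seq m : exists2 r : seq (strata R psi m.+1),
  uniq r /\ (forall sig, sig \in r) &
  forall s tau, mod_diff D s tau = \sum_(sig <- r) D m sig tau * s sig.
Proof.
have [r rP rE] := fsbig_seqT (@finite_strataT R n k psi m.+1).
by exists r => // s tau; exact: rE.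
Qed.

Lemma mod_diff_sum m (us : seq 'rV[int]_n) (f : 'rV[int]_n -> strata R psi m.+1 -> A) s tau :
  (forall sig, s sig = \sum_(u <- us) f u sig) ->
  mod_diff D s tau = \sum_(u <- us) mod_diff D (f u) tau.
Proof.
move=> sE; have [r _ rE] := mod_diff_seq m.
under [RHS]eq_bigr do rewrite rE.
by rewrite rE exchange_big /=; apply: eq_bigr => sig _; rewrite sE mulr_sumr.
Qed.

Lemma hhl_diff_diff m (s : strata R psi m.+2 -> A) tau :
  mod_diff D (mod_diff D s) tau = 0.
Proof.
have [N [us [c [uus ub cg sE]]]] := push_decomp finC oP liftP s.
have dE sig : mod_diff D s sig = \sum_(u <- us) push o u (bd N (c u)) sig.
  rewrite (mod_diff_sum _ sE); apply: eq_big_seq => u uu.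
  by apply: (push_diff oP liftP (proj2 (ub u uu))) => t; apply: cg.
rewrite (mod_diff_sum _ dE) big1_seq// => u /= uu; have [_ ubu] := ub u uu.
rewrite (push_diff oP liftP ubu); last first.
  by apply: bd_good => // t; apply: cg.
rewrite /push big1// => t _; by rewrite bd_bd mul0r scale0r.
Qed.

Lemma push_bound m (N : nat) (us : seq 'rV[int]_n) (c : 'rV[int]_n -> sgnv (level N) -> F)
    (s : strata R psi m -> A) :
  (forall u, u \in us -> degree_bounded N u) ->
  (forall u t, u \in us -> c u t != 0 -> good u m t) ->
  (forall sig, s sig = \sum_(u <- us) push o u (c u) sig) ->
  (forall u, u \in us -> forall t, bd N (c u) t = 0) ->
  exists t, forall sig, mod_diff D t sig = s sig.
Proof.
move=> ub cg sE cyc.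
have ex u : exists b : sgnv (level N) -> F, u \in us ->
    (forall t, b t != 0 -> good u m.+1 t) /\ forall t, bd N b t = c u t.
  case: (boolP (u \in us)) => [uu|_]; last by exists (fun=> 0).
  have [b bg bE] := chain_exact finC (ub u uu) (fun t => cg u t uu) (cyc u uu).
  by exists b.
pose b u := sval (cid (ex u)).
have bP u : u \in us -> (forall t, b u t != 0 -> good u m.+1 t) /\
    forall t, bd N (b u) t = c u t := svalP (cid (ex u)).
exists (fun sig => \sum_(u <- us) push o u (b u) sig) => sig.
rewrite (@mod_diff_sum _ us (fun u => push o u (b u)) _ sig)//.
rewrite sE; apply: eq_big_seq => u uu; have [bg bE] := bP u uu.
rewrite (push_diff oP liftP (ub u uu))// /push.
by apply: eq_bigr => t _; rewrite bE.
Qed.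

(** The coefficients of the differential of a cycle separate its multigraded pieces and,
    within each of them, the cells. So each piece is a cycle of the cellular chain
    complex. *)
Lemma hhl_exact m (s : strata R psi m.+1 -> A) :
  (forall tau, mod_diff D s tau = 0) -> exists t, forall sig, mod_diff D t sig = s sig.
Proof.
move=> cyc; have [N [us [c [uus ub cg sE]]]] := push_decomp finC oP liftP s.
apply: (push_bound (us := us) (c := c)) => // [u /ub[]//|u uu t].
have [cu ubu] := ub u uu.
apply/eqP; apply: contraT => b0.
have gt : good u m t by apply: (bd_good finC ubu _ b0) => s'; apply: cg.
have [tau tx] := good_strata ubu gt.
have := cyc tau; rewrite (mod_diff_sum _ sE).
rewrite (eq_big_seq (fun u => push o u (bd N (c u)) tau)); last first.
  move=> u' uu'; apply: (push_diff oP liftP (proj2 (ub u' uu'))) => t'.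
  exact: cg.
move=> /(congr1 (fun p : A => p@_(monom_of (u - ceil_vec (cell_point N t))))).
rewrite mcoeff0 raddf_sum /= (bigD1_seq u)//= big1_seq ?addr0; last first.
  move=> u' /andP[u'u uu']; have [cu' ubu'] := ub u' uu'.
  rewrite (push_coef finC o (u := u) _ ubu)//; last exact: is_canonicalP.
  by rewrite (negbTE u'u).
rewrite (push_coef finC o (u := u) _ ubu)// eqxx.
have [et bx xP dt] := goodP ubu gt.
have [_ [b bb]] : strata_up psi m (stratum_of (cell_point N t)) by apply/(strata_upP _ bx); rewrite et.
move=> /(congr1 (fun a => a * (eps tau (cell_point N t))%:~R)).
by rewrite mul0r -mulrA -intrM (eps_sqr oP tx bb) mulr1 => e; rewrite e eqxx in b0.
Qed.

(** * The augmentation *)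

Local Notation B := (Yring R psi).
Local Notation f := (Ymap R psi).
Local Notation CM := (CM R psi).

Lemma in_coneP u x : (forall i, H i x <= (u 0 i)%:~R) ->
  in_cone R (\pi_(dual_coker psi) u).
Proof.
move=> xu; apply/asboolP; exists u; split=> //.
exists (map_mx intr u - x *m (map_mx intr psi)^T), x; split; last by rewrite subrK.
by move=> i; rewrite !mxE subr_ge0 -[leLHS]/(\sum_j _) ; have := xu i; rewrite /eval_psi mxE.
Qed.

Lemma ceil_vec_in_cone x : in_cone R (\pi_(dual_coker psi) (ceil_vec x)).
Proof. by apply: (@in_coneP _ x) => i; rewrite mxE; exact: ceil_ge. Qed.

Definition ceil_class x : CM := Sub _ (ceil_vec_in_cone x).

(** The monomial of any degree in [M], zero for the degrees outside the cone. *)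
Definition monomial_at (a : F) (c : dual_coker psi) : B :=
  if insub c is Some c' then ma_monomial a c' else 0.

Lemma YmapX (a : 'X_{1..n}) : exists2 c : CM,
  val c = \pi_(dual_coker psi) (row_of_mnm a) & f 'X_[a] = ma_char F c.
Proof.
exists (\sum_i dual_basis_class R psi i *+ a i).
  rewrite raddf_sum.
  transitivity (\sum_i \pi_(dual_coker psi) (delta_mx 0 i *+ a i : 'rV[int]_n)).
    by apply: eq_bigr => i _; rewrite !raddfMn.
  rewrite -raddf_sum; congr (\pi_(dual_coker psi) _); apply/rowP => j.
  rewrite summxE mxE (bigD1 j)//= big1 ?addr0 => [|i /negbTE ij].
    by rewrite mulmxnE !mxE !eqxx /= mulr1n natz.
  by rewrite mulmxnE mxE eqxx eq_sym ij mul0rn.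
rewrite /Ymap /= mmapX /mmap1 -ma_char_prod.
by apply: eq_bigr => i _; rewrite ma_charX.
Qed.

Lemma monomial_at_val a (c : CM) : monomial_at a (val c) = ma_monomial a c.
Proof. by rewrite /monomial_at valK. Qed.

Lemma monomial_atD a b c : monomial_at (a + b) c = monomial_at a c + monomial_at b c.
Proof.
rewrite /monomial_at; case: insub => [c'|]; last by rewrite addr0.
by rewrite /ma_monomial monalg.monalgUD.
Qed.

Lemma monomial_at0 c : monomial_at 0 c = 0.
Proof. by rewrite /monomial_at; case: insub => [c'|//]; rewrite /ma_monomial monalg.monalgU0. Qed.

Lemma monomial_at_sum (I : Type) (r : seq I) (E : I -> F) c :
  monomial_at (\sum_(i <- r) E i) c = \sum_(i <- r) monomial_at (E i) c.
Proof. exact: (big_morph (fun a => monomial_at a c) (fun a b => monomial_atD a b c) (monomial_at0 c)). Qed.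

(** A vertex is sent to the monomial of its degree. The sign of its orientation makes
    edges, whose ends have opposite boundary signs, go to zero. *)
Definition aug_elt (tau : strata R psi 0) : B :=
  ma_monomial (o tau 0)%:~R (ceil_class (lift_point tau)).
Local Notation aug := (@mod_aug A B f (fun m => set_type (strata R psi m) : choiceType) aug_elt).

(** The degree of the vertex and that of the monomial add up to the class of [u],
    whatever the chosen lift. *)
Lemma aug_mono (tau : strata R psi 0) u y (a : F) : val tau = torus_stratum y ->
  (forall i, 0 <= (u - ceil_vec y) 0 i) ->
  aug_elt tau * f (a *: 'X_[monom_of (u - ceil_vec y)]) =
  monomial_at ((o tau 0)%:~R * a) (\pi_(dual_coker psi) u).
Proof.
move=> ty pos; have [w xy] : exists w, ss (lift_point tau + hs w) y.
  by apply/torus_stratumP; rewrite -torus_stratum_lift.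
have [c cE fX] := YmapX (monom_of (u - ceil_vec y)).
have cy : ceil_vec y = ceil_vec (lift_point tau) + w *m psi^T by rewrite -ceil_vecD; apply/esym/ceil_vec_same.
have rE : row_of_mnm (monom_of (u - ceil_vec y)) = u - ceil_vec y.
  apply/rowP => i; rewrite !mxE mnmE; have := pos i; rewrite !mxE => h.
  by rewrite gez0_abs.
have vE : val (ceil_class (lift_point tau) + c) = \pi_(dual_coker psi) u.
  have -> : val (ceil_class (lift_point tau) + c) = val (ceil_class (lift_point tau)) + val c by rewrite raddfD.
  rewrite cE -[val _]/(\pi_(dual_coker psi) (ceil_vec (lift_point tau))) -raddfD.
  apply/coker_eqP; exists (- w).
  rewrite rE cy mulNmx; move: (w *m psi^T) (ceil_vec (lift_point tau)) => v1 v2.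
  by apply/rowP => i; rewrite !mxE; ring.
have fC : f a%:MP = ma_const CM a by exact: mmapC.
have fE : f (a *: 'X_[monom_of (u - ceil_vec y)]) = ma_monomial a c.
  by rewrite -mul_mpolyC rmorphM fX fC; exact: ma_const_char.
rewrite -vE monomial_at_val fE; exact: ma_monomialM.
Qed.

(** The direction of the origin is trivial, so that the incidence of a ray with the
    origin is the canonical orientation of the ray. *)
Lemma inc_zero N u (t : sgnv (level N)) (tau : strata R psi 0) : degree_bounded N u ->
  good u 0 t -> val tau = torus_stratum (cell_point N t) ->
  inc N t (cell N 0) = o tau 0 * eps tau (cell_point N t).
Proof.
move=> ub gt tx; have [et bx xP dt] := goodP ub gt; set x := cell_point N t in et bx tx *.
have [_ [b bb]] : strata_up psi 0 (stratum_of x) by apply/(strata_upP _ bx); rewrite et.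
have b0 : b = 0 by apply/matrixP => -[].
rewrite b0 in bb.
rewrite (epsE oP tx (same_stratum_refl psi x) bb) mulrA (o_sqr oP tx bb) mul1r.
have f0 : face (cell N 0) (cell N (hat x)).
  by apply/faceP => j; left; rewrite cell_in ?inE// ev0; apply/sg3_None.
have d0 := dim_cell0 R finC N.
have [bf bL] := (direction_basisP _ bx).1 bb.
rewrite -et (incE (real_cell _ _ _) f0 (b := emb (0 : 'M[R]_(0, k)))).
- suff -> : ori (emb (0 : 'M[R]_(0, k))) = 1 by rewrite mulr1.
  rewrite /ori; case: pickP => [g _|]; first by rewrite det_mx00 sgz1.
  by move=> /(_ [ffun=> ord0]); rewrite det_mx00 oner_eq0.
- by rewrite et dt d0.
- by rewrite row_free_emb.
- apply/eqmxP; rewrite (_ : Arrangement.dir _ _ _ = 0) ?sub0mx ?andbT.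
    by apply/row_subP => -[].
  by apply/eqP; rewrite -mxrank_eq0; apply/eqP.
Qed.

Lemma aug_seq : exists2 r : seq (strata R psi 0),
  uniq r /\ (forall tau, tau \in r) &
  forall s, aug s = \sum_(tau <- r) aug_elt tau * f (s tau).
Proof.
have [r rP rE] := fsbig_seqT (@finite_strataT R n k psi 0).
by exists r => // s; exact: rE.
Qed.

(** In each degree the augmentation is the coefficient of the boundary at the cell of
    the origin. *)
Lemma aug_push N u (c : sgnv (level N) -> F) : degree_bounded N u ->
  (forall t, c t != 0 -> good u 0 t) ->
  aug (push o u c) = monomial_at (bd N c (cell N 0)) (\pi_(dual_coker psi) u).
Proof.
move=> ub cg; have [r [ru rT] rE] := aug_seq.
rewrite rE /push /Arrangement.bd monomial_at_sum.
transitivity (\sum_(tau <- r) \sum_(t | good u 0 t && lies_over tau t)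
   monomial_at (c t * (inc N t (cell N 0))%:~R) (\pi_(dual_coker psi) u)).
  apply: eq_bigr => tau _; rewrite raddf_sum mulr_sumr.
  apply: eq_bigr => t /andP[gt /asboolP tx]; have [_ bx xP _] := goodP ub gt.
  rewrite (aug_mono _ tx (fun i => ceil_vec_le i xP)).
  by rewrite (inc_zero ub gt tx) intrM mulrCA.
rewrite (exchange_big_dep xpredT)//=; apply: eq_bigr => t _.
have [->|ct] := eqVneq (c t) 0; first by rewrite mul0r monomial_at0 big1.
have gt := cg t ct; have [tau tx] := good_strata ub gt.
rewrite gt /= (eq_bigl (pred1 tau)) => [|tau'].
  by rewrite -big_filter filter_pred1_uniq// big_seq1.
apply/asboolP/eqP => [e|->//].
by apply: val_inj; rewrite e tx.
Qed.

Lemma aug_sum (us : seq 'rV[int]_n) (g : 'rV[int]_n -> strata R psi 0 -> A) s :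
  (forall tau, s tau = \sum_(u <- us) g u tau) -> aug s = \sum_(u <- us) aug (g u).
Proof.
move=> sE; have [r _ rE] := aug_seq.
under [RHS]eq_bigr do rewrite rE.
by rewrite rE exchange_big /=; apply: eq_bigr => tau _; rewrite sE raddf_sum mulr_sumr.
Qed.

Lemma hhl_aug_diff (s : strata R psi 1 -> A) : aug (mod_diff D s) = 0.
Proof.
have [N [us [c [uus ub cg sE]]]] := push_decomp finC oP liftP s.
have dE sig : mod_diff D s sig = \sum_(u <- us) push o u (bd N (c u)) sig.
  rewrite (mod_diff_sum _ sE); apply: eq_big_seq => u uu.
  by apply: (push_diff oP liftP (proj2 (ub u uu))) => t; apply: cg.
rewrite (aug_sum dE) big1_seq// => u /= uu; have [_ ubu] := ub u uu.
rewrite aug_push//; last by apply: bd_good => // t; apply: cg.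
by rewrite bd_bd monomial_at0.
Qed.

Lemma cell_dim0 N (t : sgnv (level N)) : real N t -> dim N t = 0%N -> t = cell N 0.
Proof.
move=> /realP[z ->] dz.
have : (z <= Arrangement.dir (level_form N) [set: level N]%SET (cell N z))%MS by exact: cell_dir.
suff -> : Arrangement.dir (level_form N) [set: level N]%SET (cell N z) = 0 by rewrite submx0 => /eqP ->.
by apply/eqP; rewrite -mxrank_eq0; apply/eqP.
Qed.

(** Distinct canonical degrees have distinct classes. Hence the vanishing of the
    augmentation means that in each degree the boundary has no component at the origin,
    the only cell that a boundary of rays can involve. *)
Lemma hhl_exact0 (s : strata R psi 0 -> A) :
  aug s = 0 -> exists t, forall sig, mod_diff D t sig = s sig.
Proof.
move=> s0; have [N [us [c [uus ub cg sE]]]] := push_decomp finC oP liftP s.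
apply: (push_bound (us := us) (c := c)) => // [u /ub[]//|u uu t].
have [cu ubu] := ub u uu; have cgu t' : c u t' != 0 -> good u 0 t' by exact: cg.
apply/eqP; apply: contraT => b0.
have [t' [c0 i0]] := bd_neq0 b0; have gt' := cgu _ c0.
have [_ rt _ e] := inc_neq0 i0; have [_ bx xP dt'] := goodP ubu gt'.
have tE : t = cell N 0 by apply: cell_dim0 => //; apply/eqP; rewrite -eqSS -e dt'.
have uC : in_cone R (\pi_(dual_coker psi) u).
  by apply: (@in_coneP _ (cell_point N t')) => i; have [] := xP i.
pose k0 : CM := Sub _ uC.
move: s0; rewrite (aug_sum sE) (eq_big_seq (fun u => monomial_at (bd N (c u) (cell N 0))
    (\pi_(dual_coker psi) u))); last first.
  by move=> u' uu'; apply: aug_push; [exact: (proj2 (ub u' uu'))|move=> t1; exact: cg].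
rewrite (bigD1_seq u)//= -tE.
have -> : monomial_at (bd N (c u) t) (\pi_(dual_coker psi) u) = ma_monomial (bd N (c u) t) k0.
  exact: (monomial_at_val _ k0).
move=> /(congr1 (fun p : B => monalg.mcoeff k0 p)).
rewrite monalg.mcoeffD monalg.mcoeff0 monalg.mcoeffUU ma_coeff_sum big1_seq ?addr0.
  by move=> e0; rewrite e0 eqxx in b0.
move=> u' /andP[u'u uu']; rewrite /monomial_at; case: insubP => [k' _ k'E|_]; last exact: monalg.mcoeff0.
rewrite /ma_monomial monalg.mcoeffU; case: eqP => [kk|_]; last by rewrite mulr0n.
move/eqP: u'u; case; have [cu' _] := ub u' uu'; rewrite -cu' -cu.
congr (repr _); rewrite -[LHS]k'E kk; by [].
Qed.

(** For a degree in the cone the polyhedron [H <= u] is nonempty, and the cell of the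
    origin is a cycle of the closed cone over a polytope inside it. The chain which it
    bounds has the required augmentation. *)
Lemma hhl_surj (x : B) : exists s, aug s = x.
Proof.
have aug0 : aug (fun=> 0) = 0.
  by rewrite (@aug_sum [::] (fun _ _ => 0)) ?big_nil// => tau; rewrite big_nil.
have augD s1 s2 : aug (fun tau => s1 tau + s2 tau) = aug s1 + aug s2.
  have [r _ rE] := aug_seq.
  by rewrite !rE -big_split; apply: eq_bigr => tau _; rewrite rmorphD mulrDr.
rewrite [x]monalg.monalgE; elim/big_ind: _ => [|y1 y2 [s1 <-] [s2 <-]|c _].
- by exists (fun=> 0).
- by exists (fun tau => s1 tau + s2 tau).
move: (monalg.mcoeff c x) => a.
have /asboolP[u [cu [w [y [w0 uE]]]]] := valP c.
have yu i : H i y <= (u 0 i)%:~R.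
  have := congr1 (fun v : 'rV_n => v 0 i) uE; rewrite [LHS]mxE [RHS]mxE => ->.
  by rewrite lerDr.
have [N1 h1] := degree_bounded_ex u; have [N2 h2] := bounded_by_ex psi y.
pose N := maxn N1 N2.
have ub : degree_bounded N u.
  by move=> i; apply: lt_le_trans (h1 i) _; rewrite lez_nat leq_maxl.
have byy : bounded_by N y by apply: bounded_by_mono h2; exact: leq_maxr.
have yP : in_polytope psi N u y by move=> i; split; [exact: bounded_by_lo|].
pose z := cell N 0; have dz : dim N z = 0%N := dim_cell0 R finC N.
pose del (t : sgnv (level N)) : F := if t == z then a else 0.
have [||b bQ bE] := acyclic_polytope ub yP (c := del).
- move=> t; rewrite /del; case: (eqVneq t z) => [-> _|_]; last by rewrite eqxx.
  rewrite real_cell /=; apply/in_closed_cone_cell; rewrite ?finset.sub0set ?finset.subsetT//.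
  by split=> j _; rewrite ev0.
- move=> t; apply/eqP; apply: contraT => /bd_neq0[s []]; rewrite /del.
  case: (eqVneq s z) => [-> _|_]; last by rewrite eqxx.
  by move=> /inc_neq0[_ _ _]; rewrite dz.
pose b1 (s : sgnv (level N)) := if dim N s == 1%N then b s else 0.
have b1g t : b1 t != 0 -> good u 0 t.
  rewrite /b1; case: (eqVneq (dim N t) 1%N) => [dt /bQ/andP[rt Qt]|_]; last by rewrite eqxx.
  exact: good_closed_cone.
exists (push o u b1); rewrite aug_push// (bd_dim _ dz) bE /del eqxx -cu.
exact: monomial_at_val.
Qed.

End ModuleResolution.

(** The modules resolve the ring of [Y] over the whole affine space; the restriction to
    an open subset keeps this property. *)
Theorem theorem3p1 (R : realType) (n k : nat) (psi : 'M[int]_(n, k))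
    (Sigma : {set {set 'I_n}})
    (o : forall m, strata R psi m -> 'M[R]_(m, k) -> int)
    (lift : forall m, strata R psi m -> set 'rV[R]_k) :
  finite_set [set: coker psi] ->
  is_subfan Sigma ->
  is_orientation o ->
  is_lift lift ->
  is_resolution_of_pushforward (Ymap R psi) (U_fan (complex R) Sigma)
    (hhl_coeff (complex R) o lift).
Proof.
move=> finC _ oP liftP.
apply: (@resolution_of_module _ _ _ _ _ _ (aug_elt o liftP)).
- by move=> m; exact: finite_strataT.
- by move=> m s j; exact: (hhl_diff_diff finC oP liftP).
- by move=> s; exact: (hhl_aug_diff finC oP liftP).
- by move=> m s; exact: (hhl_exact finC oP liftP).
- by move=> s s0; have := hhl_exact0 finC oP s0; apply.
- by move=> x; exact: (hhl_surj finC oP liftP).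
Qed.
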